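(* Let $p \in (1,\infty)$ and let $u \in M(\psi)$ be a critical point of $\mathcal{E}$ with obstacle constraint. Then $u \in C^2([0,1])$ and $$u''(x) < 0 \ \text{ for all } x \in (0,1), \qquad u''(0)=u''(1)=0;$$ in particular $u$ is concave. Moreover: (i) If $1 < p \le 2$, then $u \in W^{3,\infty}(0,1)$ and $u''' \in BV(0,1)$, but in general $u \notin C^3(0,1)$ (i.e. there exist obstacles $\psi$ satisfying the standing assumptions such that no critical point in $M(\psi)$ lies in $C^3(0,1)$). (ii) If $p > 2$, then $u \in W^{3,q}(0,1)$ for all $q \in \bigl[1, \tfrac{p-1}{p-2}\bigr)$, and $u \notin W^{3,\frac{p-1}{p-2}}(0,1)$.
   Context: Standing assumptions: $G \in C^\infty(\mathbb{R})$ is odd, $\dot G>0$ (dots denote derivatives of $G$), and $s\mapsto s\dot G(s)$ belongs to $L^1(\mathbb{R})$. The obstacle $\psi \in C^0([0,1])$ satisfies $\psi(0)<0$, $\psi(1)<0$, and $\psi(x_0)>0$ for some $x_0\in(0,1)$. Let $p\in(1,\infty)$, $M(\psi) := \{ v \in W^{2,p}(0,1)\cap W^{1,p}_0(0,1) : v \ge \psi \text{ on } [0,1]\}$ and $\mathcal{E}(u) := \int_0^1 |(G(u'(x)))'|^p\,dx$. For $u\in W^{2,p}(0,1)$, Euler's substitution is $w_u(x) := -p\,\dot G(u'(x))^{p-1}|u''(x)|^{p-2}u''(x)$ (a.e.), an element of $L^{p/(p-1)}(0,1)$. A function $u\in M(\psi)$ is called a critical point of $\mathcal{E}$ with obstacle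 constraint if there is a Radon measure $\mu$ supported on $\{u=\psi\}$ such that $-\int_0^1 w_u(x)\,\frac{d}{dx}\bigl(\dot G(u'(x))\phi'(x)\bigr)\,dx = \int_0^1 \phi\,d\mu$ for all $\phi \in W^{2,p}(0,1)\cap W^{1,p}_0(0,1)$. *)

(* Defs.v *)
From HB Require Import structures.
From mathcomp Require Import all_boot all_order all_algebra.
From mathcomp Require Import all_classical all_reals all_analysis.
Set Implicit Arguments.
Unset Strict Implicit.
Unset Printing Implicit Defensive.
Import Order.TTheory GRing.Theory Num.Theory.
Import numFieldNormedType.Exports.
Local Open Scope classical_set_scope.
Local Open Scope ring_scope.

Section Defs.
Variable R : realType.
Local Notation leb := (@lebesgue_measure R).
Local Notation I01 := (`]0%R, 1%R[%classic : set R).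
Local Notation J01 := (`[0%R, 1%R]%classic : set R).

Definition smooth (f : R -> R) : Prop :=
  forall (n : nat) (x : R), derivable (derive1n n f) x 1.

Definition test_fun (phi : R -> R) : Prop :=
  smooth phi /\
  exists a b : R, 0 < a /\ a < b /\ b < 1 /\
    (forall x, (x < a \/ b < x) -> phi x = 0).

Definition weak_deriv (f g : R -> R) : Prop :=
  leb.-integrable I01 (EFin \o f) /\
  leb.-integrable I01 (EFin \o g) /\
  forall phi, test_fun phi ->
    (\int[leb]_(x in I01) (f x * derive1 phi x)%:E
     = - \int[leb]_(x in I01) (g x * phi x)%:E)%E.

Definition in_Lq (q : R) (f : R -> R) : Prop :=
  measurable_fun I01 f /\
  (\int[leb]_(x in I01) (`|f x| `^ q)%:E < +oo)%E.

Definition in_Linf (f : R -> R) : Prop :=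
  measurable_fun I01 f /\
  exists M : R, leb [set x | I01 x /\ M < `|f x|] = 0%E.

Definition sobolev_witness (k : nat) (inX : (R -> R) -> Prop)
    (u : R -> R) (g : nat -> R -> R) : Prop :=
  g 0%N = u /\
  (forall j : nat, (j <= k)%N -> inX (g j)) /\
  (forall j : nat, (j < k)%N -> weak_deriv (g j) (g j.+1)).

Definition in_W (k : nat) (q : R) (u : R -> R) : Prop :=
  exists g, sobolev_witness k (in_Lq q) u g.
Definition in_Winf (k : nat) (u : R -> R) : Prop :=
  exists g, sobolev_witness k in_Linf u g.

(** BV(0,1): integrable with finite total variation of the distributional
    derivative (sup over test functions with |phi| <= 1). *)
Definition in_BV (f : R -> R) : Prop :=
  leb.-integrable I01 (EFin \o f) /\
  exists C : R, forall phi, test_fun phi -> (forall x, `|phi x| <= 1) ->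
    (`| \int[leb]_(x in I01) (f x * derive1 phi x)%:E | <= C%:E)%E.

Definition standing_G (G : R -> R) : Prop :=
  smooth G /\
  (forall s, G (- s) = - G s) /\
  (forall s, 0 < derive1 G s) /\
  leb.-integrable setT (fun s => (s * derive1 G s)%:E).

Definition obstacle (psi : R -> R) : Prop :=
  {within J01, continuous psi} /\
  psi 0 < 0 /\ psi 1 < 0 /\
  exists x0, 0 < x0 /\ x0 < 1 /\ 0 < psi x0.

(** W^{2,p}(0,1) ∩ W^{1,p}_0(0,1), identified with the continuous
    representative on [0,1]; u1, u2 are its first two weak derivatives. *)
Definition W2p_W1p0 (p : R) (u u1 u2 : R -> R) : Prop :=
  {within J01, continuous u} /\ u 0 = 0 /\ u 1 = 0 /\
  sobolev_witness 2 (in_Lq p) u (fun j => match j with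
                                          | 0%N => u | 1%N => u1 | _ => u2 end).

Definition in_M (p : R) (psi u : R -> R) : Prop :=
  (exists u1 u2, W2p_W1p0 p u u1 u2) /\ forall x, J01 x -> psi x <= u x.

Definition euler_w (G : R -> R) (p : R) (u1 u2 : R -> R) (x : R) : R :=
  - p * (derive1 G (u1 x)) `^ (p - 1) * (`|u2 x| `^ (p - 2) * u2 x).

(** Critical point of E with obstacle constraint.  The derivative
    d/dx (Gdot(u') phi') is written out by the product/chain rule as
    Gddot(u') u'' phi' + Gdot(u') phi''. *)
Definition critical_point (G : R -> R) (p : R) (psi u : R -> R) : Prop :=
  in_M p psi u /\
  exists (u1 u2 : R -> R) (mu : {measure set (measurableTypeR R) -> \bar R}),
    W2p_W1p0 p u u1 u2 /\
    (mu J01 < +oo)%E /\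
    mu (~` [set x | J01 x /\ u x = psi x]) = 0%E /\
    forall phi phi1 phi2 : R -> R, W2p_W1p0 p phi phi1 phi2 ->
      (\int[leb]_(x in I01)
          (- euler_w G p u1 u2 x *
             ((derive1n 2 G) (u1 x) * u2 x * phi1 x + derive1 G (u1 x) * phi2 x))%:E
       = \int[mu]_(x in J01) (phi x)%:E)%E.

Definition C2_closed (u u1 u2 : R -> R) : Prop :=
  (forall x, I01 x -> is_derive x 1 u (u1 x) /\ is_derive x 1 u1 (u2 x)) /\
  {within J01, continuous u} /\
  {within J01, continuous u1} /\
  {within J01, continuous u2}.

Definition C3_open (u : R -> R) : Prop :=
  exists u1 u2 u3 : R -> R,
    (forall x, I01 x ->
       is_derive x 1 u (u1 x) /\ is_derive x 1 u1 (u2 x) /\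
       is_derive x 1 u2 (u3 x)) /\
    {in I01, continuous u3}.

Definition concave_on01 (u : R -> R) : Prop :=
  forall x y t, J01 x -> J01 y -> 0 <= t -> t <= 1 ->
    t * u x + (1 - t) * u y <= u (t * x + (1 - t) * y).

End Defs.

(* Main.v *)
(* Write A = G'(u') and let m(t) be the mass that the obstacle measure puts on
   [t, 1]. Testing the critical point equation with phi'' = k for arbitrary
   bounded k shows that w A is a.e. equal to an absolutely continuous function
   vanishing at 0 and 1. Hence w, and then u'', is continuous, and
   w' = (m - c) / A with w(0) = w(1) = 0 for a constant c. As m is
   nonincreasing, constant near 0 and near 1, and not constant (u is not
   affine), w first increases and then decreases, and w >= kappa x (1 - x).
   So u'' = - (w / p)^(1/(p-1)) / A is negative inside and zero at the ends, and
   u''' = - C w^(1/(p-1) - 1) (m - c) / A^2 + a Lipschitz multiple of w^(2/(p-1)).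
   For p <= 2 this is a product of bounded functions that are differences of
   monotone ones; for p > 2 it behaves like x^(-(p-2)/(p-1)) at the ends.
   For the tent obstacle, strict concavity forces the contact set into the
   single point 1/2, so m jumps there and w has a kink. *)
Require Import Defs.
From HB Require Import structures.
From mathcomp Require Import all_boot all_order all_algebra.
From mathcomp Require Import all_classical all_reals all_analysis.
From mathcomp Require Import measurable_realfun ring lra.
Set Implicit Arguments.
Unset Strict Implicit.
Unset Printing Implicit Defensive.
Import Order.TTheory GRing.Theory Num.Theory.
Import numFieldNormedType.Exports.
Local Open Scope classical_set_scope.
Local Open Scope ring_scope.

(** * Calculus of Lipschitz primitives *)

(** The tail mass [m] is only monotone, so [W] is Lipschitz but need not be differentiable
    everywhere. The calculus is therefore done with pairs of a function and an integrable density
    ([prim]), which are stable under products and under outer C^1 maps once the densities are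
    bounded. The equation for [W] is this short because of a cancellation. With phi'' = k, Fubini
    turns the integral of phi against the obstacle measure into that of phi' m. Since phi' is an
    arbitrary mean-zero primitive, w A gets the density D - c, where D = m + w G''(u') u'' and c is
    the integral of D. Dividing by A adds - w G''(u') u'' / A, which cancels the second term of D.
    Two passes are necessary: at first u'' is only in L^p and D only integrable. This already makes
    w A, hence w and u'', continuous, and only then are the densities bounded as the product rule
    demands. *)

Section primitives.
Context {R : realType}.
Local Notation leb := (@lebesgue_measure R).
Implicit Types (a b x y s t d e l K : R) (f g F : R -> R).

(** Absolute continuity of f on the closed interval, with the density g as data. No pointwise
    derivative is claimed, so g may jump. *)
Definition prim a b f g : Prop :=
  leb.-integrable `[a, b] (EFin \o g) /\
  forall x y, a <= x -> x <= y -> y <= b ->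
    f y - f x = \int[leb]_(t in `[x, y]) g t.

Lemma integrable_sub a b x y g : leb.-integrable `[a, b] (EFin \o g) ->
  a <= x -> y <= b -> leb.-integrable `[x, y] (EFin \o g).
Proof.
move=> ig ax yb; apply: integrableS ig => //.
by apply: subset_itv; rewrite bnd_simp.
Qed.

Lemma Rintegral_cat a x b g : leb.-integrable `[a, b] (EFin \o g) ->
  a <= x -> x <= b ->
  \int[leb]_(t in `[a, b]) g t =
  \int[leb]_(t in `[a, x]) g t + \int[leb]_(t in `[x, b]) g t.
Proof.
move=> ig ax xb.
have := @Rintegral_itvB R g (BLeft a) (BRight b) x ig.
rewrite !bnd_simp => /(_ ax xb).
rewrite Rintegral_itv_obnd_cbnd; last first.
  by apply: integrableS ig => //; apply: subset_itv; rewrite bnd_simp.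
by move=> <-; rewrite subrKC.
Qed.

Lemma integrable_bounded a b K g : measurable_fun `[a, b] g ->
  (forall x, a <= x -> x <= b -> `|g x| <= K) ->
  leb.-integrable `[a, b] (EFin \o g).
Proof.
move=> mg gK; apply: measurable_bounded_integrable => //=.
  have := lebesgue_measure_itv `[a, b] => /= ->.
  by case: ifP => // _; rewrite -EFinB ltry.
exists K; split; first exact: num_real.
move=> L KL x /=; rewrite in_itv/= => /andP[ax xb].
by rewrite (le_trans (gK _ ax xb))// ltW.
Qed.

Lemma norm_Rintegral_le x y K g : x <= y ->
  leb.-integrable `[x, y] (EFin \o g) ->
  (forall t, x <= t -> t <= y -> `|g t| <= K) ->
  `|\int[leb]_(t in `[x, y]) g t| <= K * (y - x).
Proof.
move=> xy ig gK.
apply: (le_trans (le_normr_Rintegral _ ig)) => //.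
have -> : K * (y - x) = \int[leb]_(t in `[x, y]) K.
  rewrite Rintegral_cst//.
  have := lebesgue_measure_itv `[x, y] => /= ->; rewrite lte_fin.
  case: ltP => //= yx; have -> : y = x by apply/eqP; rewrite eq_le xy yx.
  by rewrite subrr.
apply: le_Rintegral => //.
- exact: (@integrable_norm _ _ _ leb `[x, y] g).
- apply: (@integrable_bounded _ _ `|K|) => //.
- by move=> t /=; rewrite in_itv/= => /andP[]; exact: gK.
Qed.

Lemma prim_lipschitz a b f g K : prim a b f g ->
  (forall t, a <= t -> t <= b -> `|g t| <= K) ->
  forall x y, a <= x -> x <= b -> a <= y -> y <= b ->
    `|f y - f x| <= K * `|y - x|.
Proof.
move=> [ig fg] gK.
suff H x y : a <= x -> x <= y -> y <= b -> `|f y - f x| <= K * `|y - x|.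
  move=> x y ax xb ay yb; have [xy|yx] := leP x y; first exact: H.
  by rewrite distrC [`|y - x|]distrC; apply: H => //; exact: ltW.
move=> ax xy yb; rewrite fg// (ger0_norm (_ : 0 <= y - x)) ?subr_ge0//.
apply: norm_Rintegral_le => //; first exact: integrable_sub ig _ _.
by move=> t xt ty; apply: gK; [exact: le_trans xt|exact: le_trans yb].
Qed.

Lemma prim_sub a b x y f g : prim a b f g -> a <= x -> y <= b -> prim x y f g.
Proof.
move=> [ig fg] ax yb; split; first exact: integrable_sub ig _ _.
move=> s t xs st ty; apply: fg => //; first exact: le_trans xs.
exact: le_trans yb.
Qed.

(** Lets a function on [a, b] be extended to the line by projection without enlarging its
    increments. *)
Lemma clamp_dist a b x y : a <= b ->
  `|Num.max a (Num.min b y) - Num.max a (Num.min b x)| <= `|y - x|.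
Proof.
move=> ab; pose cl z := Num.max a (Num.min b z).
have clP z : [\/ z <= a /\ cl z = a, (a <= z) && (z <= b) /\ cl z = z
    | b <= z /\ cl z = b].
  rewrite /cl; have [bz|zb] := leP b z; first by apply: Or33; rewrite max_r.
  by have [za|az] := leP z a; [apply: Or31|apply: Or32; rewrite (ltW az) (ltW zb)].
rewrite -/(cl y) -/(cl x).
have := ler_norm (y - x); have := ler_norm (x - y); rewrite (distrC x y).
rewrite ler_norml; move=> H1 H2.
by have [[? ->]|[/andP[? ?] ->]|[? ->]] := clP x;
  have [[? ->]|[/andP[? ?] ->]|[? ->]] := clP y; apply/andP; split; lra.
Qed.

(** Composing with the projection onto [a, b] extends f to the line. The hypothesis then gives a
    zero two-sided derivative at every point, the ends included. *)
Lemma zero_derivative_endpoints a b f : a <= b ->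
  (forall x e, a <= x -> x <= b -> 0 < e -> exists2 d : R, 0 < d &
     forall y, a <= y -> y <= b -> `|y - x| < d ->
       `|f y - f x| <= e * `|y - x|) ->
  f b = f a.
Proof.
move=> ab H.
pose cl x := Num.max a (Num.min b x).
have cla x : a <= cl x by rewrite /cl le_max lexx.
have clb x : cl x <= b by rewrite /cl ge_max ab ge_min lexx.
have -> : f b = (f \o cl) b by rewrite /= /cl minxx max_r.
have -> : f a = (f \o cl) a by rewrite /= /cl (min_r ab) maxxx.
apply: is_derive_0_is_cst => x.
have Hx : h^-1 *: ((f \o cl) (h *: 1 + x) - (f \o cl) x) @[h --> 0^'] --> 0.
  apply/cvgrPdist_le => e e0.
  have [d d0 Hd] := H _ e (cla x) (clb x) e0.
  near=> h; rewrite sub0r normrN /= /GRing.scale /= mulr1.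
  rewrite normrM normfV ler_pdivrMl; last first.
    by rewrite normr_gt0; near: h; exact: nbhs_dnbhs_neq.
  have hx := @clamp_dist a b x (h + x) ab.
  rewrite addrK in hx.
  rewrite mulrC (le_trans (Hd _ (cla _) (clb _) _))//.
    apply: (le_lt_trans hx); near: h.
    by apply: dnbhs0_lt.
  by rewrite ler_pM2l.
by apply: DeriveDef; [apply/cvg_ex; exists 0|exact/cvg_lim].
Unshelve. all: by end_near. Qed.

End primitives.

(** * Chain rule for functions given by a bounded density *)

Section primitive_calculus.
Context {R : realType}.
Local Notation leb := (@lebesgue_measure R).
Implicit Types (a b x y s t d e l K : R) (f g h F : R -> R).

Lemma within_continuous_dist a b h : {within `[a, b], continuous h} <->
  forall s e, a <= s -> s <= b -> 0 < e -> exists2 d : R, 0 < d &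
    forall t, a <= t -> t <= b -> `|t - s| < d -> `|h t - h s| < e.
Proof.
split=> [/subspace_continuousP ch s e as_ sb e0|H].
  have /ch : `[a, b]%classic s by rewrite /= in_itv/= as_ sb.
  move=> /cvgrPdist_lt/(_ _ e0); rewrite near_withinE.
  move=> /nbhs_ballP[d /= d0 Hd]; exists d => // t a_t tb ts.
  rewrite distrC; apply: Hd; first by rewrite /ball/= distrC.
  by rewrite in_itv/= a_t tb.
apply/subspace_continuousP => s /=; rewrite in_itv/= => /andP[as_ sb].
apply/cvgrPdist_lt => e e0; have [d d0 Hd] := H s e as_ sb e0.
rewrite near_withinE; apply/nbhs_ballP; exists d => //= t.
rewrite /ball/= in_itv/= => st /andP[a_t tb].
by rewrite distrC; apply: Hd => //; rewrite distrC.
Qed.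

Lemma within_continuous_bounded a b h : {within `[a, b], continuous h} ->
  exists2 K : R, 0 < K & forall t, a <= t -> t <= b -> `|h t| <= K.
Proof.
move=> ch; have [ab|ba] := leP a b; last first.
  exists 1 => // t a_t tb.
  by have := lt_le_trans ba (le_trans a_t tb); rewrite ltxx.
have [c _ Hc] := EVT_max ab ch; have [d _ Hd] := EVT_min ab ch.
exists (`|h c| + `|h d| + 1) => [|t a_t tb].
  by rewrite ltr_wpDl// addr_ge0.
have tab : t \in `[a, b] by rewrite in_itv/= a_t tb.
move: (Hc _ tab) (Hd _ tab) => h1 h2.
have := ler_norm (h c); have := ler_norm (- h d); rewrite normrN.
have := normr_ge0 (h c); have := normr_ge0 (h d).
by rewrite ler_norml => *; apply/andP; split; lra.
Qed.

Lemma is_derive_dist F x l e : is_derive x 1 F l -> 0 < e ->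
  exists2 d : R, 0 < d & forall y, `|y - x| < d ->
    `|F y - F x - l * (y - x)| <= e * `|y - x|.
Proof.
move=> [dF lF] e0.
have : h^-1 *: (F (h *: 1 + x) - F x) @[h --> 0^'] --> l by rewrite -lF; exact: dF.
move=> /cvgrPdist_le/(_ _ e0); rewrite near_withinE.
move=> /nbhs_ballP[d /= d0 Hd]; exists d => // y yx.
have [->|ynx] := eqVneq y x; first by rewrite !subrr mulr0 subrr normr0 mulr0.
have := Hd (y - x); rewrite /ball/= sub0r normrN => /(_ yx).
rewrite subr_eq0 => /(_ ynx); rewrite /GRing.scale/= mulr1 subrK.
have yx0 : 0 < `|y - x| by rewrite normr_gt0 subr_eq0.
rewrite -(ler_pM2r yx0) -normrM; congr (_ <= _).
rewrite distrC; congr `|_|; rewrite mulrBl; congr (_ - _).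
by rewrite mulrAC mulVf ?mul1r// subr_eq0.
Qed.

Lemma dist_is_derive F x l :
  (forall e, 0 < e -> exists2 d : R, 0 < d & forall y, `|y - x| < d ->
    `|F y - F x - l * (y - x)| <= e * `|y - x|) ->
  is_derive x 1 F l.
Proof.
move=> H.
have Hl : h^-1 *: (F (h *: 1 + x) - F x) @[h --> 0^'] --> l.
  apply/cvgrPdist_le => e e0; have [d d0 Hd] := H e e0.
  rewrite near_withinE; apply/nbhs_ballP; exists d => //= h.
  rewrite /ball/= sub0r normrN => hd h0.
  rewrite /GRing.scale/= mulr1.
  have h0' : 0 < `|h| by rewrite normr_gt0.
  rewrite -(ler_pM2r h0') -normrM.
  have := Hd (h + x); rewrite addrK => /(_ hd); congr (_ <= _).
  rewrite -normrN; congr `|_|; rewrite mulrBl opprB; congr (_ - _).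
  by rewrite mulrAC mulVf ?mul1r.
by apply: DeriveDef; [apply/cvg_ex; exists l|exact/cvg_lim].
Qed.

Lemma prim_continuous a b f g K : prim a b f g ->
  (forall t, a <= t -> t <= b -> `|g t| <= K) -> {within `[a, b], continuous f}.
Proof.
move=> fg gK; apply/within_continuous_dist => s e as_ sb e0.
have K1 : 0 < `|K| + 1 by rewrite ltr_wpDl.
exists (e / (`|K| + 1)); first by rewrite divr_gt0.
move=> t a_t tb ts; apply: (@le_lt_trans _ _ (K * `|t - s|)).
  exact: prim_lipschitz fg gK _ _ _ _ _ _.
apply: (@le_lt_trans _ _ ((`|K| + 1) * `|t - s|)).
  by rewrite ler_wpM2r// (le_trans (ler_norm _))// lerDl.
by rewrite mulrC -ltr_pdivlMr.
Qed.

Lemma prim_measurable a b f g : prim a b f g -> measurable_fun `[a, b] g.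
Proof. by case=> /integrableP[/measurable_EFinP]. Qed.

Lemma within_continuous_measurable a b h :
  {within `[a, b], continuous h} -> measurable_fun `[a, b] h.
Proof.
by move=> ch; apply: (@subspace_continuous_measurable_fun R) => //; exact: ch.
Qed.

(* The difference of the two sides has derivative zero at every point: near
   [s] it is [o(|f z - f s|)] plus an integral of [(h s - h t) * g t]. *)
Lemma prim_chain a b f g F h K : prim a b f g ->
  (forall t, a <= t -> t <= b -> `|g t| <= K) ->
  {within `[a, b], continuous h} ->
  (forall t, a <= t -> t <= b -> is_derive (f t) 1 F (h t)) ->
  prim a b (F \o f) (fun t => h t * g t).
Proof.
move=> fg gK ch dF.
have [L L0 hL] := within_continuous_bounded ch.
have ihg : leb.-integrable `[a, b] (EFin \o (fun t => h t * g t)).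
  apply: (@integrable_bounded _ _ _ (L * K)).
    apply: measurable_funM; first exact: within_continuous_measurable.
    exact: prim_measurable fg.
  by move=> t a_t tb; rewrite normrM ler_pM// ?hL ?gK.
split=> // x y ax xy yb.
pose H z := (F \o f) z - \int[leb]_(t in `[x, z]) (h t * g t).
suff : H y = H x.
  rewrite /H set_itv1 Rintegral_set1 subr0 => /eqP.
  by rewrite subr_eq addrC -subr_eq => /eqP.
apply: zero_derivative_endpoints => // s e xs sy e0.
have as_ := le_trans ax xs; have sb := le_trans sy yb.
pose K' : R := `|K| + 1; have K'0 : 0 < K' by rewrite ltr_wpDl.
have KK' : K <= K' by rewrite (le_trans (ler_norm _))// lerDl.
(* Half of e pays for the linearization of F at [f s], half for the oscillation of h; both errors
   are scaled by the Lipschitz constant [K'] of f. *)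
pose e' : R := e / K' / 2.
have e'0 : 0 < e' by rewrite !divr_gt0.
have [d1 d10 Hd1] := is_derive_dist (dF s as_ sb) e'0.
have [d2 d20 Hd2] := (within_continuous_dist _ _ _).1 ch s e' as_ sb e'0.
exists (Num.min d2 (d1 / K')).
  by rewrite lt_min d20 divr_gt0.
move=> z xz zy; rewrite lt_min => /andP[zs2 zs1].
have az := le_trans ax xz; have zb := le_trans zy yb.
have fzs : `|f z - f s| <= K' * `|z - s|.
  apply: (le_trans (prim_lipschitz fg gK as_ sb az zb)).
  by rewrite ler_wpM2r.
have fzs1 : `|f z - f s| < d1.
  by apply: (le_lt_trans fzs); rewrite mulrC -ltr_pdivlMr.
have Hz := Hd1 _ fzs1.
have key lo hi : x <= lo -> lo <= hi -> hi <= y -> 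
    (forall t, lo <= t -> t <= hi -> `|h t - h s| < e') ->
    `| \int[leb]_(t in `[lo, hi]) (h t * g t) - h s * (f hi - f lo)|
      <= e' * K' * (hi - lo).
  move=> xlo lohi hiy Hh.
  have alo := le_trans ax xlo; have hib := le_trans hiy yb.
  rewrite fg.2// -RintegralZl//; last exact: (integrable_sub fg.1).
  rewrite -RintegralB//; last 2 first.
  - exact: (integrable_sub ihg).
  - have := @integrableZl _ _ _ leb `[lo, hi] (measurable_itv _) (h s) (EFin \o g).
    by apply; exact: (integrable_sub fg.1).
  apply: norm_Rintegral_le => //.
    have -> : EFin \o (fun t => h t * g t - h s * g t) =
       ((EFin \o (fun t => (h t * g t)%R)) \- (fun t => (h s)%:E * (g t)%:E))%E.
      by apply/funext => t /=; rewrite EFinB EFinM.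
    apply: integrableB => //; first exact: (integrable_sub ihg).
    apply: integrableZl => //.
    exact: (integrable_sub fg.1).
  move=> t lot thi; rewrite -mulrBl normrM ler_pM//; first exact/ltW/Hh.
  by rewrite (le_trans (gK _ _ _))//; [exact: le_trans lot|exact: le_trans hib].
have ixy : leb.-integrable `[x, y] (EFin \o (fun t => h t * g t)).
  exact: (integrable_sub ihg).
have He : e = e' * K' + e' * K' by rewrite /e'; field; lra.
have [sz|zs] := leP s z.
- have -> : H z - H s = (F (f z) - F (f s) - h s * (f z - f s)) -
     (\int[leb]_(t in `[s, z]) (h t * g t) - h s * (f z - f s)).
    rewrite /H (@Rintegral_cat _ x s z) //=; last exact: integrable_sub ixy _ _.
    by ring.
  apply: (le_trans (ler_normB _ _)); rewrite {1}He mulrDl lerD//.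
    by apply: (le_trans Hz); rewrite -mulrA ler_pM2l.
  rewrite (ger0_norm (_ : 0 <= z - s)) ?subr_ge0//.
  apply: key => // t st tz; apply: Hd2; [lra|lra|].
  rewrite ger0_norm ?subr_ge0//; apply: le_lt_trans zs2.
  by rewrite ger0_norm ?subr_ge0// lerD2r.
- have -> : H z - H s = (F (f z) - F (f s) - h s * (f z - f s)) +
     (\int[leb]_(t in `[z, s]) (h t * g t) - h s * (f s - f z)).
    rewrite /H (@Rintegral_cat _ x z s) //=; last 2 first.
    - exact: integrable_sub ixy _ _.
    - exact: ltW.
    by ring.
  apply: (le_trans (ler_normD _ _)); rewrite {1}He mulrDl lerD//.
    by apply: (le_trans Hz); rewrite -mulrA ler_pM2l.
  rewrite [`|z - s|]distrC (gtr0_norm (_ : 0 < s - z)) ?subr_gt0//.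
  apply: key => //; first exact: ltW.
  move=> t zt ts; apply: Hd2; [lra|lra|].
  rewrite distrC ger0_norm ?subr_ge0//; apply: le_lt_trans zs2.
  by rewrite distrC gtr0_norm ?subr_gt0// lerD2l lerN2.
Qed.

End primitive_calculus.

(** * Sums and products of primitives, and passage to weak derivatives *)

Section primitive_algebra.
Context {R : realType}.
Local Notation leb := (@lebesgue_measure R).
Implicit Types (a b x y s t d e l K : R) (f g h F : R -> R).

Lemma integrable_lin (D : set R) a b g g' : measurable D ->
  leb.-integrable D (EFin \o g) -> leb.-integrable D (EFin \o g') ->
  leb.-integrable D (EFin \o (fun t => a * g t + b * g' t)).
Proof.
move=> mD ig ig'.
rewrite (_ : EFin \o _ = (fun t => a%:E * (EFin \o g) t) \+
   (fun t => b%:E * (EFin \o g') t))%E; last first.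
  by apply/funext => t /=; rewrite EFinD !EFinM.
by apply: integrableD => //; apply: integrableZl.
Qed.

Lemma Rintegral_lin (D : set R) a b g g' : measurable D ->
  leb.-integrable D (EFin \o g) -> leb.-integrable D (EFin \o g') ->
  \int[leb]_(t in D) (a * g t + b * g' t) =
  a * \int[leb]_(t in D) g t + b * \int[leb]_(t in D) g' t.
Proof.
move=> mD ig ig'; rewrite RintegralD//; first by rewrite !RintegralZl.
- by have := @integrableZl _ _ _ leb D mD a (EFin \o g) ig.
- by have := @integrableZl _ _ _ leb D mD b (EFin \o g') ig'.
Qed.

Lemma prim_lin c c' a b f g f' g' : prim a b f g -> prim a b f' g' ->
  prim a b (fun t => c * f t + c' * f' t) (fun t => c * g t + c' * g' t).
Proof.
move=> [ig fg] [ig' fg']; split; first exact: integrable_lin.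
move=> x y ax xy yb; rewrite Rintegral_lin//; last 2 first.
- exact: integrable_sub ig _ _.
- exact: integrable_sub ig' _ _.
by rewrite -fg// -fg'//; ring.
Qed.

Lemma prim_eq a b f g f' g' : prim a b f g ->
  (forall t, a <= t -> t <= b -> f' t = f t) ->
  (forall t, a <= t -> t <= b -> g' t = g t) -> prim a b f' g'.
Proof.
move=> [ig fg] ff gg; split.
  apply: eq_integrable ig => // t; rewrite inE/= in_itv/= => /andP[at_ tb].
  by rewrite gg.
move=> x y ax xy yb; have xb := le_trans xy yb; have ay := le_trans ax xy.
rewrite !ff// fg//; apply: eq_Rintegral => t; rewrite inE/= in_itv/= => /andP[xt ty].
by rewrite gg//; [exact: le_trans xt|exact: le_trans yb].
Qed.

Lemma prim_id a b : prim a b id (fun=> 1).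
Proof.
split; first by apply: (@integrable_bounded _ _ _ 1) => // t _ _; rewrite normr1.
move=> x y ax xy yb; rewrite Rintegral_cst// mul1r.
have := lebesgue_measure_itv `[x, y] => /= ->; rewrite lte_fin.
case: ltP => //= yx; have -> : y = x by apply/eqP; rewrite eq_le xy yx.
by rewrite subrr.
Qed.

(** Fundamental theorem of calculus, as the chain rule with the identity inside. *)
Lemma prim_C1 a b F h :
  (forall t, a <= t -> t <= b -> is_derive t 1 F (h t)) ->
  {within `[a, b], continuous h} -> prim a b F h.
Proof.
move=> dF ch.
have i1 t : a <= t -> t <= b -> `|(fun=> 1 : R) t| <= 1 by rewrite normr1.
apply: prim_eq (prim_chain (prim_id a b) i1 ch dF) _ _.
- by [].
- by move=> t _ _; rewrite mulr1.
Qed.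

Lemma prim_sqr a b f g K : prim a b f g ->
  (forall t, a <= t -> t <= b -> `|g t| <= K) ->
  prim a b (fun t => f t ^+ 2) (fun t => 2 * f t * g t).
Proof.
move=> fg gK.
apply: (@prim_chain R a b f g (fun z => z ^+ 2) (fun t => 2 * f t) K fg gK).
  have cf := prim_continuous fg gK.
  move=> t; apply: cvgM; [exact: cvg_cst|exact: cf].
move=> t _ _; apply: is_derive_eq.
by rewrite /GRing.scale/=; ring.
Qed.

(** Polarization reduces the product rule to the chain rule for squares: f f' = ((f + f')^2 - (f -
    f')^2) / 4. *)
Lemma prim_mul a b f g f' g' K K' : prim a b f g -> prim a b f' g' ->
  (forall t, a <= t -> t <= b -> `|g t| <= K) ->
  (forall t, a <= t -> t <= b -> `|g' t| <= K') ->
  prim a b (fun t => f t * f' t) (fun t => g t * f' t + f t * g' t).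
Proof.
move=> p1 p2 gK gK'.
have ps := prim_lin 1 1 p1 p2; have pd := prim_lin 1 (-1) p1 p2.
have := prim_lin (1/4) (-1/4) (@prim_sqr _ _ _ _ (K + K') ps _)
  (@prim_sqr _ _ _ _ (K + K') pd _).
move=> H; apply: prim_eq.
- apply: H => t at_ tb.
  + by rewrite !mul1r (le_trans (ler_normD _ _))// lerD ?gK ?gK'.
  + by rewrite mul1r mulN1r (le_trans (ler_normB _ _))// lerD ?gK ?gK'.
- by move=> t _ _; field.
- by move=> t _ _; field.
Qed.

Lemma prim_int a b g : leb.-integrable `[a, b] (EFin \o g) ->
  prim a b (fun x => \int[leb]_(t in `[a, x]) g t) g.
Proof.
move=> ig; split=> // x y ax xy yb.
by rewrite (@Rintegral_cat _ a x y)//; [ring|exact: integrable_sub ig _ _].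
Qed.

Lemma integral_eq_set (A B : set R) (h : R -> \bar R) : 
  (forall x, A x -> ~ B x -> h x = 0%E) ->
  (forall x, B x -> ~ A x -> h x = 0%E) ->
  (\int[leb]_(x in A) h x = \int[leb]_(x in B) h x)%E.
Proof.
move=> AB BA; rewrite integral_mkcond [RHS]integral_mkcond.
apply: eq_integral => x _; rewrite /patch.
have [xA|xA] := boolP (x \in A); have [xB|xB] := boolP (x \in B) => //.
- by apply: AB; [exact: set_mem|move/mem_set; rewrite (negbTE xB)].
- by apply/esym/BA; [exact: set_mem|move/mem_set; rewrite (negbTE xA)].
Qed.

Lemma Rintegral_eq_set (A B : set R) h : 
  (forall x, A x -> ~ B x -> h x = 0) ->
  (forall x, B x -> ~ A x -> h x = 0) ->
  \int[leb]_(x in A) h x = \int[leb]_(x in B) h x.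
Proof.
move=> AB BA; congr fine; apply: integral_eq_set => x Ax Bx; congr EFin.
- exact: AB.
- exact: BA.
Qed.

Lemma test_fun_deriv phi t : @test_fun R phi -> is_derive t 1 phi (derive1 phi t).
Proof.
by move=> [/(_ 0%N t) d _]; rewrite derive1E; apply: DeriveDef.
Qed.

Lemma test_fun_cont phi : @test_fun R phi -> continuous (derive1 phi).
Proof.
move=> [/(_ 1%N) d _] t; apply: differentiable_continuous.
by apply/derivable1_diffP; exact: d.
Qed.

Lemma test_fun_supp phi : @test_fun R phi -> exists a b,
  [/\ 0 < a, a < b, b < 1 & forall x, x <= a \/ b <= x -> phi x = 0 /\ derive1 phi x = 0].
Proof.
move=> tp; have [sp [a [b [a0 [ab [b1 H]]]]]] := tp.
(* Halving the margins puts these points inside the open zero set of phi, so that the derivative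
   vanishes there too. *)
exists (a / 2), ((b + 1) / 2); split; [lra|lra|lra|].
move=> x xab; split; first by apply: H; case: xab => ?; [left|right]; lra.
rewrite derive1E; apply: derive_val.
apply: dist_is_derive => e e0.
case: xab => xab.
- exists (a / 2) => [|y yx]; first lra.
  have ya : y < a by move: yx; rewrite ltr_norml => /andP[? ?]; lra.
  rewrite (H y) ?(H x); [|left; lra|left; lra].
  by rewrite mul0r !subr0 normr0 mulr_ge0// ltW.
- exists ((1 - b) / 2) => [|y yx]; first lra.
  have ya : b < y by move: yx; rewrite ltr_norml => /andP[? ?]; lra.
  rewrite (H y) ?(H x); [|right; lra|right; lra].
  by rewrite mul0r !subr0 normr0 mulr_ge0// ltW.
Qed.

Lemma prim_test_fun phi a b : @test_fun R phi -> prim a b phi (derive1 phi).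
Proof.
move=> tp; apply: prim_C1 => [t _ _|]; first exact: test_fun_deriv.
by apply: continuous_subspaceT; exact: test_fun_cont.
Qed.

(** The integration by parts takes place on the support of the test function only, so g may blow up
    at 0 and 1. The third derivative for p > 2 needs this. *)
Lemma prim_weak_deriv f g :
  leb.-integrable `]0, 1[ (EFin \o f) -> leb.-integrable `]0, 1[ (EFin \o g) ->
  (forall a b, 0 < a -> a < b -> b < 1 -> prim a b f g /\
     exists K, forall t, a <= t -> t <= b -> `|g t| <= K) ->
  weak_deriv f g.
Proof.
move=> jf jg H; split=> //; split=> // phi tp.
have [a [b [a0 ab b1 sp]]] := test_fun_supp tp.
have [fg [K gK]] := H a b a0 ab b1.
have [K' _ dK'] : exists2 K' : R, 0 < K' &
    forall t, a <= t -> t <= b -> `|derive1 phi t| <= K'.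
  by apply: within_continuous_bounded; apply: continuous_subspaceT; exact: test_fun_cont.
have pm := prim_mul fg (prim_test_fun a b tp) gK dK'.
have cf := prim_continuous fg gK.
have cphi : {within `[a, b], continuous phi}.
  exact: prim_continuous (prim_test_fun a b tp) dK'.
have out (A : R -> R) x : `]0, 1[%classic x -> ~ `[a, b]%classic x ->
    (A x * phi x = 0) * (A x * derive1 phi x = 0).
  rewrite /= !in_itv/= => /andP[x0 x1] nab.
  have [|-> ->] := sp x; last by rewrite !mulr0.
  by have [|ax] := ltP x a; [left; lra|have [|] := ltP b x; [right; lra|]];
   move=> xb; case: nab; rewrite ax xb.
have inn x : `[a, b]%classic x -> ~ `]0, 1[%classic x -> False.
  by rewrite /= !in_itv/= => /andP[ax xb]; apply; apply/andP; split; lra.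
rewrite (@integral_eq_set _ `[a, b]) => [|x h1 h2|x h1 h2]; last 2 first.
- by rewrite out.
- by case: (inn x).
rewrite [in RHS](@integral_eq_set _ `[a, b]) => [|x h1 h2|x h1 h2]; last 2 first.
- by rewrite out.
- by case: (inn x).
have mphi := within_continuous_measurable cphi.
have [L L0 hL] := within_continuous_bounded cf.
have [P P0 hP] := within_continuous_bounded cphi.
have i1 : leb.-integrable `[a, b] (EFin \o (fun x => f x * derive1 phi x)).
  apply: (@integrable_bounded _ _ _ (L * K')).
    apply: measurable_funM; first exact: within_continuous_measurable.
    exact: prim_measurable (prim_test_fun a b tp).
  by move=> t at_ tb; rewrite normrM ler_pM ?hL ?dK'.
have i2 : leb.-integrable `[a, b] (EFin \o (fun x => g x * phi x)).
  apply: (@integrable_bounded _ _ _ (K * P)).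
    by apply: measurable_funM => //; exact: prim_measurable fg.
  by move=> t at_ tb; rewrite normrM ler_pM ?gK ?hP.
have := pm.2 a b (lexx a) (ltW ab) (lexx b).
rewrite RintegralD//.
have [pa _] := sp a (or_introl (lexx a)); have [pb _] := sp b (or_intror (lexx b)).
rewrite pa pb !mulr0 subr0 => /esym/eqP; rewrite addr_eq0 => /eqP E.
rewrite -[LHS]fineK; last exact: integrable_fin_num i1.
rewrite -[X in (- X)%E]fineK; last exact: integrable_fin_num i2.
by rewrite -EFinN; congr EFin; rewrite /Rintegral in E; rewrite E opprK.
Qed.

End primitive_algebra.

(** * Smooth bump functions *)

Section bump_functions.
Context {R : realType}.
Local Notation leb := (@lebesgue_measure R).
Implicit Types (a b c x y s t d e : R) (f g h F : R -> R).

Lemma is_derive_mul f g x l m : is_derive x 1 f l -> is_derive x 1 g m ->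
  is_derive x 1 (fun y => f y * g y) (l * g x + f x * m).
Proof.
move=> df dg; have := @is_deriveM R R f g x 1 l m df dg.
by rewrite /GRing.scale/= addrC (mulrC (g x)).
Qed.

Lemma is_derive_lin a b f g x l m : is_derive x 1 f l -> is_derive x 1 g m ->
  is_derive x 1 (fun y => a * f y + b * g y) (a * l + b * m).
Proof.
move=> df dg.
have := @is_deriveD R R R _ _ x 1 _ _ (@is_deriveZ R R R f a x 1 l df)
  (@is_deriveZ R R R g b x 1 m dg).
by [].
Qed.

Lemma is_derive_affine a b x : is_derive x 1 (fun y : R => a * y + b) a.
Proof.
have := is_derive_lin a b (is_derive_id x 1) (is_derive_cst (1 : R) x 1).
by rewrite mulr1 mulr0 addr0; under eq_fun do rewrite mulr1.
Qed.

Lemma is_derive_exp f x l (n : nat) : is_derive x 1 f l ->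
  is_derive x 1 (fun y => f y ^+ n) (n%:R * f x ^+ n.-1 * l).
Proof.
move=> df; elim: n => [|n IH].
  by rewrite !mul0r; exact: (is_derive_cst (1 : R) x 1).
have -> : (fun y => f y ^+ n.+1) = (fun y => f y * f y ^+ n).
  by apply/funext => y; rewrite exprS.
rewrite (_ : _ * l = l * f x ^+ n + f x * (n%:R * f x ^+ n.-1 * l)).
  exact: is_derive_mul.
case: n {IH} => [|n] /=; first by rewrite expr0 mul0r; ring.
by rewrite exprS; ring.
Qed.

Lemma is_derive_inv x : x != 0 -> is_derive x 1 (fun y : R => y^-1) (- x^-1 ^+ 2).
Proof.
move=> xn0; have := @is_deriveV R id x 1 1 xn0 (is_derive_id _ _).
by rewrite /GRing.scale/= mulr1 exprVn.
Qed.

(** The power j is a parameter because these functions are closed under differentiation up to linear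
    combinations, which makes smoothness an induction. *)
Definition bumpe (j : nat) (x : R) : R :=
  if 0 < x then x^-1 ^+ j * expR (- x^-1) else 0.

Lemma bumpe_le0 j x : x <= 0 -> bumpe j x = 0.
Proof. by rewrite /bumpe leNgt; case: ifP. Qed.

Lemma bumpe_gt0 j x : 0 < x -> bumpe j x = x^-1 ^+ j * expR (- x^-1).
Proof. by rewrite /bumpe => ->. Qed.

(** With z = 1 / x the upper bound is z^j <= j! e^z, which follows from a single term of the
    exponential series. *)
Lemma bumpe_bound j x : 0 <= bumpe j x <= j`!%:R.
Proof.
have [x0|x0] := ltP 0 x; last by rewrite bumpe_le0// lexx ler0n.
rewrite bumpe_gt0//; have y0 : 0 < x^-1 by rewrite invr_gt0.
move: (x^-1) y0 => z z0.
apply/andP; split; first by rewrite mulr_ge0 ?expR_ge0 ?exprn_ge0// ltW.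
case: j => [|j]; first by rewrite mul1r expR_le1// oppr_le0 ltW.
have := expR_ge1Dxn j (ltW z0); rewrite expRN ler_pdivrMr ?expR_gt0// => H.
have f0 : 0 < (j.+1)`!%:R :> R by rewrite ltr0n fact_gt0.
rewrite -ler_pdivrMl// mulrC; apply: le_trans H.
by rewrite lerDr.
Qed.

Lemma is_derive_bumpe j x :
  is_derive x 1 (bumpe j) (bumpe j.+2 x - j%:R * bumpe j.+1 x).
Proof.
have [x0|x0|->] := ltgtP x 0.
- rewrite !bumpe_le0 ?ltW// mulr0 subr0.
  apply: (@near_eq_is_derive _ _ _ (cst 0)).
  near=> y; rewrite bumpe_le0//; apply: ltW; near: y; exact: lt_nbhsl.
- rewrite !bumpe_gt0//.
  apply: (@near_eq_is_derive _ _ _ (fun y => y^-1 ^+ j * expR (- y^-1))).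
    near=> y; rewrite bumpe_gt0//; near: y; exact: lt_nbhsr.
  have xn0 : x != 0 by rewrite gt_eqF.
  have dV := is_derive_inv xn0.
  have dE : is_derive x 1 (fun y : R => expR (- y^-1)) (expR (- x^-1) * x^-1 ^+ 2).
    apply: (@is_derive1_comp R expR (fun y => - y^-1)).
    by have := is_deriveN dV; rewrite opprK.
  have := is_derive_mul (is_derive_exp j dV) dE.
  congr is_derive; rewrite -addn2 exprD.
  by case: (j) => [|k]; rewrite /= !exprS; ring.
- rewrite !bumpe_le0// mulr0 subr0; apply: dist_is_derive => e e0.
  (* At 0 the increment is quadratic: [bumpe j y] equals y^2 times [bumpe j.+2 y], and C bounds the
     last factor. *)
  pose C : R := (j.+2)`!%:R.
  have C0 : 0 < C by rewrite ltr0n fact_gt0.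
  exists (e / C); first by rewrite divr_gt0.
  move=> y; rewrite (@bumpe_le0 j 0)// !subr0 mul0r subr0.
  have [y0|y0] := leP y 0; first by rewrite bumpe_le0// normr0 mulr_ge0// ltW.
  rewrite (gtr0_norm y0) => ye.
  have -> : bumpe j y = y * (y * bumpe j.+2 y).
    by rewrite !bumpe_gt0// !exprS; field; rewrite gt_eqF.
  have /andP[h1 h2] := bumpe_bound j.+2 y.
  rewrite ger0_norm; last by rewrite !mulr_ge0// ltW.
  rewrite mulrC ler_pM2r//.
  apply: (@le_trans _ _ (y * C)); first by rewrite ler_pM2l.
  by rewrite ltW// -ltr_pdivlMr.
Unshelve. all: by end_near. Qed.

(** A class closed under differentiation, so that one differentiation step yields smoothness without
    formulas for the higher derivatives. *)
Inductive bump_alg : (R -> R) -> Prop :=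
| bump_base j c d : bump_alg (fun x => bumpe j (c * x + d))
| bump_lin a b f g : bump_alg f -> bump_alg g -> bump_alg (fun x => a * f x + b * g x)
| bump_mul f g : bump_alg f -> bump_alg g -> bump_alg (fun x => f x * g x).

Lemma bump_alg_derive f : bump_alg f ->
  bump_alg (derive1 f) /\ forall x, is_derive x 1 f (derive1 f x).
Proof.
move=> Sf; suff [f' Sf' df] : exists2 f', bump_alg f' & forall x, is_derive x 1 f (f' x).
  have -> : derive1 f = f'.
    by apply/funext => x; rewrite derive1E; exact: derive_val.
  by [].
elim: Sf => [j c d|a b {}f g _ [f' Sf' df] _ [g' Sg' dg]|{}f g Sf [f' Sf' df] Sg [g' Sg' dg]].
- exists (fun x => c * bumpe j.+2 (c * x + d) + (- (c * j%:R)) * bumpe j.+1 (c * x + d)).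
    by apply: bump_lin; apply: bump_base.
  move=> x.
  have := @is_derive1_comp R (bumpe j) (fun y => c * y + d) x _ c (is_derive_bumpe j _).
  rewrite (_ : (bumpe j.+2 _ - _) * c = c * bumpe j.+2 (c * x + d) + (- (c * j%:R)) * bumpe j.+1 (c * x + d)); last by ring.
  by apply; exact: is_derive_affine.
- exists (fun x => a * f' x + b * g' x); first exact: bump_lin.
  by move=> x; exact: is_derive_lin.
- exists (fun x => 1 * (f x * g' x) + 1 * (g x * f' x)).
    by apply: bump_lin; apply: bump_mul.
  move=> x; have := is_derive_mul (df x) (dg x); congr is_derive.
  by rewrite !mul1r addrC (mulrC (f' x)).
Qed.

Lemma bump_alg_smooth f : bump_alg f -> smooth f.
Proof.
move=> Sf n x; have : bump_alg (derive1n n f).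
  elim: n => [|n IH]; first by rewrite derive1n0.
  by rewrite derive1nS; have [] := bump_alg_derive IH.
by move/bump_alg_derive => [_ /(_ x) []].
Qed.

Lemma antiderivative_smooth f g : smooth g -> (forall x, is_derive x 1 f (g x)) ->
  smooth f.
Proof.
move=> sg df n x.
have fg : derive1 f = g.
  by apply/funext => y; rewrite derive1E; exact: derive_val.
have S m : derive1n m.+1 f = derive1n m g.
  by elim: m => [|m IH]; [rewrite derive1n1 derive1n0|rewrite derive1nS IH derive1nS].
by case: n => [|n]; [rewrite derive1n0; have [] := df x|rewrite S; exact: sg].
Qed.

(** The parameter c is a steepness: as it grows, the bump tends to the indicator of the open
    interval from a to b, because [bumpe 0] tends to 1 at infinity. *)
Definition smooth_bump c a b x : R := bumpe 0 (c * (x - a)) * bumpe 0 (c * (b - x)).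

Lemma bump_alg_bump c a b : bump_alg (smooth_bump c a b).
Proof.
rewrite (_ : smooth_bump c a b = fun x => bumpe 0 (c * x + (- c * a)) * bumpe 0 (- c * x + c * b)).
  by apply: bump_mul; apply: bump_base.
by apply/funext => x; rewrite /smooth_bump; congr (bumpe _ _ * bumpe _ _); ring.
Qed.

Lemma smooth_bump_out c a b x : 0 < c -> x <= a \/ b <= x -> smooth_bump c a b x = 0.
Proof.
move=> c0 [xa|bx]; rewrite /smooth_bump.
  by rewrite bumpe_le0 ?mul0r// pmulr_rle0// subr_le0.
by rewrite [X in _ * X]bumpe_le0 ?mulr0// pmulr_rle0// subr_le0.
Qed.

Lemma smooth_bump_test c a b : 0 < c -> 0 < a -> a < b -> b < 1 -> test_fun (smooth_bump c a b).
Proof.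
move=> c0 a0 ab b1; split; first exact/bump_alg_smooth/bump_alg_bump.
exists a, b; split=> //; split=> //; split=> // x [xa|bx]; apply: smooth_bump_out => //.
- by left; exact: ltW.
- by right; exact: ltW.
Qed.

Lemma smooth_bump_bound c a b x : 0 <= smooth_bump c a b x <= 1.
Proof.
have /andP[h1 h2] := bumpe_bound 0 (c * (x - a)).
have /andP[h3 h4] := bumpe_bound 0 (c * (b - x)).
by rewrite /smooth_bump mulr_ge0//= mulr_ile1.
Qed.

Lemma smooth_bump_gt0 c a b x : 0 < c -> a < x -> x < b -> 0 < smooth_bump c a b x.
Proof.
move=> c0 ax xb.
have h1 : 0 < c * (x - a) by rewrite mulr_gt0// subr_gt0.
have h2 : 0 < c * (b - x) by rewrite mulr_gt0// subr_gt0.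
by rewrite /smooth_bump (bumpe_gt0 _ h1) (bumpe_gt0 _ h2) !expr0 !mul1r mulr_gt0// expR_gt0.
Qed.

Lemma bumpe0_cvg (u : R^nat) : u @ \oo --> +oo -> bumpe 0 (u n) @[n --> \oo] --> (1 : R).
Proof.
move=> u8; apply/cvgrPdist_le => e e0.
have /cvgryPge/(_ (e^-1)) := u8.
apply: filterS => n un.
have un0 : 0 < u n by apply: lt_le_trans un; rewrite invr_gt0.
rewrite bumpe_gt0// expr0 mul1r ger0_norm; last first.
  by rewrite subr_ge0 expR_le1 oppr_le0 invr_ge0 ltW.
rewrite lerBlDr addrC -lerBlDr; have := expR_ge1Dx (- (u n)^-1).
apply: le_trans; rewrite lerD2l lerN2.
by rewrite -[leRHS]invrK lef_pV2// posrE ?invr_gt0.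
Qed.

End bump_functions.

(** * Fubini on a triangle *)

Section triangle_fubini.
Context {R : realType}.
Local Notation leb := (@lebesgue_measure R).
Implicit Types (a b c x y s t d e : R) (f g h F : R -> R).

(** Fubini for the kernel A(x) B(t) restricted to t <= x, whose integrability follows from the
    product bound |A(x)| |B(t)|. *)
Lemma Rintegral_Fubini_le
    (nu : {sigma_finite_measure set (measurableTypeR R) -> \bar R}) (A B : R -> R) :
  nu.-integrable setT (EFin \o A) -> leb.-integrable setT (EFin \o B) ->
  (\int[nu]_x (A x * \int[leb]_(t in `]-oo, x]) B t)%:E =
   \int[leb]_t (B t * \int[nu]_(x in `[t, +oo[) A x)%:E)%E.
Proof.
move=> iA iB.
have mA : measurable_fun setT A by apply/measurable_EFinP; case/integrableP: iA.
have mB : measurable_fun setT B by apply/measurable_EFinP; case/integrableP: iB.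
pose k (z : measurableTypeR R * measurableTypeR R) : R :=
  A z.1 * B z.2 * ((z.2 : R) <= (z.1 : R))%R%:R.
have mk : measurable_fun setT k.
  apply: measurable_funM; first by apply: measurable_funM; apply: measurableT_comp.
  apply: (@measurableT_comp _ _ _ _ _ _ (fun b : bool => b%:R : R)) => //.
  by apply: measurable_fun_ler.
have ik : (nu \x leb)%E.-integrable setT (EFin \o k).
  apply/integrable12ltyP; first exact/measurable_EFinP.
  case/integrableP: iA => _ iA; case/integrableP: iB => _ iB.
  have B0 : (0 <= \int[leb]_t `|(EFin \o B) t|)%E by apply: integral_ge0.
  apply: (@le_lt_trans _ _
    (\int[nu]_x ((\int[leb]_t `|(EFin \o B) t|) * `|(EFin \o A) x|))%E).
    apply: ge0_le_integral => //.
    - by move=> x _; apply: integral_ge0.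
    - have := @measurable_fun_fubini_tonelli_F _ _ _ _ _ leb (abse \o (EFin \o k)).
      apply => [|z]; last exact: abse_ge0.
      by apply: measurableT_comp => //; exact/measurable_EFinP.
    - by apply: emeasurable_funM => //; apply: measurableT_comp => //; exact/measurable_EFinP.
    move=> x _; rewrite muleC -ge0_integralZl//; last first.
      by apply: measurableT_comp => //; exact/measurable_EFinP.
    apply: ge0_le_integral => //.
    - apply: measurableT_comp => //; apply/measurable_EFinP.
      exact: (measurableT_comp mk (pair1_measurable x)).
    - apply: emeasurable_funM => //.
      by apply: measurableT_comp => //; exact/measurable_EFinP.
    move=> t _; rewrite /k /= !normrM lee_fin.
    by case: (t <= x); rewrite ?normr1 ?mulr1// normr0 mulr0 mulr_ge0.
  rewrite ge0_integralZl//; last by apply: measurableT_comp => //; exact/measurable_EFinP.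
  by apply: lte_mul_pinfty => //; rewrite ge0_fin_numE.
have := Fubini ik.
have inner (m : {measure set (measurableTypeR R) -> \bar R}) (D : set R) (C : R -> R) c :
    measurable D -> m.-integrable setT (EFin \o C) ->
    (\int[m]_x (c * (C \_ D) x)%:E = (c * \int[m]_(x in D) C x)%:E)%E.
  move=> mD iC; have iCD : m.-integrable setT (EFin \o (C \_ D)).
    rewrite -restrict_EFin; apply/integrable_restrict => //.
    by rewrite setTI; apply: integrableS iC.
  rewrite EFinM Rintegral_mkcond /Rintegral fineK.
    by rewrite -integralZl//.
  exact: integrable_fin_num iCD.
move=> E; transitivity (\int[nu]_x \int[leb]_y (EFin \o k) (x, y))%E.
  apply: eq_integral => x _; rewrite -(inner leb)//.
  apply: eq_integral => t _; rewrite /k /= patchE mem_setE in_itv/=.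
  by case: (t <= x); rewrite ?mulr1 ?mulr0.
rewrite E; apply: eq_integral => t _; rewrite -(inner nu)//.
apply: eq_integral => x _; rewrite /k /= patchE mem_setE in_itv/= andbT.
by case: (t <= x); rewrite ?mulr1 ?mulr0// mulrC.
Qed.

(** Both functions are extended by zero outside [0, 1], which reduces the triangle to the half-plane
    t <= x. *)
Lemma Rintegral_Fubini_triangle
    (nu : {sigma_finite_measure set (measurableTypeR R) -> \bar R}) (A B : R -> R) :
  nu.-integrable `[0, 1] (EFin \o A) -> leb.-integrable `[0, 1] (EFin \o B) ->
  (\int[nu]_(x in `[0%R, 1%R]) (A x * \int[leb]_(t in `[0%R, x]) B t)%:E =
   \int[leb]_(t in `[0%R, 1%R]) (B t * \int[nu]_(x in `[t, 1%R]) A x)%:E)%E.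
Proof.
move=> iA iB.
have ex (m : {measure set (measurableTypeR R) -> \bar R}) C :
    m.-integrable `[0, 1] (EFin \o C) -> m.-integrable setT (EFin \o (C \_ `[0, 1])).
  by move=> iC; rewrite -restrict_EFin; apply/integrable_restrict => //; rewrite setTI.
have := Rintegral_Fubini_le (ex _ _ iA) (ex _ _ iB).
have eqs (m : {measure set (measurableTypeR R) -> \bar R}) (D D' : set R) C :
    (forall x, `[0, 1]%classic x -> D x <-> D' x) ->
    (forall x, D' x -> `[0, 1]%classic x) ->
    \int[m]_(x in D) (C \_ `[0, 1]) x = \int[m]_(x in D') C x.
  move=> DD D'J; rewrite Rintegral_mkcond [RHS]Rintegral_mkcond; apply: eq_Rintegral => x _.
  rewrite !patchE; have [xJ|xJ] := boolP (x \in `[0, 1]%classic).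
    have [xD|xD] := boolP (x \in D); have [xD'|xD'] := boolP (x \in D') => //.
    - by move: xD'; rewrite notin_setE; case: (DD x (set_mem xJ)) => /(_ (set_mem xD)).
    - by move: xD; rewrite notin_setE; case: (DD x (set_mem xJ)) => _ /(_ (set_mem xD')).
  case: ifP => _; case: ifP => // /set_mem/D'J/mem_set.
  - by rewrite (negbTE xJ).
  - by rewrite (negbTE xJ).
move=> E; rewrite [LHS]integral_mkcond [RHS]integral_mkcond.
transitivity (\int[nu]_x ((A \_ `[0, 1]) x * \int[leb]_(t in `]-oo, x]) (B \_ `[0, 1]) t)%:E)%E.
  apply: eq_integral => x _; rewrite !patchE; case: ifP => [|_]; last by rewrite mul0r.
  rewrite mem_setE in_itv/= => /andP[x0 x1]; congr (_ * _)%:E; apply/esym/eqs.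
    by move=> t /=; rewrite !in_itv/= => /andP[-> _].
  move=> t /=; rewrite !in_itv/= => /andP[-> tx]; exact: le_trans x1.
rewrite E; apply: eq_integral => x _; rewrite !patchE; case: ifP => [|_]; last by rewrite mul0r.
rewrite mem_setE in_itv/= => /andP[x0 x1]; congr (_ * _)%:E; apply: eqs.
  by move=> t /=; rewrite !in_itv/= andbT => /andP[_ ->]; rewrite andbT.
by move=> t /=; rewrite !in_itv/= => /andP[xt ->]; rewrite andbT; exact: le_trans xt.
Qed.

Lemma integrable_oo_cc g : leb.-integrable `]0, 1[ (EFin \o g) ->
  leb.-integrable `[0, 1] (EFin \o g).
Proof.
move=> /integrableP[mg ig].
have mg' : measurable_fun (`[0%R, 1%R]%classic : set R) (EFin \o g) by apply: emeasurable_fun_itv_cc mg.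
apply/integrableP; split => //.
rewrite -integral_itv_obnd_cbnd; last first.
  by apply: measurableT_comp => //; apply: measurable_funS mg' => //; exact: subset_itv_oc_cc.
rewrite -integral_itv_bndo_bndc//.
by apply: measurableT_comp => //; exact: mg.
Qed.

Lemma integral_oo_cc g : measurable_fun (`]0%R, 1%R[%classic : set R) g ->
  (\int[leb]_(x in `]0%R, 1%R[) (g x)%:E = \int[leb]_(x in `[0%R, 1%R]) (g x)%:E)%E.
Proof.
move=> mg; have mg' : measurable_fun (`[0%R, 1%R]%classic : set R) g by apply: measurable_fun_itv_cc mg.
rewrite integral_itv_bndo_bndc; last exact/measurable_EFinP.
rewrite integral_itv_obnd_cbnd//.
by apply/measurable_EFinP; apply: measurable_funS mg' => //; exact: subset_itv_oc_cc.
Qed.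

End triangle_fubini.

(** * Weak derivatives *)

Section weak_derivatives.
Context {R : realType}.
Local Notation leb := (@lebesgue_measure R).
Local Notation I01 := (`]0%R, 1%R[%classic : set R).
Local Notation J01 := (`[0%R, 1%R]%classic : set R).
Implicit Types (a b c x y s t d e : R) (f g h F : R -> R).

(** Bumps of growing steepness, with left ends tending to 0, converge boundedly to the indicator of
    the interval; dominated convergence transfers the orthogonality. *)
Lemma test_orthogonal_itv h x : leb.-integrable I01 (EFin \o h) ->
  (forall phi, test_fun phi -> (\int[leb]_(t in I01) (h t * phi t)%:E = 0)%E) ->
  0 < x -> x < 1 -> \int[leb]_(t in `]0, x[) h t = 0.
Proof.
move=> ih H x0 x1.
have mh : measurable_fun I01 h by apply/measurable_EFinP; case/integrableP: ih.
(* The shift by N ensures 1 / (n + N) < x for every n, so that each bump has a nondegenerate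
   support. *)
pose N := (Num.truncn x^-1).+1.
have Nx (n : nat) : x^-1 < (n + N)%:R.
  by rewrite (lt_le_trans (truncnS_gt _))// ler_nat leq_addl.
have Np (n : nat) : 0 < (n + N)%:R :> R by rewrite (le_lt_trans _ (Nx n))// invr_ge0 ltW.
pose k (n : nat) := smooth_bump (n + N)%:R ((n + N)%:R^-1) x.
have tk n : test_fun (k n).
  apply: smooth_bump_test => //; first by rewrite invr_gt0.
  by rewrite -[ltRHS]invrK ltf_pV2 ?posrE ?invr_gt0.
have mk n : measurable_fun I01 (k n).
  apply: measurable_funTS; apply: continuous_measurable_fun => t.
  apply: differentiable_continuous; apply/derivable1_diffP.
  by have [] := test_fun_deriv t (tk n).
have itv_sub : `]0, x[%classic `<=` I01.
  by apply: subset_itv; rewrite bnd_simp// ltW.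
have cv t : I01 t -> k n t @[n --> \oo] --> (\1_(`]0, x[%classic : set R) t : R).
  rewrite /= in_itv/= => /andP[t0 t1]; rewrite indicE mem_setE in_itv/= t0/=.
  have [tx|xt] := ltP t x; last first.
    rewrite (_ : k ^~ t = cst 0); first exact: cvg_cst.
    by apply/funext => n; apply: smooth_bump_out => //; right.
  rewrite -[X in _ --> X](mulr1 (1 : R)); apply: cvgM; apply: bumpe0_cvg.
    apply/cvgryPge => A; near=> n.
    rewrite mulrBr mulfV ?gt_eqF// lerBrDr -ler_pdivrMr//.
    apply: (@le_trans _ _ n%:R); last by rewrite ler_nat leq_addr.
    by near: n; exact: nbhs_infty_ger.
  apply/cvgryPge => A; near=> n.
  rewrite -ler_pdivrMr ?subr_gt0//.
  apply: (@le_trans _ _ n%:R); last by rewrite ler_nat leq_addr.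
  by near: n; exact: nbhs_infty_ger.
have h1 n : measurable_fun I01 (fun t => (h t * k n t)%:E).
  by apply/measurable_EFinP; apply: measurable_funM.
have h2 : measurable_fun I01 (fun t => (h t * \1_(`]0, x[%classic : set R) t)%:E).
  by apply/measurable_EFinP; apply: measurable_funM => //; exact: measurable_funTS.
have h3 : {ae leb, forall t, I01 t -> (h t * k n t)%:E @[n --> \oo] -->
    (h t * \1_(`]0, x[%classic : set R) t)%:E}.
  apply/aeW => t It; apply: cvg_EFin; first by near=> n.
  by apply: cvgM; [exact: cvg_cst|exact: cv].
have h5 : {ae leb, forall t n, I01 t -> (`|(h t * k n t)%:E| <= `|h t|%:E)%E}.
  apply/aeW => t n _; rewrite lee_fin normrM ler_piMr//.
  have /andP[b0 b1] := smooth_bump_bound (n + N)%:R ((n + N)%:R^-1) x t.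
  by rewrite ger0_norm.
have [_ _] := @dominated_convergence _ _ R leb _ (measurable_itv _) _ _ _ h1 h2 h3
  (integrable_norm ih) h5.
have -> : (fun n => \int[leb]_(t in I01) (h t * k n t)%:E)%E = cst 0%E.
  by apply/funext => n; rewrite H.
move=> cv0.
have E : (\int[leb]_(t in I01) (h t * \1_(`]0, x[%classic : set R) t)%:E = 0)%E.
  by apply: cvg_unique cv0 (cvg_cst _).
rewrite /Rintegral (_ : (\int[leb]_(t in `]0%R, x[) _)%E = 0%E)// -[RHS]E.
rewrite [RHS](@integral_eq_set _ _ `]0, x[).
- apply: eq_integral => t tx; rewrite indicE tx mulr1//.
- by move=> t _ tx; rewrite indicE memNset// mulr0.
- by move=> t /itv_sub.
Unshelve. all: by end_near. Qed.

(** The primitive of h from 0 vanishes identically on the interval, and Lebesgue differentiation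
    recovers h from it almost everywhere. *)
Lemma test_orthogonal_ae0 h : leb.-integrable I01 (EFin \o h) ->
  (forall phi, test_fun phi -> (\int[leb]_(t in I01) (h t * phi t)%:E = 0)%E) ->
  {ae leb, forall x, I01 x -> h x = 0}.
Proof.
move=> ih H.
have ihT : leb.-integrable setT (EFin \o (h \_ I01)).
  by rewrite -restrict_EFin; apply/integrable_restrict => //; rewrite setTI.
have ihy y : leb.-integrable `]-oo, y] (EFin \o (h \_ I01)).
  by apply: integrableS ihT.
have := FTC1Ny ihy (integrable_locally (measurable_itv _) ih).
apply: filterS; first exact: (ae_filter_ringOfSetsType leb).
move=> x [_ E] Ix; move: E; rewrite patchE mem_set// => <-.
rewrite derive1E; apply: derive_val.
apply: (@near_eq_is_derive _ _ _ (cst 0)).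
move: Ix; rewrite /= in_itv/= => /andP[x0 x1].
near=> y.
have y0 : 0 < y by near: y; exact: lt_nbhsr.
have y1 : y < 1 by near: y; exact: lt_nbhsl.
transitivity (\int[leb]_(t in `]0, y[) h t); first by rewrite test_orthogonal_itv.
rewrite Rintegral_itv_bndo_bndc; last first.
  by apply: integrableS ih => //; apply: subset_itv; rewrite bnd_simp// ltW.
rewrite Rintegral_mkcond [RHS]Rintegral_mkcond; apply: eq_Rintegral => t _.
rewrite !patchE !mem_setE !in_itv/=.
case: (ltP 0 t) => t0 /=; last by rewrite ?if_same.
case: (leP t y) => ty /=; last by rewrite ?if_same.
by rewrite (le_lt_trans ty y1).
Unshelve. all: by end_near. Qed.

End weak_derivatives.

(** * Recovering a function from its weak derivative *)

Section weak_primitive.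
Context {R : realType}.
Local Notation leb := (@lebesgue_measure R).
Local Notation I01 := (`]0%R, 1%R[%classic : set R).
Local Notation J01 := (`[0%R, 1%R]%classic : set R).
Implicit Types (a b c x y s t d e K : R) (f g h k F : R -> R).

Lemma smooth_derive f t : smooth f -> is_derive t 1 f (derive1 f t).
Proof.
by move=> /(_ 0%N t) d; rewrite derive1E; apply: DeriveDef.
Qed.

Lemma smooth_continuous f : smooth f -> continuous f.
Proof.
move=> /(_ 0%N) d t; apply: differentiable_continuous.
by apply/derivable1_diffP; exact: d.
Qed.

Lemma smooth_derive1n f (n : nat) : smooth f -> smooth (derive1n n f).
Proof.
move=> sf m t.
suff -> : derive1n m (derive1n n f) = derive1n (m + n) f by exact: sf.
by elim: m => [|m IH]; [rewrite derive1n0|rewrite addSn !derive1nS IH].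
Qed.

Lemma smooth_lin a b f g : smooth f -> smooth g -> smooth (fun x => a * f x + b * g x).
Proof.
move=> sf sg n t.
have S m : derive1n m (fun x => a * f x + b * g x) =
    (fun x => a * derive1n m f x + b * derive1n m g x).
  elim: m => [|m IH]; first by rewrite !derive1n0.
  rewrite !derive1nS IH; apply/funext => x; rewrite derive1E.
  apply: derive_val; apply: is_derive_lin;
    by apply: smooth_derive; apply: smooth_derive1n.
rewrite S.
have [] := is_derive_lin a b (smooth_derive t (@smooth_derive1n _ n sf))
  (smooth_derive t (@smooth_derive1n _ n sg)).
by [].
Qed.

Lemma integrable_mul_bounded (D : set R) f h K : measurable D ->
  leb.-integrable D (EFin \o f) -> measurable_fun D h ->
  (forall x, D x -> `|h x| <= K) -> leb.-integrable D (EFin \o (fun x => f x * h x)).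
Proof.
move=> mD jf mh hK.
have := @integrableMl _ _ R leb D mD (EFin \o f) h jf mh.
apply; exists K; split; first exact: num_real.
by move=> L KL x Dx; exact: le_trans (hK _ Dx) (ltW KL).
Qed.

Lemma test_fun_smooth phi : @test_fun R phi -> smooth phi.
Proof. by case. Qed.

Lemma continuous_bounded_J h : continuous h ->
  exists2 K : R, 0 < K & forall x, I01 x -> `|h x| <= K.
Proof.
move=> ch; have [|K K0 hK] := @within_continuous_bounded R 0 1 h.
  exact: continuous_subspaceT.
exists K => // x /=; rewrite in_itv/= => /andP[x0 x1].
by apply: hK; exact: ltW.
Qed.

Lemma integrable_mul_continuous f h : leb.-integrable I01 (EFin \o f) -> continuous h ->
  leb.-integrable I01 (EFin \o (fun x => f x * h x)).
Proof.
move=> jf ch; have [K K0 hK] := continuous_bounded_J ch.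
apply: integrable_mul_bounded hK => //; apply: measurable_funTS.
exact: continuous_measurable_fun.
Qed.

(** Here g is merely integrable, while [prim_mul] asks for bounded densities; writing phi(x) as
    minus the integral of phi' over [x, 1] lets Fubini replace the product rule. *)
Lemma test_fun_parts g phi : leb.-integrable I01 (EFin \o g) -> test_fun phi ->
  \int[leb]_(x in I01) ((\int[leb]_(t in `[0, x]) g t) * derive1 phi x) =
  - \int[leb]_(x in I01) (g x * phi x).
Proof.
move=> ig tp; have ig' := integrable_oo_cc ig.
have cG : {within J01, continuous (fun x => \int[leb]_(t in `[0, x]) g t)}.
  by apply: parameterized_integral_continuous.
have cphi' := test_fun_cont tp.
have cphi := smooth_continuous (test_fun_smooth tp).
have [K K0 phiK] : exists2 K : R, 0 < K & forall t, 0 <= t -> t <= 1 -> `|derive1 phi t| <= K.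
  by apply: within_continuous_bounded; exact: continuous_subspaceT.
have iphi : leb.-integrable J01 (EFin \o derive1 phi).
  apply: integrable_bounded phiK.
  by apply: measurable_funTS; exact: continuous_measurable_fun.
have mG : measurable_fun I01 (fun x => \int[leb]_(t in `[0, x]) g t).
  apply: (@measurable_funS _ _ _ _ J01) => //; first exact: subset_itv_oo_cc.
  exact: (@within_continuous_measurable R 0 1).
have mg : measurable_fun I01 g by apply/measurable_EFinP; case/integrableP: ig.
have mphi : measurable_fun I01 phi.
  by apply: measurable_funTS; exact: continuous_measurable_fun.
have mphi' : measurable_fun I01 (derive1 phi).
  by apply: measurable_funTS; exact: continuous_measurable_fun.
have := @Rintegral_Fubini_triangle R leb (derive1 phi) g iphi ig'.
rewrite -!integral_oo_cc; last 2 first.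
- apply: (@eq_measurable_fun _ _ _ _ _ (fun x => - (g x * phi x))).
    move=> x; rewrite inE/= in_itv/= => /andP[x0 x1].
    have [_ p2] := prim_test_fun x 1 tp.
    rewrite -p2// ?(ltW x1)//.
    have [a [b [a0 ab b1 sp]]] := test_fun_supp tp.
    by have [-> _] := sp 1 (or_intror (ltW b1)); rewrite sub0r mulrN.
  by apply: measurable_funN; apply: measurable_funM.
- by apply: measurable_funM.
move=> E; rewrite /Rintegral.
under eq_integral do rewrite mulrC.
rewrite E -[RHS]mulN1r -[X in _ = _ * X]/(\int[leb]_(x in I01) (g x * phi x)).
rewrite -RintegralZl//; last exact: integrable_mul_continuous.
congr fine; apply: eq_integral => x; rewrite inE/= in_itv/= => /andP[x0 x1].
have [_ p2] := prim_test_fun x 1 tp.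
rewrite -p2// ?(ltW x1)//.
have [a [b [a0 ab b1 sp]]] := test_fun_supp tp.
by have [-> _] := sp 1 (or_intror (ltW b1)); rewrite sub0r mulN1r mulrN.
Qed.

(** The zero mean makes the antiderivative vanish again beyond b, hence have compact support. *)
Lemma antiderivative_test_fun k a b : continuous k -> smooth k ->
  0 < a -> a < b -> b < 1 -> (forall x, x < a \/ b < x -> k x = 0) ->
  \int[leb]_(t in J01) k t = 0 ->
  test_fun (fun x => \int[leb]_(t in `[0, x]) k t) /\
  derive1 (fun x => \int[leb]_(t in `[0, x]) k t) = k.
Proof.
move=> ck sk a0 ab b1 kab k0.
have ik x y : leb.-integrable `[x, y] (EFin \o k).
  apply: continuous_compact_integrable; first exact: segment_compact.
  exact: continuous_subspaceT.
have th0 x : x < a -> \int[leb]_(t in `[0, x]) k t = 0.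
  move=> xa; rewrite -[RHS](@Rintegral_set0 _ _ R leb k).
  apply: Rintegral_eq_set => // t /=; rewrite in_itv/= => /andP[_ tx] _.
  by apply: kab; left; exact: le_lt_trans xa.
have dth x : is_derive x 1 (fun x => \int[leb]_(t in `[0, x]) k t) (k x).
  have [x0|x0] := ltP 0 x.
    have [] := @continuous_FTC1_closed R k 0 x (x + 1) _ (ik _ _) x0 (ck x).
      by rewrite ltrDl.
    by move=> dF <-; rewrite derive1E; apply: DeriveDef.
  rewrite kab; last by left; exact: le_lt_trans a0.
  apply: (@near_eq_is_derive _ _ _ (cst 0)); near=> y.
  by rewrite th0//; near: y; apply: lt_nbhsl; exact: le_lt_trans a0.
split; last first.
  by apply/funext => x; rewrite derive1E; exact: derive_val.
split; first exact: antiderivative_smooth dth.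
exists a, b; split=> //; split=> //; split=> // x [|bx]; first exact: th0.
transitivity (\int[leb]_(t in J01) k t) => //.
apply: Rintegral_eq_set => t /=; rewrite !in_itv/= => /andP[t0 tx].
- by rewrite t0/= => /negP; rewrite -ltNge => t1; apply: kab; right; lra.
- by rewrite t0/= => /negP; rewrite -ltNge => t1; apply: kab; right; lra.
Unshelve. all: by end_near. Qed.

(** Fix a bump rho of positive integral. Any test function k minus a suitable multiple of rho has
    mean zero, so it is the derivative of a test function. Hence h - C is orthogonal to every k,
    where C is the rho-weighted mean of h. *)
Lemma test_deriv_orthogonal_cst h : leb.-integrable I01 (EFin \o h) ->
  (forall phi, test_fun phi -> \int[leb]_(x in I01) (h x * derive1 phi x) = 0) ->
  exists C, {ae leb, forall x, I01 x -> h x = C}.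
Proof.
move=> ih H.
pose rho := smooth_bump 1 (1/4) (3/4) : R -> R.
have trho : test_fun rho by apply: smooth_bump_test; lra.
have crho := smooth_continuous (test_fun_smooth trho).
have iJ k : continuous k -> leb.-integrable J01 (EFin \o k).
  move=> ck; apply: continuous_compact_integrable; first exact: segment_compact.
  exact: continuous_subspaceT.
have Z0 : 0 < \int[leb]_(t in J01) rho t.
  have rg t : 0 <= rho t by have /andP[] := smooth_bump_bound 1 (1/4) (3/4) t.
  (* If the integral were zero, the primitive of rho would vanish near 1/2, against its derivative
     [rho (1/2)] being positive. *)
  rewrite lt_neqAle Rintegral_ge0// andbT; apply/eqP => Z.
  have [_ E] := @continuous_FTC1_closed R rho 0 (1/2) 1 ltac:(lra) (iJ _ crho) ltac:(lra) (crho _).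
  have rp : 0 < rho (1/2) by apply: smooth_bump_gt0; lra.
  suff r0 : derive1 (fun x => \int[leb]_(t in `[0, x]) rho t) (1/2) = 0.
    by move: rp; rewrite -E r0 ltxx.
  rewrite derive1E; apply: derive_val; apply: (@near_eq_is_derive _ _ _ (cst 0)).
  near=> y.
  have y0 : 0 <= y by apply: ltW; near: y; apply: lt_nbhsr; lra.
  have y1 : y <= 1 by apply: ltW; near: y; apply: lt_nbhsl; lra.
  have := @Rintegral_cat R 0 y 1 rho (iJ _ crho) y0 y1; rewrite -Z.
  have : 0 <= \int[leb]_(t in `[0, y]) rho t by exact: Rintegral_ge0.
  have : 0 <= \int[leb]_(t in `[y, 1]) rho t by exact: Rintegral_ge0.
  by rewrite /cst; lra.
pose Z := \int[leb]_(t in J01) rho t.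
pose C := (\int[leb]_(x in I01) (h x * rho x)) / Z.
exists C.
have iC : leb.-integrable I01 (EFin \o (fun=> C)).
  apply: (@integrableS _ _ _ leb J01) => //; first exact: subset_itv_oo_cc.
  exact: (@integrable_bounded _ _ _ `|C|).
have ihC : leb.-integrable I01 (EFin \o (fun x => 1 * h x + (-1) * C)).
  exact: integrable_lin.
have := test_orthogonal_ae0 ihC.
move=> HH; have : {ae leb, forall x, I01 x -> 1 * h x + (-1) * C = 0}.
  apply: HH => k tk.
  have ck := smooth_continuous (test_fun_smooth tk).
  pose c := (\int[leb]_(t in J01) k t) / Z.
  pose kk x := 1 * k x + (- c) * rho x.
  have skk : smooth kk.
    by apply: smooth_lin; [exact: test_fun_smooth|exact: (test_fun_smooth trho)].
  have ckk := smooth_continuous skk.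
  have [_ [a [b [a0 [ab [b1 kab]]]]]] := tk.
  have [tth dth] : test_fun (fun x => \int[leb]_(t in `[0, x]) kk t) /\
      derive1 (fun x => \int[leb]_(t in `[0, x]) kk t) = kk.
    apply: (@antiderivative_test_fun _ (Num.min a (1/4)) (Num.max b (3/4))) => //.
    - by rewrite lt_min a0; lra.
    - by rewrite lt_max gt_min ab.
    - by rewrite gt_max b1; lra.
    - move=> x xab; rewrite /kk kab; last first.
        by case: xab => [|]; [rewrite lt_min => /andP[? _]; left|rewrite gt_max => /andP[? _]; right].
      rewrite /rho smooth_bump_out//; first ring.
      by case: xab => [|]; [rewrite lt_min => /andP[_ ?]; left|rewrite gt_max => /andP[_ ?]; right]; lra.
    - rewrite /kk Rintegral_lin//; [|exact: iJ|exact: iJ].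
      by rewrite -/Z /c mul1r mulNr divfK ?subrr// gt_eqF.
  have := H _ tth; rewrite dth => E.
  have ihk := integrable_mul_continuous ih ck.
  have ihr := integrable_mul_continuous ih crho.
  have iCk := integrable_mul_continuous iC ck.
  have E1 : \int[leb]_(x in I01) (h x * k x) - c * \int[leb]_(x in I01) (h x * rho x) = 0.
    rewrite -[RHS]E -[X in X - _]mul1r -mulNr -Rintegral_lin//.
    by apply: eq_Rintegral => x _; rewrite /kk; ring.
  have E2 : \int[leb]_(x in I01) (C * k x) = C * \int[leb]_(x in J01) k x.
    rewrite RintegralZl//; last first.
      by apply: integrableS (iJ _ ck) => //; exact: subset_itv_oo_cc.
    congr (_ * _); congr fine; apply: integral_oo_cc.
    by apply: measurable_funTS; exact: continuous_measurable_fun.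
  have E3 : \int[leb]_(x in I01) ((1 * h x + (-1) * C) * k x) = 0.
    transitivity (\int[leb]_(x in I01) (1 * (h x * k x) + (-1) * (C * k x))).
      by apply: eq_Rintegral => x _; ring.
    rewrite Rintegral_lin// E2 mul1r.
    move/eqP: E1; rewrite subr_eq0 => /eqP ->.
    by rewrite /c /C; field; rewrite gt_eqF.
  rewrite -[LHS]fineK; first by rewrite -[fine _]/(\int[leb]_(x in I01) ((1 * h x + (-1) * C) * k x)) E3.
  have := integrable_mul_continuous ihC ck.
  exact: integrable_fin_num.
apply: filterS; first exact: (ae_filter_ringOfSetsType leb).
by move=> x Hx Ix; have := Hx Ix; lra.
Unshelve. all: by end_near. Qed.

Lemma weak_deriv_primitive f g : weak_deriv f g ->
  exists C, {ae leb, forall x, I01 x -> f x = C + \int[leb]_(t in `[0, x]) g t}.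
Proof.
move=> [jf [ig H]].
pose Gf x := \int[leb]_(t in `[0, x]) g t.
have ig' := integrable_oo_cc ig.
have cG : {within J01, continuous Gf}.
  by apply: parameterized_integral_continuous.
have iG : leb.-integrable I01 (EFin \o Gf).
  apply: (@integrableS _ _ _ leb J01) => //; first exact: subset_itv_oo_cc.
  by apply: continuous_compact_integrable => //; exact: segment_compact.
have [|phi tp|C HC] := @test_deriv_orthogonal_cst (fun x => 1 * f x + (-1) * Gf x).
- exact: integrable_lin.
- have cphi := smooth_continuous (test_fun_smooth tp).
  have cphi' := test_fun_cont tp.
  transitivity (\int[leb]_(x in I01) (1 * (f x * derive1 phi x) + (-1) * (Gf x * derive1 phi x))).
    by apply: eq_Rintegral => x _; ring.
  rewrite Rintegral_lin//; [|exact: integrable_mul_continuous..].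
  rewrite test_fun_parts// {1}/Rintegral H// fineN -/(Rintegral _ _ _); ring.
- exists C; move: HC.
  apply: filterS; first exact: (ae_filter_ringOfSetsType leb).
  by move=> x Hx Ix; have := Hx Ix; rewrite /Gf; lra.
Qed.

End weak_primitive.

(** * The Euler-Lagrange equation *)

Section representatives.
Context {R : realType}.
Local Notation leb := (@lebesgue_measure R).
Local Notation I01 := (`]0%R, 1%R[%classic : set R).
Local Notation J01 := (`[0%R, 1%R]%classic : set R).
Implicit Types (a b c x y s t d e K : R) (f g h k F : R -> R).

(** If f and g differed at x they would differ on a whole interval, which is not a null set. *)
Lemma within_continuous_eq f g : {within J01, continuous f} ->
  {within J01, continuous g} -> {ae leb, forall x, I01 x -> f x = g x} ->
  forall x, 0 <= x -> x <= 1 -> f x = g x.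
Proof.
move=> cf cg [N [mN N0 HN]] x x0 x1; apply/eqP/negPn/negP => fgx.
have e0 : 0 < `|f x - g x| / 2 by rewrite divr_gt0// normr_gt0 subr_eq0.
have [d1 d10 Hd1] := (within_continuous_dist _ _ _).1 cf x _ x0 x1 e0.
have [d2 d20 Hd2] := (within_continuous_dist _ _ _).1 cg x _ x0 x1 e0.
pose d := Num.min (Num.min d1 d2) (1/2).
have dd1 : d <= d1 by rewrite /d !ge_min lexx.
have dd2 : d <= d2 by rewrite /d !ge_min lexx orbT.
have dh : d <= 1/2 by rewrite /d !ge_min lexx !orbT.
have d0 : 0 < d by rewrite /d !lt_min d10 d20; lra.
(* A one-sided interval of length d at x that stays in [0, 1]. It lies to the right or left of x
   according to the half containing x, which also covers the ends. *)
have [c [c0 c1 H]] : exists c, [/\ 0 <= c, c + d <= 1 & forall t, c < t -> t < c + d -> `|t - x| < d].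
  have [xh|xh] := leP x (1/2).
    by exists x; split=> [//||t ? ?]; [lra|rewrite ltr_norml; apply/andP; split; lra].
  by exists (x - d); split=> [||t ? ?]; [lra|lra|rewrite ltr_norml; apply/andP; split; lra].
have sub : `]c, (c + d)[%classic `<=` N.
  clear N0.
  move=> t /=; rewrite in_itv/= => /andP[ct tc]; apply: HN => /=.
  have It : `]0, 1[%classic t by rewrite /= in_itv/=; apply/andP; split; lra.
  move=> /(_ It) fgt.
  have td := H t ct tc.
  have := Hd1 t _ _ (lt_le_trans td dd1); have := Hd2 t _ _ (lt_le_trans td dd2).
  move=> h2 h1.
  have t0 : 0 <= t by lra.
  have t1 : t <= 1 by lra.
  have := h1 t0 t1; have := h2 t0 t1; rewrite fgt.
  have := ler_distD (g t) (f x) (g x); rewrite (distrC (f x) (g t)).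
  by move=> ? ? ?; lra.
have : (leb `]c, (c + d)%R[%classic <= leb N)%E by apply: le_measure => //; rewrite inE.
rewrite N0; have := lebesgue_measure_itv `]c, (c + d)[ => /= ->.
rewrite lte_fin ltrDl d0 -EFinB lee_fin; apply/negP; rewrite -ltNge.
by rewrite addrAC subrr add0r.
Qed.

Lemma ae_Rintegral f g (D : set R) : measurable D -> D `<=` I01 ->
  measurable_fun D f -> measurable_fun D g ->
  {ae leb, forall x, I01 x -> f x = g x} ->
  \int[leb]_(x in D) f x = \int[leb]_(x in D) g x.
Proof.
move=> mD DI mf mg fg; congr fine; apply: ae_eq_integral => //.
- exact/measurable_EFinP.
- exact/measurable_EFinP.
apply: filterS fg; first exact: (ae_filter_ringOfSetsType leb).
by move=> x H /DI/H ->.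
Qed.

Lemma ae_Rintegral_itv f g x : 
  leb.-integrable I01 (EFin \o f) -> leb.-integrable I01 (EFin \o g) ->
  {ae leb, forall x, I01 x -> f x = g x} -> 0 <= x -> x <= 1 ->
  \int[leb]_(t in `[0, x]) f t = \int[leb]_(t in `[0, x]) g t.
Proof.
move=> jf ig fg x0 x1.
have s : `]0, x[%classic `<=` I01 by apply: subset_itv; rewrite bnd_simp.
have E h : leb.-integrable I01 (EFin \o h) ->
    \int[leb]_(t in `[0, x]) h t = \int[leb]_(t in `]0, x[) h t.
  move=> ih; have ih' := integrable_oo_cc ih.
  rewrite Rintegral_itv_bndo_bndc; last by apply: integrableS ih.
  rewrite Rintegral_itv_obnd_cbnd//.
  by apply: integrableS ih' => //; apply: subset_itv; rewrite bnd_simp.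
rewrite !E//; apply: ae_Rintegral => //.
- by apply/measurable_EFinP; apply: measurable_funS s _ => //; case/integrableP: jf.
- by apply/measurable_EFinP; apply: measurable_funS s _ => //; case/integrableP: ig.
Qed.

(** The given weak derivative [u1] is determined only almost everywhere; [U1] is its continuous
    representative. As u is itself continuous, its integral formula holds at every point. *)
Lemma W2p_C1_representative p (u u1 u2 : R -> R) : W2p_W1p0 p u u1 u2 ->
  exists U1 : R -> R, [/\ {ae leb, forall x, I01 x -> u1 x = U1 x},
    {within J01, continuous U1},
    leb.-integrable J01 (EFin \o u2),
    prim 0 1 U1 u2 & prim 0 1 u U1].
Proof.
move=> [cu [u0 [u1' [_ [_ wd]]]]].
have wd0 := wd 0%N isT; have wd1 := wd 1%N isT; rewrite /= in wd0 wd1.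
have [iu2] : leb.-integrable J01 (EFin \o u2).
  by case: wd1 => [_ [i2 _]]; exact: integrable_oo_cc.
have [C HC] := weak_deriv_primitive wd1.
pose U1 x := C + \int[leb]_(t in `[0, x]) u2 t.
have cint : {within J01, continuous (fun x => \int[leb]_(t in `[0, x]) u2 t)}.
  by apply: parameterized_integral_continuous.
have cU1 : {within J01, continuous U1}.
  by move=> t; apply: cvgD; [exact: cvg_cst|exact: cint].
exists U1; split=> //.
  split=> // x y x0 xy y1; have [_ H] := prim_int iu2.
  by rewrite -H// /U1; ring.
have iU1 : leb.-integrable J01 (EFin \o U1).
  by apply: continuous_compact_integrable => //; exact: segment_compact.
have iU1' : leb.-integrable I01 (EFin \o U1).
  by apply: integrableS iU1 => //; exact: subset_itv_oo_cc.
have iu1 : leb.-integrable I01 (EFin \o u1) by case: wd1.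
have [C' HC'] := weak_deriv_primitive wd0.
have cI : {within J01, continuous (fun x => C' + \int[leb]_(t in `[0, x]) U1 t)}.
  move=> t; apply: cvgD; first exact: cvg_cst.
  by apply: (@parameterized_integral_continuous R 0 1 U1).
have E : forall x, 0 <= x -> x <= 1 -> u x = C' + \int[leb]_(t in `[0, x]) U1 t.
  apply: within_continuous_eq => //; move: HC'.
  apply: filterS; first exact: (ae_filter_ringOfSetsType leb).
  move=> x Hx Ix; rewrite (Hx Ix); congr (_ + _).
  move: Ix; rewrite /= in_itv/= => /andP[x0 x1].
  by apply: ae_Rintegral_itv => //; exact: ltW.
split=> // x y x0 xy y1; have [_ H] := prim_int iU1.
rewrite -H// !E//; first ring.
- exact: le_trans y1.
- exact: le_trans xy.
Qed.

Lemma bounded_in_Lq q K h : measurable_fun I01 h -> 0 <= q ->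
  (forall x, I01 x -> `|h x| <= K) -> in_Lq q h.
Proof.
move=> mh q0 hK; split=> //.
apply: (@le_lt_trans _ _ (\int[leb]_(x in I01) (`|K| `^ q)%:E)%E).
  apply: ge0_le_integral => //.
  - apply/measurable_EFinP; apply: (@measurableT_comp _ _ _ _ _ _ (@powR R ^~ q)) => //.
    exact: measurableT_comp.
  - move=> x Ix; rewrite lee_fin ge0_ler_powR// ?nnegrE//.
    exact: le_trans (hK _ Ix) (ler_norm _).
rewrite integral_cst//=; have := lebesgue_measure_itv `]0%R, 1%R[ => /= ->.
by rewrite lte_fin ltr01 oppr0 adde0 mule1 ltry.
Qed.

Lemma bounded_integrable_I K h : measurable_fun I01 h ->
  (forall x, I01 x -> `|h x| <= K) -> leb.-integrable I01 (EFin \o h).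
Proof.
move=> mh hK; apply: measurable_bounded_integrable => //=.
  by rewrite lebesgue_measure_itv /= lte_fin ltr01 oppr0 adde0 ltry.
exists K; split; first exact: num_real.
by move=> L KL x Dx; exact: le_trans (hK _ Dx) (ltW KL).
Qed.

End representatives.

(** * Variations with prescribed second derivative *)

Section variations.
Context {R : realType}.
Local Notation leb := (@lebesgue_measure R).
Local Notation I01 := (`]0%R, 1%R[%classic : set R).
Local Notation J01 := (`[0%R, 1%R]%classic : set R).
Implicit Types (a b c x y s t d e K : R) (f g h k F D : R -> R).

(* The primitive of [k] with mean value zero, so that its own primitive
   vanishes at both ends. *)
Definition zero_mean_prim k x :=
  \int[leb]_(t in J01) (k t * t) - \int[leb]_(t in `[x, 1]) k t.

Lemma Rintegral_oo_cc g : measurable_fun I01 g ->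
  \int[leb]_(x in I01) g x = \int[leb]_(x in J01) g x.
Proof. by move=> mg; congr fine; exact: integral_oo_cc. Qed.

Lemma integrable_cc_oo g : leb.-integrable J01 (EFin \o g) ->
  leb.-integrable I01 (EFin \o g).
Proof. by move=> ig; apply: integrableS ig => //; exact: subset_itv_oo_cc. Qed.

Lemma integrable_measurable g (D : set R) :
  leb.-integrable D (EFin \o g) -> measurable_fun D g.
Proof. by case/integrableP => /measurable_EFinP. Qed.

Lemma within_continuous_integrable h : {within J01, continuous h} ->
  leb.-integrable J01 (EFin \o h).
Proof.
by move=> ch; apply: continuous_compact_integrable => //; exact: segment_compact.
Qed.

Section fixed_variation.
Variables (k : R -> R) (K : R).
Hypothesis mk : measurable_fun J01 k.
Hypothesis kK : forall t, 0 <= t -> t <= 1 -> `|k t| <= K.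

Let ik : leb.-integrable J01 (EFin \o k).
Proof. exact: integrable_bounded kK. Qed.

Lemma zero_mean_prim_prim : prim 0 1 (zero_mean_prim k) k.
Proof.
split=> // x y x0 xy y1; rewrite /zero_mean_prim (@Rintegral_cat _ x y 1)//.
  by ring.
exact: integrable_sub ik _ _.
Qed.

Lemma zero_mean_prim_continuous : {within J01, continuous (zero_mean_prim k)}.
Proof. exact: prim_continuous zero_mean_prim_prim kK. Qed.

Lemma int_tail_continuous :
  {within J01, continuous (fun x => \int[leb]_(t in `[x, 1]) k t)}.
Proof.
have -> : (fun x => \int[leb]_(t in `[x, 1]) k t) =
   (fun x => \int[leb]_(t in J01) (k t * t) - zero_mean_prim k x).
  by apply/funext => x; rewrite /zero_mean_prim; ring.
by move=> t; apply: cvgB; [exact: cvg_cst|exact: zero_mean_prim_continuous].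
Qed.

Let ikt : leb.-integrable J01 (EFin \o (fun t => k t * t)).
Proof.
apply: (@integrable_mul_bounded _ _ _ _ 1) => // t /=.
by rewrite in_itv/= => /andP[t0 t1]; rewrite ger0_norm.
Qed.

Lemma Rintegral_triangle D : leb.-integrable J01 (EFin \o D) ->
  \int[leb]_(x in J01) (k x * \int[leb]_(t in `[0, x]) D t) =
  \int[leb]_(t in J01) (D t * \int[leb]_(x in `[t, 1]) k x).
Proof.
by move=> iD; congr fine; exact: (@Rintegral_Fubini_triangle R leb k D ik iD).
Qed.

(** By Fubini the mean of the tail integral of k is the first moment of k, which is the constant in
    [zero_mean_prim]. *)
Lemma zero_mean_prim_mean0 : \int[leb]_(x in J01) zero_mean_prim k x = 0.
Proof.
have i1 : leb.-integrable J01 (EFin \o (fun=> 1)) by have [] := prim_id (0 : R) 1.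
have := Rintegral_triangle i1.
have E : \int[leb]_(x in J01) (k x * \int[leb]_(t in `[0, x]) 1) =
    \int[leb]_(x in J01) (k x * x).
  apply: eq_Rintegral => x; rewrite inE/= in_itv/= => /andP[x0 x1].
  by have [_ H] := prim_id (0 : R) 1; rewrite -H// subr0.
rewrite E => E2; pose c := \int[leb]_(t in J01) (k t * t).
have -> : \int[leb]_(x in J01) zero_mean_prim k x =
   \int[leb]_(x in J01) (c * 1 + (-1) * \int[leb]_(t in `[x, 1]) k t).
  by apply: eq_Rintegral => x _; rewrite /zero_mean_prim -/c; ring.
rewrite Rintegral_lin//; last first.
  exact/within_continuous_integrable/int_tail_continuous.
have -> : \int[leb]_(t in J01) (1 : R) = 1.
  by have [_ H] := prim_id (0 : R) 1; rewrite -H// subr0.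
have -> : \int[leb]_(x in J01) (\int[leb]_(t in `[x, 1]) k t) = c.
  by rewrite /c E2; apply: eq_Rintegral => x _; rewrite mul1r.
by ring.
Qed.

Lemma variation_admissible p : 1 < p ->
  W2p_W1p0 p (fun x => \int[leb]_(t in `[0, x]) zero_mean_prim k t)
    (zero_mean_prim k) k.
Proof.
move=> p1; have p0 : 0 <= p by lra.
have cz := zero_mean_prim_continuous.
have iz := within_continuous_integrable cz.
have [Z _ zZ] := within_continuous_bounded cz.
have pz := prim_int iz.
have cphi := prim_continuous pz zZ.
have [P _ phiP] := within_continuous_bounded cphi.
have IJ x : I01 x -> 0 <= x /\ x <= 1.
  by rewrite /= in_itv/= => /andP[? ?]; split; exact: ltW.
have mI h : measurable_fun J01 h -> measurable_fun I01 h.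
  by move=> mh; apply: measurable_funS mh => //; exact: subset_itv_oo_cc.
have mcI h : {within J01, continuous h} -> measurable_fun I01 h.
  by move=> ch; apply: mI; exact: within_continuous_measurable.
split=> //; split; first by rewrite set_itv1 Rintegral_set1.
split; first exact: zero_mean_prim_mean0.
split=> //; split.
  case=> [|[|[|//]]] _.
  - by apply: (@bounded_in_Lq _ _ P); [exact: mcI|by []|move=> x /IJ[]; exact: phiP].
  - by apply: (@bounded_in_Lq _ _ Z); [exact: mcI|by []|move=> x /IJ[]; exact: zZ].
  - by apply: (@bounded_in_Lq _ _ K); [exact: mI|by []|move=> x /IJ[]; exact: kK].
case=> [|[|//]] _.
- apply: prim_weak_deriv => [||a b a0 ab b1].
  + exact/integrable_cc_oo/within_continuous_integrable.
  + exact/integrable_cc_oo.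
  + split; first by apply: prim_sub pz _ _; exact: ltW.
    by exists Z => t ta tb; apply: zZ; lra.
- apply: prim_weak_deriv => [||a b a0 ab b1].
  + exact/integrable_cc_oo.
  + exact/integrable_cc_oo.
  + split; first by apply: prim_sub zero_mean_prim_prim _ _; exact: ltW.
    by exists K => t ta tb; apply: kK; lra.
Qed.

(** Moves the integration from k to D, after which k is a bare factor that can be chosen freely. *)
Lemma zero_mean_prim_pairing D : leb.-integrable J01 (EFin \o D) ->
  \int[leb]_(x in J01) (D x * zero_mean_prim k x) =
  \int[leb]_(x in J01) (k x *
    (x * \int[leb]_(t in J01) D t - \int[leb]_(t in `[0, x]) D t)).
Proof.
move=> iD; pose c := \int[leb]_(t in J01) (k t * t).
have cD : {within J01, continuous (fun x => \int[leb]_(t in `[0, x]) D t)}.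
  by apply: parameterized_integral_continuous.
have [L _ DL] := within_continuous_bounded cD.
have [T _ tT] := within_continuous_bounded int_tail_continuous.
have -> : \int[leb]_(x in J01) (D x * zero_mean_prim k x) =
   \int[leb]_(x in J01) (c * D x + (-1) * (D x * \int[leb]_(t in `[x, 1]) k t)).
  by apply: eq_Rintegral => x _; rewrite /zero_mean_prim -/c; ring.
have J x : J01 x -> 0 <= x /\ x <= 1 by rewrite /= in_itv/= => /andP[].
rewrite Rintegral_lin//; last first.
  apply: (@integrable_mul_bounded _ _ _ _ T) => //.
    apply: within_continuous_measurable; exact: int_tail_continuous.
  by move=> x /J[]; exact: tT.
rewrite -Rintegral_triangle//.
have -> : \int[leb]_(x in J01) (k x *
    (x * \int[leb]_(t in J01) D t - \int[leb]_(t in `[0, x]) D t)) =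
   \int[leb]_(x in J01) ((\int[leb]_(t in J01) D t) * (k x * x) +
      (-1) * (k x * \int[leb]_(t in `[0, x]) D t)).
  by apply: eq_Rintegral => x _; ring.
rewrite Rintegral_lin//; first by rewrite -/c mulrC.
apply: (@integrable_mul_bounded _ _ _ _ L) => //.
  exact: within_continuous_measurable.
by move=> x /J[]; exact: DL.
Qed.

End fixed_variation.

(** Since k need only be bounded and measurable, it can be the sign of the difference of the two
    sides. The hypothesis then says that this difference has zero L^1 norm. *)
Lemma du_Bois_Reymond f D : leb.-integrable I01 (EFin \o f) ->
  leb.-integrable J01 (EFin \o D) ->
  (forall k, measurable_fun J01 k -> (forall t, 0 <= t -> t <= 1 -> `|k t| <= 1) ->
     \int[leb]_(x in I01) (f x * k x) =
     - \int[leb]_(x in J01) (D x * zero_mean_prim k x)) ->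
  {ae leb, forall x, I01 x ->
     f x = \int[leb]_(t in `[0, x]) D t - x * \int[leb]_(t in J01) D t}.
Proof.
move=> jf iD H.
pose E x := \int[leb]_(t in `[0, x]) D t - x * \int[leb]_(t in J01) D t.
have cD : {within J01, continuous (fun x => \int[leb]_(t in `[0, x]) D t)}.
  by apply: parameterized_integral_continuous.
have cE : {within J01, continuous E}.
  move=> t; apply: cvgB; first exact: cD.
  apply: cvgM; last exact: cvg_cst.
  by move: t; apply: continuous_subspaceT => t; exact: cvg_id.
have iE := within_continuous_integrable cE.
have [L _ EL] := within_continuous_bounded cE.
pose g x := 1 * f x + (-1) * E x.
have ig : leb.-integrable I01 (EFin \o g).
  by apply: integrable_lin => //; exact: integrable_cc_oo.
have mg := integrable_measurable ig.
have mg' : measurable_fun J01 g by apply: measurable_fun_itv_cc mg.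
pose k x : R := (0 < g x)%R%:R - (g x < 0)%R%:R.
have mk : measurable_fun J01 k.
  apply: measurable_funB.
    apply: (@measurableT_comp _ _ _ _ _ _ (fun b : bool => b%:R : R)) => //.
    by apply: measurable_fun_ltr.
  apply: (@measurableT_comp _ _ _ _ _ _ (fun b : bool => b%:R : R)) => //.
  by apply: measurable_fun_ltr.
have kg x : g x * k x = `|g x|.
  rewrite /k; case: (ltgtP (g x) 0) => [g0|g0|->]; rewrite /=.
  - by rewrite ltr0_norm// sub0r mulrN1.
  - by rewrite gtr0_norm// subr0 mulr1.
  - by rewrite normr0 mul0r.
have k1 x : `|k x| <= 1.
  rewrite /k; case: (ltgtP (g x) 0) => _ /=.
  - by rewrite sub0r normrN normr1.
  - by rewrite subr0 normr1.
  - by rewrite subrr normr0.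
have := H k mk (fun t _ _ => k1 t).
rewrite (zero_mean_prim_pairing mk (fun t _ _ => k1 t) iD).
have ik : leb.-integrable J01 (EFin \o k).
  by apply: (@integrable_bounded _ _ _ 1).
have ifk : leb.-integrable I01 (EFin \o (fun x => f x * k x)).
  apply: (@integrable_mul_bounded _ _ _ _ 1) => //.
  by apply: measurable_funS mk => //; exact: subset_itv_oo_cc.
have iEk : leb.-integrable I01 (EFin \o (fun x => E x * k x)).
  apply: (@integrable_mul_bounded _ _ _ _ 1) => //; first exact: integrable_cc_oo.
  by apply: measurable_funS mk => //; exact: subset_itv_oo_cc.
have -> : \int[leb]_(x in J01) (k x * (x * \int[leb]_(t in J01) D t - \int[leb]_(t in `[0, x]) D t))
   = - \int[leb]_(x in I01) (E x * k x).
  rewrite Rintegral_oo_cc; last exact: integrable_measurable iEk.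
  rewrite -[RHS]mulN1r -RintegralZl//; last exact: integrable_oo_cc.
  by apply: eq_Rintegral => x _; rewrite /E; ring.
rewrite opprK => E1.
have E2 : \int[leb]_(x in I01) `|g x| = 0.
  transitivity (\int[leb]_(x in I01) (1 * (f x * k x) + (-1) * (E x * k x))).
    by apply: eq_Rintegral => x _; rewrite -kg /g; ring.
  by rewrite Rintegral_lin// E1; ring.
have E3 : (\int[leb]_(x in I01) `|(g x)%:E| = 0)%E.
  rewrite -[LHS]fineK; last first.
    have := integrable_norm ig; exact: integrable_fin_num.
  by congr EFin.
have := (@ae_eq_integral_abs _ _ R leb I01 (measurable_itv _) (EFin \o g) _).1 E3.
move=> HH; have {HH} : {ae leb, forall x, I01 x -> (g x)%:E = 0%E}.
  by apply: HH; exact/measurable_EFinP.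
apply: filterS; first exact: (ae_filter_ringOfSetsType leb).
move=> x Hx Ix; have /= := Hx Ix; rewrite /g => -[].
by rewrite -/(E x); lra.
Qed.

End variations.

(** * Tails of the obstacle measure *)

Section obstacle_measure.
Context {R : realType}.
Local Notation leb := (@lebesgue_measure R).
Local Notation I01 := (`]0%R, 1%R[%classic : set R).
Local Notation J01 := (`[0%R, 1%R]%classic : set R).
Implicit Types (a b c x y s t d e K : R) (f g h k F D : R -> R).
Variable mu : {measure set (measurableTypeR R) -> \bar R}.

Lemma contact_measurable (u psi : R -> R) :
  {within J01, continuous u} -> {within J01, continuous psi} ->
  measurable [set x | J01 x /\ u x = psi x].
Proof.
move=> cu cpsi.
have mf : measurable_fun J01 (fun x => u x - psi x).
  by apply: measurable_funB; apply: within_continuous_measurable.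
have := mf (measurable_itv _) [set 0] (measurable_set1 _).
congr measurable; apply/seteqP; split=> x /= [Jx].
  by move/eqP; rewrite subr_eq0 => /eqP.
by move=> ->; rewrite subrr.
Qed.

Lemma contact_measure_finite (C : set R) : measurable C -> C `<=` J01 ->
  (mu J01 < +oo)%E -> mu (~` C) = 0%E -> (mu setT < +oo)%E.
Proof.
move=> mC CJ muJ muC.
have -> : setT = J01 `|` ~` C.
  apply/seteqP; split=> // x _ /=.
  by have [xJ|xJ] := pselect (J01 x); [left|right => /CJ].
apply: (@le_lt_trans _ _ (mu J01 + mu (~` C))%E).
  by apply: measureU2 => //; exact: measurableC.
by rewrite muC adde0.
Qed.

Hypothesis mufin : (mu setT < +oo)%E.

Definition tail t : R := fine (mu `[t, 1]%classic).

Lemma mu_fin_num (A : set R) : measurable A -> mu A \is a fin_num.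
Proof.
move=> mA; rewrite ge0_fin_numE//; apply: le_lt_trans mufin.
by apply: le_measure => //; rewrite inE.
Qed.

Lemma tail_nonincreasing s t : s <= t -> tail t <= tail s.
Proof.
move=> st; apply: fine_le; [exact: mu_fin_num|exact: mu_fin_num|].
by apply: le_measure; rewrite ?inE//; apply: subset_itv; rewrite bnd_simp.
Qed.

Lemma tail_ge0 t : 0 <= tail t.
Proof. exact: fine_ge0. Qed.

Lemma tail_measurable (D : set R) : measurable D -> measurable_fun D tail.
Proof.
move=> mD; have -> : tail = (fun x => - (- tail x)) by apply/funext => x; rewrite opprK.
apply: measurable_funN; apply: nondecreasing_measurable => // s t st.
by rewrite lerN2; exact: tail_nonincreasing.
Qed.

(** Trades the unknown measure for the monotone density [tail] with respect to Lebesgue measure. *)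
Lemma integral_mu_tail z : leb.-integrable J01 (EFin \o z) ->
  (\int[mu]_(x in J01) (\int[leb]_(t in `[0%R, x]) z t)%:E =
   \int[leb]_(t in J01) (z t * tail t)%:E)%E.
Proof.
move=> iz.
(* Restricting [mu] to the whole space equips it with the finite-measure structure that Fubini asks
   for. *)
pose nu : {finite_measure set (measurableTypeR R) -> \bar R} :=
  mfrestr (@measurableT _ (measurableTypeR R)) mufin.
have nuE A : nu A = mu A by rewrite /= /mfrestr /mrestr setIT.
have i1 : nu.-integrable J01 (EFin \o (fun=> 1)).
  exact: finite_measure_integrable_cst.
have := @Rintegral_Fubini_triangle R nu (fun=> 1) z i1 iz.
have -> : (\int[nu]_(x in J01) (1 * \int[leb]_(t in `[0%R, x]) z t)%:E =
   \int[mu]_(x in J01) (\int[leb]_(t in `[0%R, x]) z t)%:E)%E.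
  rewrite (@eq_measure_integral _ (measurableTypeR R) R _ mu nu); last first.
    by move=> A _ _; exact: nuE.
  by apply: eq_integral => x _; rewrite mul1r.
move=> ->; apply: eq_integral => t _; congr (_ * _)%:E.
by rewrite Rintegral_cst// mul1r /tail -nuE.
Qed.

End obstacle_measure.

(** * Pointwise inversion of Euler's substitution, and bounds for its ingredients *)

Section regularity.
Context {R : realType}.
Local Notation leb := (@lebesgue_measure R).
Local Notation I01 := (`]0%R, 1%R[%classic : set R).
Local Notation J01 := (`[0%R, 1%R]%classic : set R).
Implicit Types (a b c x y s t d e K : R) (f g h k F D : R -> R).

Lemma within_itv_continuous_comp a b h F : {within `[a, b], continuous h} -> continuous F ->
  {within `[a, b], continuous (F \o h)}.
Proof.
move=> ch cF t.
by apply: (@continuous_comp (subspace `[a, b]) R R h F t); [exact: ch|exact: cF].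
Qed.

Lemma within_itv_continuousM a b f g : {within `[a, b], continuous f} ->
  {within `[a, b], continuous g} -> {within `[a, b], continuous (fun x => f x * g x)}.
Proof. by move=> cf cg t; apply: cvgM; [exact: cf|exact: cg]. Qed.

Lemma within_itv_continuousV a b f : {within `[a, b], continuous f} ->
  (forall x, 0 < f x) -> {within `[a, b], continuous (fun x => (f x)^-1)}.
Proof. by move=> cf f0 t; apply: cvgV; [rewrite gt_eqF|exact: cf]. Qed.

(** Replaces the exponent p - 2, which is negative for p < 2, by the positive exponent p - 1. *)
Lemma powR_mul_self p x : 1 < p -> `|x| `^ (p - 2) * x = Num.sg x * `|x| `^ (p - 1).
Proof.
move=> p1; rewrite {2}[x]numEsg mulrCA; congr (_ * _).
have -> : p - 2 = p - 1 - 1 by ring.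
by rewrite mulrC mulr_powRB1//; lra.
Qed.

(** The signs of w and x are opposite, and |w| / p = (a |x|)^(p - 1) is inverted by the power 1 / (p
    - 1). *)
Lemma euler_inverse p a x w : 1 < p -> 0 < a ->
  w = - p * a `^ (p - 1) * (`|x| `^ (p - 2) * x) ->
  x = - Num.sg w * (`|w| / p) `^ (p - 1)^-1 / a.
Proof.
move=> p1 a0; rewrite powR_mul_self// => wE.
have p0 : 0 < p by lra.
have q0 : p - 1 != 0 by apply/negP => /eqP; lra.
have {wE} wE : w = - (Num.sg x) * (p * (a * `|x|) `^ (p - 1)).
  by rewrite wE powRM// ?ltW//; ring.
have [x0|x0] := eqVneq x 0.
  by rewrite wE x0 sgr0 oppr0 !mul0r sgr0 oppr0 !mul0r.
have ax0 : 0 < a * `|x| by rewrite mulr_gt0// normr_gt0.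
have P0 : 0 < (a * `|x|) `^ (p - 1) by rewrite powR_gt0.
have sw : Num.sg w = - Num.sg x.
  by rewrite wE sgrM sgrN sgr_id (gtr0_sg (mulr_gt0 p0 P0)) mulr1.
have aw : `|w| / p = (a * `|x|) `^ (p - 1).
  rewrite wE normrM normrN normr_sg x0 mul1r gtr0_norm ?mulr_gt0//.
  by rewrite mulrC mulKf// gt_eqF.
rewrite sw aw opprK -powRrM mulfV// powRr1 ?ltW// {1}[x]numEsg.
by field; rewrite gt_eqF.
Qed.

(** Makes |u''|^(p - 1) integrable from |u''|^p alone, in place of Hoelder's inequality on an
    interval of finite length. *)
Lemma powR_pred_le p x : 1 < p -> `|x| `^ (p - 1) <= 1 + `|x| `^ p.
Proof.
move=> p1; have [x1|x1] := leP `|x| 1.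
  have : `|x| `^ (p - 1) <= 1 `^ (p - 1).
    by rewrite ge0_ler_powR// ?nnegrE//; lra.
  by rewrite powR1 => H; rewrite (le_trans H)// lerDl powR_ge0.
apply: (@le_trans _ _ (`|x| `^ p)); last by rewrite lerDr.
by rewrite ler_powR// ?ltW//; lra.
Qed.

Variables (G : R -> R) (p : R).
Hypothesis sG : standing_G G.
Hypothesis p1 : 1 < p.

Let dG := derive1 G.
Let ddG := derive1n 2 G.

Lemma Gdot_gt0 s : 0 < dG s.
Proof. by have [_ [_ [H _]]] := sG. Qed.

Lemma Gdot_continuous : continuous dG.
Proof.
by have [H _] := sG; rewrite /dG -derive1n1; apply/smooth_continuous/smooth_derive1n.
Qed.

Lemma Gddot_continuous : continuous ddG.
Proof. by have [H _] := sG; apply/smooth_continuous/smooth_derive1n. Qed.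

Lemma Gdot_derive s : is_derive s 1 dG (ddG s).
Proof.
have [H _] := sG; rewrite /ddG derive1nS derive1n1; apply: smooth_derive.
by rewrite /dG -derive1n1; exact: smooth_derive1n.
Qed.

Lemma Gddot_derive s : is_derive s 1 ddG (derive1n 3 G s).
Proof.
have [H _] := sG; rewrite derive1nS; apply: smooth_derive.
exact: smooth_derive1n.
Qed.

Lemma euler_w_measurable (v1 v2 : R -> R) : measurable_fun I01 v1 -> measurable_fun I01 v2 ->
  measurable_fun I01 (euler_w G p v1 v2).
Proof.
move=> m1 m2; apply: measurable_funM.
  apply: measurable_funM => //.
  apply: (@measurableT_comp _ _ _ _ _ _ (@powR R ^~ (p - 1))) => //.
  apply: (@measurableT_comp _ _ _ _ _ _ dG) => //.
  apply: continuous_measurable_fun; exact: Gdot_continuous.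
apply: measurable_funM => //.
apply: (@measurableT_comp _ _ _ _ _ _ (@powR R ^~ (p - 2))) => //.
exact: measurableT_comp.
Qed.

Lemma in_Lq_integrable q h : in_Lq q h ->
  leb.-integrable I01 (EFin \o (fun x => `|h x| `^ q)).
Proof.
move=> [mh Hh]; apply/integrableP; split.
  apply/measurable_EFinP; apply: (@measurableT_comp _ _ _ _ _ _ (@powR R ^~ q)) => //.
  exact: measurableT_comp.
suff -> : (\int[leb]_(x in I01) `|(EFin \o (fun x => (`|h x| `^ q)%R)) x| =
  \int[leb]_(x in I01) (`|h x| `^ q)%:E)%E by [].
by apply: eq_integral => x _ /=; rewrite ger0_norm// powR_ge0.
Qed.

Lemma integrable_le_bound f g : measurable_fun I01 f -> leb.-integrable I01 (EFin \o g) ->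
  (forall x, I01 x -> `|f x| <= g x) -> leb.-integrable I01 (EFin \o f).
Proof.
move=> mf ig fg; apply: (@le_integrable _ _ R leb I01 _ (EFin \o f) (EFin \o g)) => //.
  exact/measurable_EFinP.
by move=> x Ix; rewrite /= lee_fin (le_trans (fg _ Ix))// ler_norm.
Qed.

End regularity.

(** * From the weak equation to the first-order equation for [W] *)

Section critical_points.
Context {R : realType}.
Local Notation leb := (@lebesgue_measure R).
Local Notation I01 := (`]0%R, 1%R[%classic : set R).
Local Notation J01 := (`[0%R, 1%R]%classic : set R).
Implicit Types (a b c x y s t d e K : R) (f g h k F D : R -> R).

(* Inverts Euler's substitution: recovers [u''] from [w_u] and [u']. *)
Definition curv (G : R -> R) p (U1 W : R -> R) x :=
  - Num.sg (W x) * (`|W x| / p) `^ (p - 1)^-1 / derive1 G (U1 x).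

(** The signed power is treated because the sign of [W] is not yet known when [u''] is shown to be
    continuous. *)
Lemma sg_powR_continuous r : 0 < r -> continuous (fun x : R => - Num.sg x * `|x| `^ r).
Proof.
move=> r0 x; have [x0|x0|->] := ltgtP x 0.
- apply: (@cvg_trans _ ((fun y : R => (- y) `^ r) y @[y --> x])).
    apply: near_eq_cvg; near=> y.
    have y0 : y < 0 by near: y; exact: lt_nbhsl.
    by rewrite ltr0_sg// ltr0_norm// opprK mul1r.
  rewrite ltr0_sg// ltr0_norm// opprK mul1r.
  apply: (@continuous_comp R R R -%R (@powR R ^~ r)); first exact: opp_continuous.
  apply: differentiable_continuous; apply/derivable1_diffP.
  by apply: derivable_powR; rewrite in_itv/= andbT oppr_gt0.
- apply: (@cvg_trans _ ((fun y : R => - (y `^ r)) y @[y --> x])).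
    apply: near_eq_cvg; near=> y.
    have y0 : 0 < y by near: y; exact: lt_nbhsr.
    by rewrite gtr0_sg// gtr0_norm// mulN1r.
  rewrite gtr0_sg// gtr0_norm// mulN1r.
  have cp : {for x, continuous (fun y : R => y `^ r)}.
    apply: differentiable_continuous; apply/derivable1_diffP.
    by apply: derivable_powR; rewrite in_itv/= andbT.
  exact: (cvgN cp).
- rewrite /continuous_at sgr0 oppr0 mul0r; apply/cvgrPdist_lt => e e0.
  pose d := e `^ r^-1.
  have d0 : 0 < d by rewrite powR_gt0.
  near=> y.
  have yd : `|y| < d by near: y; exact: (@nbhs0_lt R R).
  rewrite sub0r normrN normrM normrN ger0_norm ?powR_ge0//.
  apply: (@le_lt_trans _ _ (`|y| `^ r)).
    rewrite ler_piMl ?powR_ge0// normr_sg.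
    by case: (y != 0).
  rewrite -[ltRHS](@powRr1 _ e) ?ltW// -(@mulVf _ r) ?gt_eqF// powRrM -/d.
  by rewrite gt0_ltr_powR// ?nnegrE// ltW.
Unshelve. all: by end_near. Qed.

Lemma curv_continuous G p (U1 W : R -> R) : standing_G G -> 1 < p ->
  {within J01, continuous U1} -> {within J01, continuous W} ->
  {within J01, continuous (curv G p U1 W)}.
Proof.
move=> sG p1 cU1 cW.
have p0 : 0 < p by lra.
pose F s : R := - Num.sg s * `|s| `^ (p - 1)^-1.
pose h y : R := p^-1 * W y.
have -> : curv G p U1 W = fun x => (F \o h) x * (derive1 G (U1 x))^-1.
  have pV0 : 0 < p^-1 by rewrite invr_gt0.
  apply/funext => x; rewrite /curv /F /h /= sgrM (gtr0_sg pV0) mul1r.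
  by rewrite normrM (gtr0_norm pV0) (mulrC p^-1).
have cF : continuous F by apply: sg_powR_continuous; rewrite invr_gt0; lra.
have ch : {within J01, continuous h}.
  by apply: within_itv_continuousM => // t; exact: cvg_cst.
have cFh := within_itv_continuous_comp ch cF.
have cA : {within J01, continuous (derive1 G \o U1)}.
  by apply: (within_itv_continuous_comp cU1); exact: Gdot_continuous.
apply: (within_itv_continuousM cFh); apply: (within_itv_continuousV cA) => x.
exact: Gdot_gt0.
Qed.

Lemma critical_regularity (G : R -> R) p (psi u : R -> R) :
  standing_G G -> 1 < p -> obstacle psi -> critical_point G p psi u ->
  exists (U1 W : R -> R) (c : R) (mu : {measure set (measurableTypeR R) -> \bar R}),
    (mu setT < +oo)%E /\
    mu (~` [set x | J01 x /\ u x = psi x]) = 0%E /\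
    {within J01, continuous U1} /\ {within J01, continuous W} /\
    prim 0 1 u U1 /\ prim 0 1 U1 (curv G p U1 W) /\
    W 0 = 0 /\ W 1 = 0 /\
    prim 0 1 W (fun t => (tail mu t - c) / derive1 G (U1 t)).
Proof.
move=> sG p1 [cpsi _] [_ [u1 [u2 [mu [Wu [muJ [muC crit]]]]]]].
have [cu [u00 [u10 [_ [Lqs wds]]]]] := Wu.
have mufin : (mu setT < +oo)%E.
  apply: (contact_measure_finite _ _ muJ muC); last by move=> x [].
  exact: contact_measurable.
have [U1 [u1U1 cU1 iu2 pU1 pu]] := W2p_C1_representative Wu.
have p0 : 0 < p by lra.
pose A x := derive1 G (U1 x); pose B x := derive1n 2 G (U1 x).
have A0 x : 0 < A x by exact: Gdot_gt0.
have cA : {within J01, continuous A}.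
  by apply: (within_itv_continuous_comp cU1); exact: Gdot_continuous.
have cB : {within J01, continuous B}.
  by apply: (within_itv_continuous_comp cU1); exact: Gddot_continuous.
have IJ x : I01 x -> 0 <= x /\ x <= 1.
  by rewrite /= in_itv/= => /andP[? ?]; split; exact: ltW.
have mcI h : {within J01, continuous h} -> measurable_fun I01 h.
  move=> ch; apply: (@measurable_funS _ _ _ _ J01) => //; first exact: subset_itv_oo_cc.
  exact: (@within_continuous_measurable R 0 1).
have iu1 : leb.-integrable I01 (EFin \o u1) by have [] := wds 1%N isT.
have mu1 := integrable_measurable iu1.
have mU1 := mcI _ cU1; have mA := mcI _ cA; have mB := mcI _ cB.
have mu2 := integrable_measurable (integrable_cc_oo iu2).
have [KA KA0 hKA] := within_continuous_bounded cA.
have [KB KB0 hKB] := within_continuous_bounded cB.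
pose w := euler_w G p U1 u2.
have mw : measurable_fun I01 w by exact: euler_w_measurable.
have ip : leb.-integrable I01 (EFin \o (fun x => `|u2 x| `^ p)).
  by apply: in_Lq_integrable; exact: (Lqs 2%N).
have i1 : leb.-integrable I01 (EFin \o (fun=> 1)).
  by apply: integrable_cc_oo; have [] := prim_id (0 : R) 1.
have wE x : `|w x| = p * A x `^ (p - 1) * `|u2 x| `^ (p - 1) * (u2 x != 0)%:R.
  rewrite /w /euler_w powR_mul_self// !normrM normrN (gtr0_norm p0).
  rewrite (ger0_norm (powR_ge0 _ _)) normr_sg (ger0_norm (powR_ge0 _ _)).
  by rewrite -/(A x); ring.
have wle x : I01 x -> `|w x| <= p * KA `^ (p - 1) * `|u2 x| `^ (p - 1).
  move=> /IJ[x0 x1]; rewrite wE.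
  apply: (@le_trans _ _ (p * A x `^ (p - 1) * `|u2 x| `^ (p - 1))).
    by case: (u2 x != 0); rewrite ?mulr1 ?mulr0// !mulr_ge0 ?powR_ge0// ltW.
  rewrite ler_wpM2r ?powR_ge0// ler_pM2l//.
  rewrite ge0_ler_powR// ?nnegrE ?(ltW (A0 x))// ?(ltW KA0)//; first lra.
  by rewrite -[A x]gtr0_norm// hKA.
pose CC := p * KA `^ (p - 1).
have CC0 : 0 <= CC by rewrite mulr_ge0 ?powR_ge0// ltW.
have iwA : leb.-integrable I01 (EFin \o (fun x => w x * A x)).
  apply: (@integrable_le_bound _ _ (fun x => (CC * KA) * 1 + (CC * KA) * `|u2 x| `^ p)).
  - exact: measurable_funM.
  - exact: integrable_lin.
  - move=> x Ix; have [x0 x1] := IJ _ Ix; rewrite (normrM (w x)) -mulrDr mulrAC.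
    rewrite ler_pM// ?hKA//.
    apply: (le_trans (wle _ Ix)); rewrite -/CC ler_wpM2l//.
    exact: powR_pred_le.
(* The contribution of d/dx G'(u') to the equation. It is of order |u''|^p, hence integrable but at
   this point not known to be bounded. *)
pose H x := w x * (B x * u2 x).
have iH : leb.-integrable I01 (EFin \o H).
  apply: (@integrable_le_bound _ _ (fun x => (CC * KB) * `|u2 x| `^ p + 0 * 1)).
  - by apply: measurable_funM => //; exact: measurable_funM.
  - exact: integrable_lin.
  - move=> x Ix; have [x0 x1] := IJ _ Ix; rewrite mul0r addr0 /H (normrM (w x)) (normrM (B x)).
    rewrite -(@mulr_powRB1 _ `|u2 x| p)//.
    have -> : CC * KB * (`|u2 x| * `|u2 x| `^ (p - 1)) =
       (CC * `|u2 x| `^ (p - 1)) * (KB * `|u2 x|) by ring.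
    by apply: ler_pM; [by []|by rewrite mulr_ge0|exact: (wle _ Ix)|rewrite ler_wpM2r// hKB].
pose m := tail mu.
have im : leb.-integrable J01 (EFin \o m).
  apply: (@integrable_bounded _ _ _ (m 0)); first exact: tail_measurable.
  by move=> t t0 t1; rewrite ger0_norm ?tail_ge0//; exact: tail_nonincreasing.
pose D x := 1 * m x + 1 * H x.
have iD : leb.-integrable J01 (EFin \o D).
  by apply: integrable_lin => //; exact: integrable_oo_cc.
have EL : {ae leb, forall x, I01 x ->
     w x * A x = \int[leb]_(t in `[0, x]) D t - x * \int[leb]_(t in J01) D t}.
  apply: du_Bois_Reymond => // k mk k1.
  have mkI : measurable_fun I01 k.
    apply: (@measurable_funS _ _ _ _ J01) => //; exact: subset_itv_oo_cc.
  have := crit _ _ _ (variation_admissible mk k1 p1).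
  pose z := zero_mean_prim k.
  have cz : {within J01, continuous z} by exact: (zero_mean_prim_continuous mk k1).
  have iz := within_continuous_integrable cz.
  have [Z Z0 zZ] := within_continuous_bounded cz.
  have mz := mcI _ cz.
  rewrite (integral_mu_tail mufin iz).
  have iHz : leb.-integrable I01 (EFin \o (fun x => H x * z x)).
    by apply: (@integrable_mul_bounded _ _ _ _ Z) => // x /IJ[]; exact: zZ.
  have iwAk : leb.-integrable I01 (EFin \o (fun x => w x * A x * k x)).
    by apply: (@integrable_mul_bounded _ _ _ _ 1) => // x /IJ[]; exact: k1.
  have imz : leb.-integrable J01 (EFin \o (fun x => m x * z x)).
    apply: (@integrable_mul_bounded _ _ _ _ Z) => //.
      exact: (@within_continuous_measurable R 0 1).
    by move=> x /=; rewrite in_itv/= => /andP[]; exact: zZ.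
  have mddG : measurable_fun setT (derive1n 2 G).
    by apply: continuous_measurable_fun; exact: Gddot_continuous.
  have mdG : measurable_fun setT (derive1 G).
    by apply: continuous_measurable_fun; exact: Gdot_continuous.
  have mint v : measurable_fun I01 v -> measurable_fun I01 (fun x => (- euler_w G p v u2 x *
      ((derive1n 2 G) (v x) * u2 x * z x + derive1 G (v x) * k x))).
    move=> mv; apply: measurable_funM.
      by apply: measurable_funN; exact: euler_w_measurable.
    apply: measurable_funD.
      apply: measurable_funM; last exact: mz.
      apply: measurable_funM; last exact: mu2.
      exact: (@measurableT_comp _ _ _ _ _ _ (derive1n 2 G)).
    apply: measurable_funM; last exact: mkI.
    exact: (@measurableT_comp _ _ _ _ _ _ (derive1 G)).
  move=> E.
  (* The equation is stated with the given weak derivative [u1]; it is rewritten with the continuous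
     representative [U1], equal to it almost everywhere. *)
  have {}E : \int[leb]_(x in I01) (- euler_w G p U1 u2 x *
      ((derive1n 2 G) (U1 x) * u2 x * z x + derive1 G (U1 x) * k x)) =
     \int[leb]_(t in J01) (z t * tail mu t).
    rewrite {2}/Rintegral -E -/(Rintegral _ _ _).
    apply: ae_Rintegral => //; [exact: mint|exact: mint|].
    move: u1U1; apply: filterS; first exact: (ae_filter_ringOfSetsType leb).
    by move=> x Hx Ix; rewrite /euler_w (Hx Ix).
  have E1 : \int[leb]_(x in I01) ((-1) * (H x * z x) + (-1) * (w x * A x * k x)) =
     \int[leb]_(t in J01) (m t * z t).
    transitivity (\int[leb]_(t in J01) (z t * tail mu t)).
      by rewrite -E; apply: eq_Rintegral => x _; rewrite /H /A /B -/w; ring.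
    by apply: eq_Rintegral => x _; rewrite mulrC.
  move: E1; rewrite Rintegral_lin// => E1.
  have -> : \int[leb]_(x in J01) (D x * zero_mean_prim k x) =
     \int[leb]_(x in J01) (1 * (m x * z x) + 1 * (H x * z x)).
    by apply: eq_Rintegral => x _; rewrite /D -/z; ring.
  rewrite Rintegral_lin//; last exact: integrable_oo_cc.
  rewrite -E1 -(@Rintegral_oo_cc _ (fun x => H x * z x)); last exact: integrable_measurable iHz.
  by ring.
pose c := \int[leb]_(t in J01) D t.
pose E x := \int[leb]_(t in `[0, x]) D t - x * c.
have cE : {within J01, continuous E}.
  move=> t; apply: cvgB.
    by apply: (@parameterized_integral_continuous R 0 1 D).
  apply: cvgM; last exact: cvg_cst.
  by move: t; apply: continuous_subspaceT => t; exact: cvg_id.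
pose W x := E x / A x.
have cW : {within J01, continuous W}.
  by apply: within_itv_continuousM => //; exact: within_itv_continuousV.
pose U2 := curv G p U1 W.
have cU2 : {within J01, continuous U2} by exact: curv_continuous.
have wW : {ae leb, forall x, I01 x -> w x = W x}.
  move: EL; apply: filterS; first exact: (ae_filter_ringOfSetsType leb).
  by move=> x Hx Ix; rewrite /W /E /c -(Hx Ix) mulfK// gt_eqF.
have u2U2 : {ae leb, forall x, I01 x -> u2 x = U2 x}.
  move: wW; apply: filterS; first exact: (ae_filter_ringOfSetsType leb).
  move=> x Hx Ix; rewrite /U2 /curv; apply: euler_inverse => //.
  - exact: A0.
  - exact: (esym (Hx Ix)).
have [K2 K20 hU2] := within_continuous_bounded cU2.
have iU2 := within_continuous_integrable cU2.
have iu2I := integrable_cc_oo iu2; have iU2I := integrable_cc_oo iU2.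
have pU1' : prim 0 1 U1 U2.
  split=> // x y x0 xy y1; have [_ ->] := pU1 => //.
  have y0 := le_trans x0 xy; have x1 := le_trans xy y1.
  have := ae_Rintegral_itv iu2I iU2I u2U2 x0 x1.
  have := ae_Rintegral_itv iu2I iU2I u2U2 y0 y1.
  rewrite (@Rintegral_cat _ 0 x y)//; last exact: integrable_sub iu2 _ _.
  rewrite [in X in _ = X -> _](@Rintegral_cat _ 0 x y)//; last exact: integrable_sub iU2 _ _.
  by move=> e1 e2; rewrite e2 in e1; lra.
(* Second pass: [u''] now has a continuous representative, so the density of w A can be replaced by
   a bounded one and [W = E / A] differentiated by the product rule. *)
pose H' x := W x * (B x * U2 x).
have cH' : {within J01, continuous H'}.
  by apply: within_itv_continuousM => //; exact: within_itv_continuousM.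
have [KH KH0 hKH] := within_continuous_bounded cH'.
have HH' : {ae leb, forall x, I01 x -> H x = H' x}.
  apply: filterS2 wW u2U2; first exact: (ae_filter_ringOfSetsType leb).
  by move=> x h1 h2 Ix; rewrite /H /H' (h1 Ix) (h2 Ix).
have iH' := within_continuous_integrable cH'.
pose D' x := 1 * m x + 1 * H' x.
have iD' : leb.-integrable J01 (EFin \o D') by apply: integrable_lin.
have DD' : {ae leb, forall x, I01 x -> D x = D' x}.
  move: HH'; apply: filterS; first exact: (ae_filter_ringOfSetsType leb).
  by move=> x h1 Ix; rewrite /D /D' (h1 Ix).
have E0 : E 0 = 0 by rewrite /E set_itv1 Rintegral_set1 mul0r subr0.
have E1 : E 1 = 0 by rewrite /E mul1r subrr.
have pE : prim 0 1 E (fun x => 1 * D' x + (- c) * 1).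
  apply: prim_eq (prim_lin 1 (- c) (prim_int iD') (prim_id 0 1)) _ _ => // x x0 x1.
  rewrite /E (ae_Rintegral_itv _ _ DD' x0 x1); [|exact: integrable_cc_oo..].
  by ring.
have DK' t : 0 <= t -> t <= 1 -> `|1 * D' t + (- c) * 1| <= m 0 + KH + `|c|.
  move=> t0 t1; rewrite mulr1 mul1r (le_trans (ler_normB _ _))// lerD2r.
  rewrite /D' !mul1r (le_trans (ler_normD _ _))// lerD ?hKH//.
  by rewrite ger0_norm ?tail_ge0//; exact: tail_nonincreasing.
have ch : {within J01, continuous (fun t => - (A t)^-1 ^+ 2 * B t)}.
  apply: within_itv_continuousM => //.
  rewrite (_ : (fun x => - _) = (fun x => (- (A x)^-1) * (A x)^-1)); last first.
    by apply/funext => x; rewrite expr2 mulNr.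
  have cVA := within_itv_continuousV cA A0.
  by apply: within_itv_continuousM => // t; apply: cvgN; exact: cVA.
have pV : prim 0 1 (fun x => (A x)^-1) (fun t => - (A t)^-1 ^+ 2 * B t * U2 t).
  apply: (@prim_chain R 0 1 U1 U2 (fun s => (derive1 G s)^-1) _ K2) => // t t0 t1.
  have dn0 : derive1 G (U1 t) != 0 by rewrite gt_eqF//; exact: A0.
  have := @is_derive1_comp R GRing.inv (derive1 G) (U1 t) _ _ (is_derive_inv dn0) (Gdot_derive sG _).
  by [].
have [KV KV0 hKV] := within_continuous_bounded ch.
have pW := prim_mul pE pV DK' _.
exists U1, W, c, mu; split=> //; split=> //; split=> //; split=> //; split=> //; split=> //.
split; first by rewrite /W E0 mul0r.
split; first by rewrite /W E1 mul0r.
apply: prim_eq.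
- apply: (pW (KV * K2)) => t t0 t1; rewrite normrM ler_pM ?hKV ?hU2//.
- by [].
move=> t t0 t1; rewrite -/(A t) -/m /D' /H' /W.
by field; rewrite gt_eqF.
Qed.

End critical_points.

(** * Shape of the solution *)

Section prim_order.
Context {R : realType}.
Local Notation leb := (@lebesgue_measure R).
Implicit Types (a b c x y s t d e K : R) (f g h k F D : R -> R).

Lemma prim_ge a b f g K x y : prim a b f g -> a <= x -> x <= y -> y <= b ->
  (forall t, x <= t -> t <= y -> K <= g t) -> K * (y - x) <= f y - f x.
Proof.
move=> fg ax xy yb H.
have [iK E] := prim_lin K 0 (prim_id x y) (prim_id x y).
have := E x y (lexx x) xy (lexx y); rewrite !mul0r !addr0 -mulrBr => ->.
rewrite fg.2//;  apply: le_Rintegral => //.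
- by move: iK; rewrite mul0r addr0.
- exact: integrable_sub fg.1 _ _.
- by move=> t /=; rewrite in_itv/= => /andP[xt ty]; rewrite mulr1 H.
Qed.

Lemma prim_le a b f g K x y : prim a b f g -> a <= x -> x <= y -> y <= b ->
  (forall t, x <= t -> t <= y -> g t <= K) -> f y - f x <= K * (y - x).
Proof.
move=> fg ax xy yb H.
have := @prim_ge a b _ _ (- K) x y (prim_lin (-1) 0 fg (prim_id a b)) ax xy yb.
rewrite !mul0r !addr0 => H'; have {}H' : - K * (y - x) <= -1 * f y - (-1 * f x).
  by apply: H' => t xt ty; rewrite ?mul0r ?addr0 mulN1r lerN2 H.
by rewrite -lerN2; move: H'; congr (_ <= _); ring.
Qed.

Lemma prim_is_derive a b f g x : prim a b f g -> {within `[a, b], continuous g} ->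
  a < x -> x < b -> is_derive x 1 f (g x).
Proof.
move=> fg cg ax xb; apply: dist_is_derive => e e0.
have [d d0 Hd] := (within_continuous_dist _ _ _).1 cg x e (ltW ax) (ltW xb) e0.
pose r := Num.min (d / 2) (Num.min (x - a) (b - x)).
have r1 : r <= d / 2 by rewrite /r ge_min lexx.
have r2 : r <= x - a by rewrite /r !ge_min lexx orbT.
have r3 : r <= b - x by rewrite /r !ge_min lexx !orbT.
exists r; first by rewrite /r !lt_min; apply/and3P; split; lra.
move=> y; rewrite ltr_norml => /andP[yx1 yx2].
(* Subtracting the tangent leaves a density of size at most e near x, hence an increment of size at
   most e |y - x|. *)
have pr : prim (x - r) (x + r) (fun t => 1 * f t + (- g x) * t) (fun t => 1 * g t + (- g x) * 1).
  by apply: prim_lin; [apply: prim_sub fg _ _; lra|exact: prim_id].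
have bd t : x - r <= t -> t <= x + r -> `|1 * g t + (- g x) * 1| <= e.
  move=> t1 t2; rewrite mul1r mulr1; apply/ltW/Hd; [lra|lra|].
  by rewrite ltr_norml; apply/andP; split; lra.
have := @prim_lipschitz _ _ _ _ _ _ pr bd x y.
have -> : 1 * f y + - g x * y - (1 * f x + - g x * x) = f y - f x - g x * (y - x) by ring.
by apply; lra.
Qed.

End prim_order.

(* What the Euler-Lagrange equation says about a critical point: [W] is
   the continuous representative of Euler's substitution, [m t] the mass that
   the obstacle measure puts on [[t, 1]], [c] the Lagrange multiplier of the
   constraint [u 0 = u 1], and [M] the total mass. *)
Record EL_data {R : realType} (G : R -> R) (p : R) (u U1 W m : R -> R) (c M del : R) : Prop := ELData {
  el_G : standing_G G;
  el_p : 1 < p;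
  el_cU1 : {within `[0, 1], continuous U1};
  el_cW : {within `[0, 1], continuous W};
  el_pu : prim 0 1 u U1;
  el_pU1 : prim 0 1 U1 (curv G p U1 W);
  el_W0 : W 0 = 0;
  el_W1 : W 1 = 0;
  el_pW : prim 0 1 W (fun t => (m t - c) / derive1 G (U1 t));
  el_m_noninc : forall s t, s <= t -> m t <= m s;
  el_m_ge0 : forall t, 0 <= m t;
  el_del0 : 0 < del;
  el_del1 : del < 1/2;
  el_mM : forall t, 0 <= t -> t <= del -> m t = M;
  el_m0 : forall t, 1 - del <= t -> t <= 1 -> m t = 0;
  el_u0 : u 0 = 0;
  el_u1 : u 1 = 0;
  el_upos : exists x, [/\ 0 < x, x < 1 & 0 < u x] }.

Section structure.
Context {R : realType}.
Local Notation leb := (@lebesgue_measure R).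
Local Notation I01 := (`]0%R, 1%R[%classic : set R).
Local Notation J01 := (`[0%R, 1%R]%classic : set R).
Implicit Types (a b x y s t d e K : R) (f g h k F D : R -> R).

Variables (G : R -> R) (p : R) (u U1 W m : R -> R) (c M del : R).
Hypothesis E : EL_data G p u U1 W m c M del.
Let sG := el_G E.
Let p1 := el_p E.
Let cU1 := el_cU1 E.
Let cW := el_cW E.
Let pu := el_pu E.
Let pU1 := el_pU1 E.
Let W0 := el_W0 E.
Let W1 := el_W1 E.
Let pW := el_pW E.
Let m_noninc := el_m_noninc E.
Let m_ge0 := el_m_ge0 E.
Let del0 := el_del0 E.
Let del1 := el_del1 E.
Let mM := el_mM E.
Let m0 := el_m0 E.
Let u0 := el_u0 E.
Let u1 := el_u1 E.
Let upos := el_upos E.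

Let A x := derive1 G (U1 x).
Let U2 := curv G p U1 W.

Lemma speed_continuous : {within J01, continuous A}.
Proof. by apply: (within_itv_continuous_comp cU1); exact: Gdot_continuous. Qed.

Lemma speed_gt0 x : 0 < A x.
Proof. exact: Gdot_gt0. Qed.

Lemma speed_bounds : exists2 b0 : R, 0 < b0 & forall x, 0 <= x -> x <= 1 -> b0 <= (A x)^-1.
Proof.
have [K K0 hK] := within_continuous_bounded speed_continuous.
exists K^-1; first by rewrite invr_gt0.
move=> x x0 x1; rewrite lef_pV2 ?posrE ?speed_gt0//.
by rewrite (le_trans (ler_norm _))// hK.
Qed.

Lemma tail_le_mass t : 0 <= t -> m t <= M.
Proof. by move=> t0; rewrite -(mM (lexx 0) (ltW del0)) m_noninc. Qed.

(** Without mass the density of [W] is - c / A, of constant sign, while [W] vanishes at both ends;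
    so c = 0 and [W = 0]. Then u is affine with zero boundary values, although it is positive
    somewhere. *)
Lemma contact_mass_gt0 : 0 < M.
Proof.
have [b0 b00 hb] := speed_bounds.
rewrite ltNge; apply/negP => M0.
have mz t : 0 <= t -> m t = 0.
  by move=> t0; apply/eqP; rewrite eq_le m_ge0 (le_trans (tail_le_mass t0)).
have c0 : c = 0.
  apply/eqP; rewrite eq_le; apply/andP; split; rewrite leNgt; apply/negP => cc.
    have := @prim_le _ _ _ _ _ (- c * b0) 0 1 pW (lexx 0) ler01 (lexx 1).
    rewrite W0 W1 !subr0 mulr1 => H; have : 0 <= - c * b0.
      apply: H => t t0 t1; rewrite mz// sub0r -/(A t) !mulNr lerN2 ler_pM2l//.
      exact: hb.
    by rewrite mulNr oppr_ge0 leNgt mulr_gt0.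
  have := @prim_ge _ _ _ _ _ (- c * b0) 0 1 pW (lexx 0) ler01 (lexx 1).
  rewrite W0 W1 !subr0 mulr1 => H; have : - c * b0 <= 0.
    apply: H => t t0 t1; rewrite mz// sub0r -/(A t) ler_pM2l ?oppr_gt0//.
    exact: hb.
  by rewrite leNgt mulr_gt0// oppr_gt0.
have Wz x : 0 <= x -> x <= 1 -> W x = 0.
  move=> x0 x1; apply/eqP; rewrite eq_le; apply/andP; split.
    have := @prim_le _ _ _ _ _ 0 0 x pW (lexx 0) x0 x1; rewrite W0 mul0r subr0; apply.
    by move=> t t0 tx; rewrite mz// c0 subrr mul0r.
  have := @prim_ge _ _ _ _ _ 0 0 x pW (lexx 0) x0 x1; rewrite W0 mul0r subr0; apply.
  by move=> t t0 tx; rewrite mz// c0 subrr mul0r.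
have U2z x : 0 <= x -> x <= 1 -> curv G p U1 W x = 0.
  by move=> x0 x1; rewrite /curv Wz// sgr0 oppr0 !mul0r.
have U1c x : 0 <= x -> x <= 1 -> U1 x = U1 0.
  move=> x0 x1; apply/eqP; rewrite -subr_eq0 eq_le; apply/andP; split.
    have := @prim_le _ _ _ _ _ 0 0 x pU1 (lexx 0) x0 x1; rewrite mul0r; apply.
    by move=> t t0 tx; rewrite U2z//; exact: le_trans x1.
  have := @prim_ge _ _ _ _ _ 0 0 x pU1 (lexx 0) x0 x1; rewrite mul0r; apply.
  by move=> t t0 tx; rewrite U2z//; exact: le_trans x1.
have uE x : 0 <= x -> x <= 1 -> u x = U1 0 * x.
  move=> x0 x1; have := @prim_le _ _ _ _ _ (U1 0) 0 x pu (lexx 0) x0 x1.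
  have := @prim_ge _ _ _ _ _ (U1 0) 0 x pu (lexx 0) x0 x1.
  rewrite u0 !subr0 => h1 h2; apply/eqP; rewrite eq_le; apply/andP; split.
    by apply: h2 => t t0 tx; rewrite U1c//; exact: le_trans x1.
  by apply: h1 => t t0 tx; rewrite U1c//; exact: le_trans x1.
have [x [x0 x1 ux]] := upos.
have := uE 1 ler01 (lexx 1); rewrite u1 mulr1 => e.
by move: ux; rewrite uE ?ltW// -e mul0r ltxx.
Qed.

(** If c <= 0, then [W] never decreases and gains a definite amount on [0, del]. If c >= M, it never
    increases and loses a definite amount on [1 - del, 1]. Both contradict W(0) = W(1). *)
Lemma multiplier_bounds : 0 < c /\ c < M.
Proof.
have [b0 b00 hb] := speed_bounds; have M0 := contact_mass_gt0.
have d0 := del0; have d1 := del1.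
split; rewrite ltNge; apply/negP => cc.
  have h1 : M * b0 * (del - 0) <= W del - W 0.
    apply: (prim_ge pW); [lra|lra|lra|] => t t0 td; apply: ler_pM.
    - exact: ltW.
    - exact: ltW.
    - by rewrite mM// lerDl oppr_ge0.
    - by apply: hb; lra.
  have h2 : 0 * (1 - del) <= W 1 - W del.
    apply: (prim_ge pW); [lra|lra|lra|] => t t0 td; rewrite mulr_ge0//.
      by rewrite subr_ge0 (le_trans cc).
    by rewrite invr_ge0 ltW// speed_gt0.
  have : 0 < M * b0 * (del - 0) by rewrite !mulr_gt0// subr0.
  by rewrite W0 W1 in h1 h2; lra.
have h1 : W 1 - W (1 - del) <= - (M * b0) * (1 - (1 - del)).
  apply: (prim_le pW); [lra|lra|lra|] => t t0 td; rewrite m0//.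
  rewrite sub0r mulNr lerN2; apply: ler_pM; [exact: ltW|exact: ltW|by []|].
  by apply: hb; lra.
have h2 : W (1 - del) - W 0 <= 0 * (1 - del - 0).
  apply: (prim_le pW); [lra|lra|lra|] => t t0 td.
  rewrite -/(A t) mulr_le0_ge0//; last by rewrite invr_ge0 ltW// speed_gt0.
  by rewrite subr_le0 (le_trans (tail_le_mass t0)).
have : 0 < M * b0 * del by rewrite !mulr_gt0.
by rewrite W0 W1 in h1 h2; lra.
Qed.

(** As [m] is nonincreasing, its value at the right end fixes the sign of [m - c] on the whole
    interval. *)
Lemma W_incr x y : 0 <= y -> y <= x -> x <= 1 -> c <= m x -> W y <= W x.
Proof.
move=> y0 yx x1 cm; rewrite -subr_ge0.
have := @prim_ge _ _ _ _ _ 0 y x pW y0 yx x1; rewrite mul0r; apply.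
move=> t yt tx; rewrite mulr_ge0 ?invr_ge0 ?(ltW (speed_gt0 _))//.
by rewrite subr_ge0 (le_trans cm)// m_noninc.
Qed.

Lemma W_decr x y : 0 <= x -> x <= y -> y <= 1 -> m x < c -> W y <= W x.
Proof.
move=> x0 xy y1 cm; rewrite -subr_le0.
have := @prim_le _ _ _ _ _ 0 x y pW x0 xy y1; rewrite mul0r; apply.
move=> t xt ty; rewrite mulr_le0_ge0 ?invr_ge0 ?(ltW (speed_gt0 _))//.
by rewrite subr_le0 ltW// (le_lt_trans _ cm)// m_noninc.
Qed.

(** Taking a maximum of [W] as the turning point avoids locating where [m] crosses the level c: a
    point on the wrong side of the crossing is handled by maximality. *)
Lemma W_unimodal : exists t0, [/\ 0 <= t0, t0 <= 1,
  forall x y, 0 <= x -> x <= y -> y <= t0 -> W x <= W y &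
  forall x y, t0 <= x -> x <= y -> y <= 1 -> W y <= W x].
Proof.
have [t0 tJ Hmax] := EVT_max ler01 cW; exists t0.
move: tJ; rewrite in_itv/= => /andP[t00 t01].
have mx x : 0 <= x -> x <= 1 -> W x <= W t0.
  by move=> x0 x1; apply: Hmax; rewrite in_itv/= x0 x1.
split=> // x y h1 h2 h3.
- have [cm|cm] := leP c (m y); first by apply: W_incr => //; exact: le_trans t01.
  apply: (@le_trans _ _ (W t0)); first by apply: mx => //; lra.
  by apply: W_decr => //; exact: le_trans h2.
- have [cm|cm] := leP c (m x); last by apply: W_decr => //; exact: le_trans h1.
  apply: (@le_trans _ _ (W t0)); first by apply: mx => //; lra.
  by apply: W_incr => //; lra.
Qed.

(** Where [W] increases, it is at least its value at min(x, del), and on [0, del] it grows at a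
    definite rate. Where it decreases, the same is done from the end 1. *)
Lemma W_lower_bound : exists2 kap : R, 0 < kap &
  forall x, 0 <= x -> x <= 1 -> kap * (x * (1 - x)) <= W x.
Proof.
have [b0 b00 hb] := speed_bounds; have [c0 cM] := multiplier_bounds.
have d0 := del0; have d1 := del1.
(* The density of [W] has numerator M - c near 0 and - c near 1. In the final constant, the factor
   [del] turns min(x, del) into a multiple of x. *)
pose q := Num.min (M - c) c.
have q0 : 0 < q by rewrite /q lt_min subr_gt0 cM.
have q1 : q <= M - c by rewrite /q ge_min lexx.
have q2 : q <= c by rewrite /q ge_min lexx orbT.
exists (q * b0 * del); first by rewrite !mulr_gt0.
have qb : 0 < q * b0 by rewrite mulr_gt0.
move=> x x0 x1; have [cm|cm] := leP c (m x).
- pose y := Num.min x del.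
  have y1 : y <= x by rewrite /y ge_min lexx.
  have y2 : y <= del by rewrite /y ge_min lexx orbT.
  have y3 : del * x <= y.
    rewrite /y le_min; apply/andP; split; first by rewrite ler_piMl//; lra.
    by rewrite ler_piMr// ltW.
  have y0 : 0 <= y by rewrite (le_trans _ y3)// mulr_ge0// ltW.
  apply: (@le_trans _ _ (W y)); last exact: W_incr.
  have h : q * b0 * (y - 0) <= W y - W 0.
    apply: (prim_ge pW) => //; first lra.
    move=> t t0 ty; rewrite mM//; last lra.
    by apply: ler_pM; [exact: ltW|exact: ltW|by []|apply: hb; lra].
  rewrite W0 !subr0 in h; apply: (le_trans _ h).
  have h5 : del * (x * (1 - x)) <= del * x.
    by rewrite ler_pM2l// ler_piMr//; lra.
  by rewrite -[leLHS]mulrA ler_pM2l//; exact: le_trans h5 y3.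
- pose y := Num.max x (1 - del).
  have y1 : x <= y by rewrite /y le_max lexx.
  have y2 : 1 - del <= y by rewrite /y le_max lexx orbT.
  have y3 : y <= 1 - del * (1 - x).
    rewrite /y ge_max; apply/andP; split.
      have : del * (1 - x) <= 1 - x by rewrite ler_piMl//; lra.
      lra.
    have : del * (1 - x) <= del by rewrite ler_piMr//; lra.
    lra.
  have y4 : y <= 1 by rewrite (le_trans y3)// gerBl mulr_ge0//; lra.
  apply: (@le_trans _ _ (W y)); last exact: W_decr.
  have h : W 1 - W y <= - (q * b0) * (1 - y).
    apply: (prim_le pW) => //; first lra.
    move=> t ty t1; rewrite m0//; last lra.
    rewrite sub0r mulNr lerN2.
    by apply: ler_pM; [exact: ltW|exact: ltW|by []|apply: hb; lra].
  rewrite W1 sub0r mulNr lerN2 in h; apply: (le_trans _ h).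
  rewrite -[leLHS]mulrA ler_pM2l//.
  have h5 : del * (x * (1 - x)) <= del * (1 - x).
    by rewrite ler_pM2l// ler_piMl//; lra.
  by lra.
Qed.

Lemma W_gt0 x : 0 < x -> x < 1 -> 0 < W x.
Proof.
move=> x0 x1; have [kap k0 H] := W_lower_bound.
by apply: lt_le_trans (H _ (ltW x0) (ltW x1)); rewrite !mulr_gt0// subr_gt0.
Qed.

Lemma W_ge0 x : 0 <= x -> x <= 1 -> 0 <= W x.
Proof.
move=> x0 x1; have [kap k0 H] := W_lower_bound.
by apply: le_trans (H _ x0 x1); rewrite !mulr_ge0// ?subr_ge0// ltW.
Qed.

Lemma curvE x : 0 <= x -> x <= 1 ->
  curv G p U1 W x = - ((p^-1 * W x) `^ (p - 1)^-1 * (A x)^-1).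
Proof.
have p1' := p1; move=> x0 x1; rewrite /curv; have [Wz|Wn] := eqVneq (W x) 0.
  rewrite Wz sgr0 oppr0 !mul0r mulr0 powR0 ?mul0r ?oppr0//.
  by rewrite invr_eq0; apply/eqP; lra.
have Wp : 0 < W x by rewrite lt_neqAle eq_sym Wn W_ge0.
by rewrite gtr0_sg// gtr0_norm// (mulrC p^-1) !mulN1r mulNr.
Qed.

Lemma curv_lt0 x : 0 < x -> x < 1 -> curv G p U1 W x < 0.
Proof.
have p1' := p1; move=> x0 x1; rewrite curvE ?ltW// oppr_lt0 mulr_gt0 ?invr_gt0 ?speed_gt0//.
by rewrite powR_gt0// mulr_gt0 ?W_gt0// invr_gt0; lra.
Qed.

Lemma curv_end x : W x = 0 -> curv G p U1 W x = 0.
Proof. by move=> Wx; rewrite /curv Wx sgr0 oppr0 !mul0r. Qed.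

Lemma curv_le0 x : 0 <= x -> x <= 1 -> curv G p U1 W x <= 0.
Proof.
by move=> x0 x1; rewrite curvE// oppr_le0 mulr_ge0 ?powR_ge0// invr_ge0 ltW// speed_gt0.
Qed.

Lemma slope_noninc x y : 0 <= x -> x <= y -> y <= 1 -> U1 y <= U1 x.
Proof.
move=> x0 xy y1; rewrite -subr_le0.
have := @prim_le _ _ _ _ _ 0 x y pU1 x0 xy y1; rewrite mul0r; apply.
by move=> t xt ty; apply: curv_le0; lra.
Qed.

(** The second derivative vanishes at 0 and 1, so the strict decrease is taken from a compact
    subinterval of the interior, where it has a negative maximum. *)
Lemma slope_decr x y : 0 <= x -> x < y -> y <= 1 -> U1 y < U1 x.
Proof.
move=> x0 xy y1.
pose a := x + (y - x) / 4; pose b := x + (y - x) / 2.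
have cU2 : {within `[a, b], continuous (curv G p U1 W)}.
  apply: continuous_subspaceW (curv_continuous sG p1 cU1 cW).
  by apply: subset_itv; rewrite bnd_simp /a /b; lra.
have ab : a <= b by rewrite /a /b; lra.
have [t tab Ht] := EVT_max ab cU2.
move: tab; rewrite in_itv/= => /andP[at_ tb].
have t2 : curv G p U1 W t < 0 by apply: curv_lt0; rewrite /a /b in at_ tb; lra.
have : U1 b - U1 a <= curv G p U1 W t * (b - a).
  apply: (prim_le pU1) => //; [rewrite /a; lra|rewrite /b; lra|].
  by move=> s as_ sb; apply: Ht; rewrite in_itv/= as_ sb.
have : curv G p U1 W t * (b - a) < 0 by rewrite nmulr_rlt0// /a /b; lra.
have : U1 a <= U1 x by apply: slope_noninc; rewrite /a; lra.
have : U1 y <= U1 b by apply: slope_noninc; rewrite /b; lra.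
lra.
Qed.

Lemma strictly_concave x y t : 0 <= x -> x < y -> y <= 1 -> 0 < t -> t < 1 ->
  t * u x + (1 - t) * u y < u (t * x + (1 - t) * y).
Proof.
move=> x0 xy y1 t0 t1; set z := t * x + (1 - t) * y.
have zx : z - x = (1 - t) * (y - x) by rewrite /z; ring.
have yz : y - z = t * (y - x) by rewrite /z; ring.
have zx0 : 0 < z - x by rewrite zx mulr_gt0//; lra.
have yz0 : 0 < y - z by rewrite yz mulr_gt0//; lra.
(* The midpoint supplies the strictness: on [x, a] the slope is at least [U1 a], which exceeds
   [U1 z]. *)
pose a := (x + z) / 2.
have ha : U1 a * (a - x) <= u a - u x.
  apply: (prim_ge pu) => //; [rewrite /a; lra|rewrite /a; lra|].
  by move=> s xs sa; apply: slope_noninc; rewrite /a in sa *; lra.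
have hz : U1 z * (z - a) <= u z - u a.
  apply: (prim_ge pu) => //; [rewrite /a; lra|rewrite /a; lra|lra|].
  by move=> s xs sa; apply: slope_noninc; rewrite /a in xs; lra.
have hy : u y - u z <= U1 z * (y - z).
  apply: (prim_le pu) => //; [lra|lra|].
  by move=> s xs sa; apply: slope_noninc; lra.
have az : U1 z < U1 a by apply: slope_decr; rewrite /a; lra.
have hs : U1 z * (a - x) < U1 a * (a - x) by rewrite ltr_pM2r// /a; lra.
have h1 : U1 z * (z - x) < u z - u x by rewrite !mulrBr in ha hz hs *; lra.
have h2 : t * (U1 z * (z - x)) < t * (u z - u x) by rewrite ltr_pM2l.
have h3 : (1 - t) * (u y - u z) <= (1 - t) * (U1 z * (y - z)) by rewrite ler_pM2l//; lra.
have h4 : t * (U1 z * (z - x)) = (1 - t) * (U1 z * (y - z)).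
  by rewrite zx yz; ring.
rewrite !mulrBr in h2 h3 h4; lra.
Qed.

Lemma concave : concave_on01 u.
Proof.
have key x y t : 0 <= x -> x < y -> y <= 1 -> 0 <= t -> t <= 1 ->
    t * u x + (1 - t) * u y <= u (t * x + (1 - t) * y).
  move=> x0 xy y1; rewrite le_eqVlt => /predU1P[<- _|t0].
    by rewrite !mul0r subr0 !mul1r !add0r.
  rewrite le_eqVlt => /predU1P[->|t1]; first by rewrite subrr !mul0r !mul1r !addr0.
  exact/ltW/strictly_concave.
move=> x y t; rewrite /= !in_itv/= => /andP[x0 x1] /andP[y0 y1] t0 t1.
have [xy|yx|->] := ltgtP x y; first exact: key.
- have := key y x (1 - t) y0 yx x1; rewrite subKr [in X in X -> _]subr_ge0 gerBl.
  by rewrite addrC [in u (_ + _)]addrC; apply.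
- by rewrite -!mulrDl subrKC !mul1r.
Qed.

Lemma classical_C2 : C2_closed u U1 (curv G p U1 W).
Proof.
have cU2 := curv_continuous sG p1 cU1 cW.
have [K _ hK] := within_continuous_bounded cU1.
split; last by split => //; exact: prim_continuous pu hK.
move=> x /=; rewrite in_itv/= => /andP[x0 x1].
by split; [exact: prim_is_derive pu _ _ _|exact: prim_is_derive pU1 _ _ _].
Qed.

End structure.

(** * The third derivative *)

Section contact.
Context {R : realType}.
Local Notation leb := (@lebesgue_measure R).
Local Notation I01 := (`]0%R, 1%R[%classic : set R).
Local Notation J01 := (`[0%R, 1%R]%classic : set R).
Implicit Types (a b c x y s t d e K : R) (f g h k F D : R -> R).

(** Serves twice: with B a smaller tail, [m] is constant across gaps of the contact set; with B
    empty, [m] vanishes beyond it. *)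
Lemma tail_le_off_contact (mu : {measure set (measurableTypeR R) -> \bar R}) (C B : set R) t :
  (mu setT < +oo)%E -> measurable C -> mu (~` C) = 0%E -> measurable B ->
  (`[t, 1]%classic `<=` B `|` ~` C) -> tail mu t <= fine (mu B).
Proof.
move=> mufin mC muC mB tB; apply: fine_le; [exact: mu_fin_num|exact: mu_fin_num|].
apply: (@le_trans _ _ (mu (B `|` ~` C))).
  by apply: le_measure => //; rewrite inE//; apply: measurableU => //; exact: measurableC.
apply: (@le_trans _ _ (mu B + mu (~` C))%E).
  by apply: measureU2 => //; exact: measurableC.
by rewrite muC adde0.
Qed.

Lemma off_contact_ends (u psi : R -> R) :
  {within J01, continuous u} -> {within J01, continuous psi} ->
  psi 0 < u 0 -> psi 1 < u 1 ->
  exists del, [/\ 0 < del, del < 1/2,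
    forall t, 0 <= t -> t <= del -> psi t < u t &
    forall t, 1 - del <= t -> t <= 1 -> psi t < u t].
Proof.
move=> cu cpsi h0 h1.
have key x : 0 <= x -> x <= 1 -> psi x < u x -> exists2 d : R, 0 < d &
    forall t, 0 <= t -> t <= 1 -> `|t - x| < d -> psi t < u t.
  move=> x0 x1 hx; have e0 : 0 < (u x - psi x) / 2 by lra.
  have [d1 d10 H1] := (within_continuous_dist _ _ _).1 cu x _ x0 x1 e0.
  have [d2 d20 H2] := (within_continuous_dist _ _ _).1 cpsi x _ x0 x1 e0.
  exists (Num.min d1 d2); first by rewrite lt_min d10.
  move=> t t0 t1; rewrite lt_min => /andP[t2 t3].
  have := H1 t t0 t1 t2; have := H2 t t0 t1 t3.
  by rewrite !ltr_norml => /andP[? ?] /andP[? ?]; lra.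
have [d1 d10 H1] := key 0 (lexx 0) ler01 h0.
have [d2 d20 H2] := key 1 ler01 (lexx 1) h1.
(* Division by 3 gives both [d < 1/2] and closed intervals inside the open neighbourhoods. *)
pose d := Num.min (Num.min d1 d2) 1 / 3.
have dd1 : Num.min (Num.min d1 d2) 1 <= d1 by rewrite !ge_min lexx.
have dd2 : Num.min (Num.min d1 d2) 1 <= d2 by rewrite !ge_min lexx orbT.
have dd3 : Num.min (Num.min d1 d2) 1 <= 1 by rewrite !ge_min lexx !orbT.
have dd0 : 0 < Num.min (Num.min d1 d2) 1 by rewrite !lt_min d10 d20 ltr01.
exists d; split; rewrite /d; [lra|lra| |] => t h2 h3.
- by apply: H1; [lra|lra|rewrite subr0 ger0_norm//; lra].
- by apply: H2; [lra|lra|rewrite ltr_norml; apply/andP; split; lra].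
Qed.

Lemma critical_EL_data (G : R -> R) p (psi u : R -> R) :
  standing_G G -> 1 < p -> obstacle psi -> critical_point G p psi u ->
  exists (U1 W : R -> R) (c M del : R) (mu : {measure set (measurableTypeR R) -> \bar R}),
    EL_data G p u U1 W (tail mu) c M del /\
    (mu setT < +oo)%E /\ measurable [set x | J01 x /\ u x = psi x] /\
    mu (~` [set x | J01 x /\ u x = psi x]) = 0%E.
Proof.
move=> sG p1 ob crit.
have [U1 [W [c [mu [mufin [muC [cU1 [cW [pu [pU1 [W0 [W1 pW]]]]]]]]]]]] :=
  critical_regularity sG p1 ob crit.
have [[[v1 [v2 [cu [u0 [u1 _]]]]] upsi] _] := crit.
have [cpsi [psi0 [psi1 [x0 [x00 [x01 psix0]]]]]] := ob.
have mC := contact_measurable cu cpsi.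
have [|| del [del0 del1 H0 H1]] := off_contact_ends cu cpsi.
- by rewrite u0.
- by rewrite u1.
exists U1, W, c, (tail mu 0), del, mu; split=> //; split=> //.
- exact: tail_nonincreasing.
- exact: tail_ge0.
- move=> t t0 td; apply/eqP; rewrite eq_le tail_nonincreasing//=.
  apply: (tail_le_off_contact mufin mC muC) => // x /=; rewrite !in_itv/= => /andP[h0 h1].
  have [tx|xt] := leP t x; first by left.
  right=> -[_ ux]; have := H0 x h0 (ltW (lt_le_trans xt td)); by rewrite ux ltxx.
- move=> t td t1; apply/eqP; rewrite eq_le tail_ge0 andbT.
  have := @tail_le_off_contact mu _ set0 t mufin mC muC measurable0.
  rewrite measure0; apply => x /=; rewrite in_itv/= => /andP[h0 h1]; right=> -[_ ux].
  by have := H1 x (le_trans td h0) h1; rewrite ux ltxx.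
- exists x0; split=> //; apply: (lt_le_trans psix0); apply: upsi.
  by rewrite /= in_itv/= !ltW.
Qed.

End contact.

(** * An explicit third derivative on compact subintervals *)

Section third_derivative.
Context {R : realType}.
Local Notation leb := (@lebesgue_measure R).
Local Notation I01 := (`]0%R, 1%R[%classic : set R).
Local Notation J01 := (`[0%R, 1%R]%classic : set R).
Implicit Types (a b x y s t d e K : R) (f g h k F D : R -> R).

Variables (G : R -> R) (p : R) (u U1 W m : R -> R) (c M del : R).
Hypothesis E : EL_data G p u U1 W m c M del.

Let A x := derive1 G (U1 x).
Let B x := derive1n 2 G (U1 x).
Let r := (p - 1)^-1.
Let S x := p^-1 * W x.
Let U2 := curv G p U1 W.

(** The product rule for u'' = - S^r / A. The first term carries W'; the second comes from
    differentiating 1 / A, with u'' replaced by - S^r / A once more. *)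
Definition third x : R :=
  - (r / p) * (S x `^ (r - 1) * (m x - c) * ((A x)^-1 * (A x)^-1)) -
  (S x `^ r * S x `^ r) * ((A x)^-1 * (A x)^-1) * (B x * (A x)^-1).

Lemma inv_speed_continuous : {within J01, continuous (fun x => (A x)^-1)}.
Proof. exact: within_itv_continuousV (speed_continuous E) (speed_gt0 E). Qed.

Lemma second_speed_continuous : {within J01, continuous B}.
Proof.
by apply: (within_itv_continuous_comp (el_cU1 E)); exact: (Gddot_continuous (el_G E)).
Qed.

Lemma S_continuous : {within J01, continuous S}.
Proof.
by apply: within_itv_continuousM; [move=> t; exact: cvg_cst|exact: (el_cW E)].
Qed.

Lemma S_gt0 x : 0 < x -> x < 1 -> 0 < S x.
Proof.
move=> x0 x1; rewrite mulr_gt0 ?(W_gt0 E)// invr_gt0.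
by have := el_p E => ?; lra.
Qed.

Lemma S_ge0 x : 0 <= x -> x <= 1 -> 0 <= S x.
Proof.
move=> x0 x1; rewrite mulr_ge0 ?(W_ge0 E)// invr_ge0.
by have := el_p E => ?; lra.
Qed.

Lemma prim_inv_speed :
  prim 0 1 (fun x => (A x)^-1) (fun t => - (A t)^-1 ^+ 2 * B t * U2 t).
Proof.
have cU2 := curv_continuous (el_G E) (el_p E) (el_cU1 E) (el_cW E).
have [K2 K20 hU2] := within_continuous_bounded cU2.
apply: (@prim_chain R 0 1 U1 U2 (fun s => (derive1 G s)^-1) _ K2 (el_pU1 E) hU2).
  apply: within_itv_continuousM; last exact: second_speed_continuous.
  rewrite (_ : (fun x => - _) = (fun x => (- (A x)^-1) * (A x)^-1)); last first.
    by apply/funext => x; rewrite expr2 mulNr.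
  have cVA := inv_speed_continuous.
  by apply: within_itv_continuousM => // t; apply: cvgN; exact: cVA.
move=> t t0 t1.
have dn0 : derive1 G (U1 t) != 0 by rewrite gt_eqF//; exact: (speed_gt0 E).
by have := @is_derive1_comp R GRing.inv (derive1 G) (U1 t) _ _ (is_derive_inv dn0)
  (Gdot_derive (el_G E) _).
Qed.

Lemma m_bounded t : 0 <= t -> `|m t - c| <= M.
Proof.
move=> t0; have [c0 cM] := multiplier_bounds E.
have := tail_le_mass E t0; have := el_m_ge0 E t.
by move=> ? ?; rewrite ler_norml; apply/andP; split; lra.
Qed.

Lemma W_density_bound : exists2 L : R, 0 < L &
  forall t, 0 <= t -> t <= 1 -> `|(m t - c) / A t| <= L.
Proof.
have [K K0 hK] := within_continuous_bounded inv_speed_continuous.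
have M0 := contact_mass_gt0 E.
exists (M * K); first by rewrite mulr_gt0.
move=> t t0 t1; rewrite normrM ler_pM//; first exact: m_bounded.
exact: hK.
Qed.

(** Away from the ends [S] is bounded below by a positive constant, so its powers are C^1 functions
    of [S]. On all of [0, 1] this fails for p > 2, where S^(r - 1) is unbounded. *)
Lemma prim_third a b : 0 < a -> a < b -> b < 1 ->
  prim a b U2 third /\ exists K, forall t, a <= t -> t <= b -> `|third t| <= K.
Proof.
move=> a0 ab b1.
have sub f g : prim 0 1 f g -> prim a b f g.
  by move=> H; apply: prim_sub H _ _; exact: ltW.
have J t : a <= t -> t <= b -> 0 <= t /\ t <= 1 by move=> *; split; lra.
have cJ h : {within J01, continuous h} -> {within `[a, b], continuous h}.
  by move=> ch; apply: continuous_subspaceW ch; apply: subset_itv; rewrite bnd_simp ltW.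
have [L L0 hL] := W_density_bound.
have p1 := el_p E; have p0 : 0 < p by lra.
have pS : prim a b S (fun t => p^-1 * ((m t - c) / A t)).
  have := prim_lin p^-1 0 (sub _ _ (el_pW E)) (prim_id a b).
  by move=> H; apply: prim_eq H _ _ => t _ _; rewrite mul0r addr0.
have bS t : a <= t -> t <= b -> `|p^-1 * ((m t - c) / A t)| <= p^-1 * L.
  move=> at_ tb; have [t0 t1] := J t at_ tb.
  by rewrite normrM gtr0_norm ?invr_gt0// ler_pM2l ?invr_gt0// hL.
have Sp t : a <= t -> t <= b -> 0 < S t by move=> ? ?; apply: S_gt0; lra.
have cSr q : {within `[a, b], continuous (fun t => S t `^ q)}.
  apply/within_continuous_dist => s e as_ sb e0.
  have cp : {for S s, continuous (@powR R ^~ q)}.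
    apply: differentiable_continuous; apply/derivable1_diffP.
    by apply: derivable_powR; rewrite in_itv/= andbT Sp.
  move: cp => /cvgrPdist_lt/(_ _ e0) /nbhs_ballP[d /= d0 Hd].
  have [d' d'0 Hd'] := (within_continuous_dist _ _ _).1 (cJ _ S_continuous) s d as_ sb d0.
  exists d' => // t at_ tb ts; rewrite distrC; apply: Hd; rewrite /ball/= distrC.
  exact: Hd'.
have cV : {within `[a, b], continuous (fun t => r * S t `^ (r - 1))}.
  by apply: within_itv_continuousM; [move=> t; exact: cvg_cst|exact: cSr].
have pV : prim a b (fun t => S t `^ r) (fun t => r * S t `^ (r - 1) * (p^-1 * ((m t - c) / A t))).
  apply: (@prim_chain R a b S _ (@powR R ^~ r) _ _ pS bS cV) => t at_ tb.
  exact/is_derive1_powR/Sp.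
have [KV KV0 hKV] := within_continuous_bounded cV.
have pI := sub _ _ prim_inv_speed.
have cI' : {within J01, continuous (fun t => - (A t)^-1 ^+ 2 * B t * U2 t)}.
  apply: within_itv_continuousM; last first.
    exact: curv_continuous (el_G E) (el_p E) (el_cU1 E) (el_cW E).
  apply: within_itv_continuousM; last exact: second_speed_continuous.
  rewrite (_ : (fun x => - _) = (fun x => (- (A x)^-1) * (A x)^-1)); last first.
    by apply/funext => x; rewrite expr2 mulNr.
  have cVA := inv_speed_continuous.
  by apply: within_itv_continuousM => // t; apply: cvgN; exact: cVA.
have [KI KI0 hKI] := within_continuous_bounded (cJ _ cI').
have bV t : a <= t -> t <= b ->
    `|r * S t `^ (r - 1) * (p^-1 * ((m t - c) / A t))| <= KV * (p^-1 * L).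
  by move=> at_ tb; rewrite normrM ler_pM// ?hKV ?bS.
have pm := prim_lin (-1) 0 (prim_mul pV pI bV hKI) (prim_id a b).
have dE t : a <= t -> t <= b -> third t =
   -1 * (r * S t `^ (r - 1) * (p^-1 * ((m t - c) / A t)) * (A t)^-1 +
      S t `^ r * (- (A t)^-1 ^+ 2 * B t * U2 t)) + 0 * 1.
  move=> at_ tb; have [t0 t1] := J t at_ tb.
  by rewrite /third /U2 (curvE E)// -/(A t) -/(S t) -/r; ring.
split.
  apply: prim_eq pm _ dE => t at_ tb; have [t0 t1] := J t at_ tb.
  by rewrite /U2 (curvE E)// -/(A t) -/(S t) -/r; ring.
have [KA KA0 hKA] := within_continuous_bounded (cJ _ inv_speed_continuous).
have [Kr Kr0 hKr] := within_continuous_bounded (cSr r).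
exists (KV * (p^-1 * L) * KA + Kr * KI) => t at_ tb; rewrite dE// mul0r addr0 mulN1r normrN.
rewrite (le_trans (ler_normD _ _))// lerD// normrM ler_pM// ?hKA ?hKr ?hKI//.
exact: bV.
Qed.

Lemma third_measurable (mm : measurable_fun I01 m) : measurable_fun I01 third.
Proof.
have mcI h : {within J01, continuous h} -> measurable_fun I01 h.
  move=> ch; apply: (@measurable_funS _ _ _ _ J01) => //; first exact: subset_itv_oo_cc.
  exact: (@within_continuous_measurable R 0 1).
have mA := mcI _ inv_speed_continuous; have mB := mcI _ second_speed_continuous.
have mS := mcI _ S_continuous.
have mSq q : measurable_fun I01 (fun x => S x `^ q).
  by apply: (@measurableT_comp _ _ _ _ _ _ (@powR R ^~ q)).
have mAA := measurable_funM mA mA.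
apply: measurable_funB.
  apply: measurable_funM; first exact: measurable_cst.
  apply: measurable_funM; last exact: mAA.
  apply: measurable_funM; first exact: mSq.
  by apply: measurable_funB; [exact: mm|exact: measurable_cst].
apply: measurable_funM; last exact: measurable_funM.
by apply: measurable_funM; [exact: measurable_funM|exact: mAA].
Qed.

Lemma third_weak_deriv : leb.-integrable I01 (EFin \o third) -> weak_deriv U2 third.
Proof.
move=> i3; apply: prim_weak_deriv => //; last exact: prim_third.
apply/integrable_cc_oo/within_continuous_integrable.
exact: curv_continuous (el_G E) (el_p E) (el_cU1 E) (el_cW E).
Qed.

Lemma lower_weak_derivs : weak_deriv u U1 /\ weak_deriv U1 U2.
Proof.
have cU2 := curv_continuous (el_G E) (el_p E) (el_cU1 E) (el_cW E).
have [K2 K20 hU2] := within_continuous_bounded cU2.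
have [K1 K10 hU1] := within_continuous_bounded (el_cU1 E).
have cu := prim_continuous (el_pu E) hU1.
have iJ h : {within J01, continuous h} -> leb.-integrable I01 (EFin \o h).
  by move=> ch; exact/integrable_cc_oo/within_continuous_integrable.
split; apply: prim_weak_deriv; try by apply: iJ => //; exact: (el_cU1 E).
  move=> a b a0 ab b1; split; first by apply: prim_sub (el_pu E) _ _; exact: ltW.
  by exists K1 => t at_ tb; apply: hU1; lra.
move=> a b a0 ab b1; split; first by apply: prim_sub (el_pU1 E) _ _; exact: ltW.
by exists K2 => t at_ tb; apply: hU2; lra.
Qed.

End third_derivative.

(** * Bounded variation *)

Section bounded_variation.
Context {R : realType}.
Local Notation leb := (@lebesgue_measure R).
Local Notation I01 := (`]0%R, 1%R[%classic : set R).
Local Notation J01 := (`[0%R, 1%R]%classic : set R).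
Implicit Types (a b x y s t d e K : R) (f g h k F D : R -> R).

Definition nondecr01 f := forall x y, 0 <= x -> x <= y -> y <= 1 -> f x <= f y.

(** Differences of monotone functions form an algebra, so the bounded variation of a product can be
    checked factor by factor. *)
Definition dmono f := exists f1 f2, [/\ nondecr01 f1, nondecr01 f2 &
  forall x, 0 <= x -> x <= 1 -> f x = f1 x - f2 x].

Lemma nondecr01_measurable f : nondecr01 f -> measurable_fun J01 f.
Proof.
move=> ndf; pose cl x : R := Num.max 0 (Num.min 1 x).
have cl0 x : 0 <= cl x by rewrite /cl le_max lexx.
have cl1 x : cl x <= 1 by rewrite /cl ge_max ler01 ge_min lexx.
apply: (@eq_measurable_fun _ _ _ _ _ (f \o cl)).
  move=> x; rewrite inE/= in_itv/= => /andP[x0 x1].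
  by rewrite /cl (min_r x1) (max_r x0).
apply: nondecreasing_measurable => // x y xy; apply: ndf => //.
by rewrite /cl; apply: le_max2 => //; apply: le_min2.
Qed.

Lemma nondecr01_integrable f : nondecr01 f -> leb.-integrable J01 (EFin \o f).
Proof.
move=> ndf; apply: (@integrable_bounded _ _ _ (`|f 0| + `|f 1|)).
  exact: nondecr01_measurable.
move=> x x0 x1; have := ndf 0 x (lexx 0) x0 x1; have := ndf x 1 x0 x1 (lexx 1).
have := ler_norm (f 1); have := ler_norm (- f 0); rewrite normrN.
have := normr_ge0 (f 0); have := normr_ge0 (f 1).
by rewrite ler_norml => *; apply/andP; split; lra.
Qed.

(* Summation by parts over the partition [i / n], with [n] larger than the
   supremum of [phi']. *)
Lemma nondecr01_pairing f phi : nondecr01 f -> test_fun phi ->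
  (forall x, `|phi x| <= 1) ->
  `|\int[leb]_(x in J01) (f x * derive1 phi x)| <= 2 * (f 1 - f 0).
Proof.
move=> ndf tp phi1; have jf := nondecr01_integrable ndf.
have cphi' := test_fun_cont tp.
have [a [b [a0 ab b1 sp]]] := test_fun_supp tp.
have [phi0 _] := sp 0 (or_introl (ltW a0)).
have [phi1' _] := sp 1 (or_intror (ltW b1)).
have [L L0 hL] : exists2 L : R, 0 < L & forall t, 0 <= t -> t <= 1 -> `|derive1 phi t| <= L.
  by apply: within_continuous_bounded; exact: continuous_subspaceT.
have mphi' (D : set R) : measurable_fun D (derive1 phi).
  by apply: measurable_funTS; exact: continuous_measurable_fun.
have ifp : leb.-integrable J01 (EFin \o (fun x => f x * derive1 phi x)).
  apply: (@integrable_mul_bounded _ _ _ _ L) => //.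
  by move=> x /=; rewrite in_itv/= => /andP[]; exact: hL.
pose n := (Num.truncn L).+1.
have nL : L < n%:R by exact: truncnS_gt.
have n0 : 0 < n%:R :> R by rewrite ltr0n.
(* One half of the factor 2 bounds the oscillation of f on the cells, where the mesh 1 / n absorbs
   the bound L of phi'. The other half bounds the jump terms (f y - f x) phi(y). *)
have step i : (i <= n)%N ->
    `|\int[leb]_(x in `[0, i%:R / n%:R]) (f x * derive1 phi x) - f (i%:R / n%:R) * phi (i%:R / n%:R)|
    <= 2 * (f (i%:R / n%:R) - f 0).
  elim: i => [_|i IH iN].
    by rewrite mul0r set_itv1 Rintegral_set1 phi0 mulr0 !subrr normr0 mulr0.
  have {}IH := IH (ltnW iN).
  set x := i%:R / n%:R in IH *; set y := i.+1%:R / n%:R.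
  have x0 : 0 <= x by rewrite divr_ge0.
  have y1 : y <= 1 by rewrite ler_pdivrMr// mul1r ler_nat.
  have yx : y - x = n%:R^-1 by rewrite /y /x -natr1 mulrDl mul1r addrAC subrr add0r.
  have xy : x <= y by rewrite -subr_ge0 yx invr_ge0 ltW.
  have fxy : f x <= f y by exact: ndf.
  rewrite (@Rintegral_cat _ 0 x y)//; last exact: integrable_sub ifp _ _.
  have pphi := (prim_test_fun x y tp).2 x y (lexx x) xy (lexx y).
  have ip : leb.-integrable `[x, y] (EFin \o derive1 phi) := (prim_test_fun x y tp).1.
  have E : \int[leb]_(t in `[x, y]) (f t * derive1 phi t) - f x * (phi y - phi x) =
      \int[leb]_(t in `[x, y]) (1 * (f t * derive1 phi t) + (- f x) * derive1 phi t).
    rewrite Rintegral_lin//; last exact: integrable_sub ifp _ _.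
    by rewrite pphi; ring.
  have bE : `|\int[leb]_(t in `[x, y]) (f t * derive1 phi t) - f x * (phi y - phi x)|
      <= (f y - f x) * L * (y - x).
    rewrite E; apply: norm_Rintegral_le => //.
      by apply: integrable_lin => //; exact: integrable_sub ifp _ _.
    move=> t xt ty; rewrite mul1r mulNr -mulrBl normrM ler_pM//; last by apply: hL; lra.
    have h1 : f x <= f t by apply: ndf => //; lra.
    have h2 : f t <= f y by apply: ndf => //; lra.
    by rewrite ger0_norm ?subr_ge0// lerD2r.
  have bE2 : (f y - f x) * L * (y - x) <= f y - f x.
    rewrite yx -mulrA ler_piMr ?subr_ge0//.
    by rewrite ler_pdivrMr// mul1r ltW.
  have bp : `|(f y - f x) * phi y| <= f y - f x.
    by rewrite normrM ger0_norm ?subr_ge0// ler_piMr ?subr_ge0.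
  have -> : \int[leb]_(t in `[0, x]) (f t * derive1 phi t) +
     \int[leb]_(t in `[x, y]) (f t * derive1 phi t) - f y * phi y =
     (\int[leb]_(t in `[0, x]) (f t * derive1 phi t) - f x * phi x) +
     ((\int[leb]_(t in `[x, y]) (f t * derive1 phi t) - f x * (phi y - phi x)) -
      (f y - f x) * phi y) by ring.
  apply: (le_trans (ler_normD _ _)).
  apply: (le_trans (lerD IH (le_trans (ler_normB _ _) (lerD (le_trans bE bE2) bp)))).
  by rewrite le_eqVlt; apply/orP; left; apply/eqP; ring.
have := step n (leqnn n); rewrite divff ?gt_eqF// phi1' mulr0 subr0.
by [].
Qed.

Lemma dmono_BV f : dmono f -> in_BV f.
Proof.
move=> [f1 [f2 [nd1 nd2 fE]]].
have i1 := nondecr01_integrable nd1; have i2 := nondecr01_integrable nd2.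
have jf : leb.-integrable J01 (EFin \o f).
  apply: eq_integrable (integrable_lin 1 (-1) _ i1 i2) => //.
  move=> x; rewrite inE/= in_itv/= => /andP[x0 x1].
  by rewrite /= fE// mul1r mulN1r.
split; first exact: integrable_cc_oo.
exists (2 * (f1 1 - f1 0) + 2 * (f2 1 - f2 0)) => phi tp phi1.
have cphi' := test_fun_cont tp.
have [L L0 hL] : exists2 L : R, 0 < L & forall t, 0 <= t -> t <= 1 -> `|derive1 phi t| <= L.
  by apply: within_continuous_bounded; exact: continuous_subspaceT.
have mphi' (D : set R) : measurable_fun D (derive1 phi).
  by apply: measurable_funTS; exact: continuous_measurable_fun.
have ip g : leb.-integrable J01 (EFin \o g) ->
    leb.-integrable J01 (EFin \o (fun x => g x * derive1 phi x)).
  move=> ig; apply: (@integrable_mul_bounded _ _ _ _ L) => //.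
  by move=> x /=; rewrite in_itv/= => /andP[]; exact: hL.
have ifp := integrable_cc_oo (ip _ jf).
rewrite -(@EFin_normr_Rintegral _ _ _ leb I01 _ (measurable_itv _) ifp) lee_fin.
rewrite Rintegral_oo_cc; last exact: integrable_measurable ifp.
have -> : \int[leb]_(x in J01) (f x * derive1 phi x) =
  \int[leb]_(x in J01) (1 * (f1 x * derive1 phi x) + (-1) * (f2 x * derive1 phi x)).
  apply: eq_Rintegral => x; rewrite inE/= in_itv/= => /andP[x0 x1].
  by rewrite fE//; ring.
rewrite Rintegral_lin//; [|exact: ip..].
rewrite mul1r mulN1r (le_trans (ler_normB _ _))// lerD//; exact: nondecr01_pairing.
Qed.

(** Adding one constant to both parts makes them nonnegative, so that products of such parts are
    again nondecreasing. *)
Lemma dmono_shift f : dmono f -> exists f1 f2,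
  [/\ nondecr01 f1, nondecr01 f2, forall x, 0 <= x -> x <= 1 -> 0 <= f1 x,
   forall x, 0 <= x -> x <= 1 -> 0 <= f2 x &
   forall x, 0 <= x -> x <= 1 -> f x = f1 x - f2 x].
Proof.
move=> [f1 [f2 [nd1 nd2 fE]]]; pose K := `|f1 0| + `|f2 0|.
have h1 : - f1 0 <= K by rewrite (le_trans (ler_norm _))// normrN lerDl.
have h2 : - f2 0 <= K by rewrite (le_trans (ler_norm _))// normrN lerDr.
exists (fun x => f1 x + K), (fun x => f2 x + K); split.
- by move=> x y x0 xy y1; rewrite lerD2r nd1.
- by move=> x y x0 xy y1; rewrite lerD2r nd2.
- by move=> x x0 x1; have := nd1 0 x (lexx 0) x0 x1; lra.
- by move=> x x0 x1; have := nd2 0 x (lexx 0) x0 x1; lra.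
- by move=> x x0 x1; rewrite fE//; ring.
Qed.

Lemma dmono_cst K : dmono (fun=> K).
Proof. by exists (fun=> K), (fun=> 0); split=> // x _ _; rewrite subr0. Qed.

Lemma dmonoB f g : dmono f -> dmono g -> dmono (fun x => f x - g x).
Proof.
move=> [f1 [f2 [nf1 nf2 fE]]] [g1 [g2 [ng1 ng2 gE]]].
exists (fun x => f1 x + g2 x), (fun x => f2 x + g1 x); split.
- by move=> x y x0 xy y1; rewrite lerD ?nf1 ?ng2.
- by move=> x y x0 xy y1; rewrite lerD ?nf2 ?ng1.
- by move=> x x0 x1; rewrite fE// gE//; ring.
Qed.

Lemma dmonoM f g : dmono f -> dmono g -> dmono (fun x => f x * g x).
Proof.
move=> /dmono_shift[f1 [f2 [nf1 nf2 f10 f20 fE]]] /dmono_shift[g1 [g2 [ng1 ng2 g10 g20 gE]]].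
have key (h k : R -> R) : nondecr01 h -> nondecr01 k ->
    (forall x, 0 <= x -> x <= 1 -> 0 <= h x) -> (forall x, 0 <= x -> x <= 1 -> 0 <= k x) ->
    nondecr01 (fun x => h x * k x).
  move=> nh nk h0 k0 x y x0 xy y1.
  by apply: ler_pM; [apply: h0; lra|apply: k0; lra|exact: nh|exact: nk].
exists (fun x => f1 x * g1 x + f2 x * g2 x), (fun x => f1 x * g2 x + f2 x * g1 x); split.
- by move=> x y x0 xy y1; rewrite lerD//; apply: (key _ _ _ _ _ _ x y).
- by move=> x y x0 xy y1; rewrite lerD//; apply: (key _ _ _ _ _ _ x y).
- by move=> x x0 x1; rewrite fE// gE//; ring.
Qed.

Lemma dmono_noninc f : (forall x y, 0 <= x -> x <= y -> y <= 1 -> f y <= f x) -> dmono f.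
Proof.
move=> H; exists (fun=> 0), (fun x => - f x); split=> //.
- by move=> x y x0 xy y1; rewrite lerN2 H.
- by move=> x _ _; rewrite sub0r opprK.
Qed.

Lemma dmono_prim f g K : prim 0 1 f g ->
  (forall t, 0 <= t -> t <= 1 -> `|g t| <= K) -> dmono f.
Proof.
move=> fg gK; exists (fun x => f x + K * x), (fun x => K * x); split.
- move=> x y x0 xy y1.
  have : - K * (y - x) <= f y - f x.
    apply: (prim_ge fg) => // t xt ty; have : `|g t| <= K by apply: gK; lra.
    by rewrite ler_norml => /andP[].
  by rewrite mulNr mulrBr; lra.
- move=> x y x0 xy y1; rewrite ler_wpM2l//.
  by apply: (le_trans (normr_ge0 (g 0))); apply: gK => //; lra.
- by move=> x _ _; ring.
Qed.

(** One of [min x t0] and [max x t0] is always t0, so the rise stopped at t0 and the fall started at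
    t0 recombine to f. *)
Lemma dmono_unimodal f t0 : 0 <= t0 -> t0 <= 1 ->
  (forall x y, 0 <= x -> x <= y -> y <= t0 -> f x <= f y) ->
  (forall x y, t0 <= x -> x <= y -> y <= 1 -> f y <= f x) -> dmono f.
Proof.
move=> t00 t01 H1 H2.
exists (fun x => f (Num.min x t0)), (fun x => f t0 - f (Num.max x t0)); split.
- move=> x y x0 xy y1; apply: H1.
  + by rewrite le_min x0 t00.
  + by apply: le_min2.
  + by rewrite ge_min lexx orbT.
- move=> x y x0 xy y1; rewrite lerB// H2//.
  + by rewrite le_max lexx orbT.
  + by apply: le_max2.
  + by rewrite ge_max y1 t01.
- move=> x x0 x1; have [xt|tx] := leP x t0; last by ring.
  by ring.
Qed.

Lemma bounded_in_Linf f K : measurable_fun I01 f ->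
  (forall x, I01 x -> `|f x| <= K) -> in_Linf f.
Proof.
move=> mf fK; split=> //; exists K.
rewrite (_ : [set x | _] = set0) ?measure0//.
by apply/seteqP; split=> // x /= [/fK]; rewrite leNgt => /negbTE ->.
Qed.

Lemma powR_homo a b q : 0 <= q -> 0 <= a -> a <= b -> a `^ q <= b `^ q.
Proof.
by move=> q0 a0 ab; apply: ge0_ler_powR => //; rewrite nnegrE//; exact: le_trans ab.
Qed.

Variables (G : R -> R) (p : R) (u U1 W m : R -> R) (c M del : R).
Hypothesis E : EL_data G p u U1 W m c M del.

Let A x := derive1 G (U1 x).
Let B x := derive1n 2 G (U1 x).
Let r := (p - 1)^-1.
Let S x := p^-1 * W x.
Let U2 := curv G p U1 W.
Let T := third G p U1 W m c.

Lemma r_gt0 : 0 < r.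
Proof. by rewrite invr_gt0; have := el_p E => ?; lra. Qed.

Lemma S_upper_bound : exists2 K : R, 0 < K & forall x, 0 <= x -> x <= 1 -> S x <= K.
Proof.
have [K K0 hK] := within_continuous_bounded (S_continuous E).
by exists K => // x x0 x1; rewrite (le_trans (ler_norm _))// hK.
Qed.

(** Only S^(r - 1) can be unbounded. The bound on the second term is exported separately for the
    lower bound in the superquadratic case. *)
Lemma third_bound : exists C1 C2, [/\ 0 < C1, 0 < C2 & forall x, 0 <= x -> x <= 1 ->
  `|T x| <= C1 * S x `^ (r - 1) + C2 /\
  `|(S x `^ r * S x `^ r) * ((A x)^-1 * (A x)^-1) * (B x * (A x)^-1)| <= C2].
Proof.
have p1 := el_p E; have r0 := r_gt0.
have [KA KA0 hKA] := within_continuous_bounded (inv_speed_continuous E).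
have [KB KB0 hKB] := within_continuous_bounded (second_speed_continuous E).
have [K K0 hK] := S_upper_bound.
have M0 := contact_mass_gt0 E.
pose Kr := K `^ r; have Kr0 : 0 < Kr by rewrite powR_gt0.
have rp : 0 < r / p by rewrite divr_gt0//; lra.
exists (r / p * M * (KA * KA)), (Kr * Kr * (KA * KA) * (KB * KA)); split.
- by apply: mulr_gt0; apply: mulr_gt0.
- by rewrite !mulr_gt0.
move=> x x0 x1.
have hA : `|(A x)^-1| <= KA by exact: hKA.
have hB : `|B x| <= KB by exact: hKB.
have hS : `|S x `^ r| <= Kr.
  rewrite ger0_norm ?powR_ge0//.
  by apply: powR_homo; [exact: ltW|exact: (S_ge0 E)|exact: hK].
have hAA : `|(A x)^-1 * (A x)^-1| <= KA * KA by rewrite normrM ler_pM.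
have h2 : `|(S x `^ r * S x `^ r) * ((A x)^-1 * (A x)^-1) * (B x * (A x)^-1)|
    <= Kr * Kr * (KA * KA) * (KB * KA).
  rewrite normrM; apply: ler_pM => //; last by rewrite normrM ler_pM.
  by rewrite normrM; apply: ler_pM => //; rewrite normrM ler_pM.
split=> //; rewrite /T /third (le_trans (ler_normB _ _))// lerD//.
rewrite normrM normrN (gtr0_norm rp).
have -> : r / p * M * (KA * KA) * S x `^ (r - 1) = r / p * (S x `^ (r - 1) * M * (KA * KA)) by ring.
rewrite ler_pM2l// normrM; apply: ler_pM => //.
rewrite normrM; apply: ler_pM => //; last exact: (m_bounded E).
by rewrite ger0_norm ?powR_ge0.
Qed.

Lemma third_bounded : p <= 2 -> exists K, forall x, 0 <= x -> x <= 1 -> `|T x| <= K.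
Proof.
move=> p2; have p1 := el_p E.
have [C1 [C2 [C10 C20 H]]] := third_bound.
have [K K0 hK] := S_upper_bound.
have r1 : 0 <= r - 1.
  by rewrite subr_ge0 /r -[leLHS]invr1 lef_pV2 ?posrE//; lra.
exists (C1 * K `^ (r - 1) + C2) => x x0 x1; have [h _] := H x x0 x1.
rewrite (le_trans h)// lerD2r ler_pM2l//.
by apply: powR_homo => //; [exact: (S_ge0 E)|exact: hK].
Qed.

(** For p <= 2 the exponent r - 1 is nonnegative, so S^(r - 1) and S^r inherit the unimodality of
    [W]; the other factors are monotone, Lipschitz or constant. *)
Lemma third_dmono : p <= 2 -> dmono T.
Proof.
move=> p2; have p1 := el_p E; have r0 := r_gt0; have p0 : 0 < p by lra.
have r1 : 0 <= r - 1.
  by rewrite subr_ge0 /r -[leLHS]invr1 lef_pV2 ?posrE//; lra.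
have dS q : 0 <= q -> dmono (fun x => S x `^ q).
  move=> q0; have [t0 [t00 t01 H1 H2]] := W_unimodal E.
  have SM x y : 0 <= x -> x <= 1 -> 0 <= y -> y <= 1 -> W x <= W y -> S x `^ q <= S y `^ q.
    move=> x0 x1 y0 y1 Wxy; apply: powR_homo => //; first exact: (S_ge0 E).
    by rewrite ler_pM2l ?invr_gt0.
  apply: (dmono_unimodal t00 t01) => x y h1 h2 h3.
    by apply: SM; [lra|lra|lra|lra|exact: H1].
  by apply: SM; [lra|lra|lra|lra|exact: H2].
have dA : dmono (fun x => (A x)^-1).
  have cI' : {within J01, continuous (fun t => - (A t)^-1 ^+ 2 * B t * U2 t)}.
    apply: within_itv_continuousM; last first.
      exact: curv_continuous (el_G E) (el_p E) (el_cU1 E) (el_cW E).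
    apply: within_itv_continuousM; last exact: (second_speed_continuous E).
    rewrite (_ : (fun x => - _) = (fun x => (- (A x)^-1) * (A x)^-1)); last first.
      by apply/funext => x; rewrite expr2 mulNr.
    have cVA := inv_speed_continuous E.
    by apply: within_itv_continuousM => // t; apply: cvgN; exact: cVA.
  have [KI KI0 hKI] := within_continuous_bounded cI'.
  exact: dmono_prim (prim_inv_speed E) hKI.
have cU2 := curv_continuous (el_G E) (el_p E) (el_cU1 E) (el_cW E).
have dB : dmono B.
  have [K2 K20 hU2] := within_continuous_bounded cU2.
  have ch : {within J01, continuous (derive1n 3 G \o U1)}.
    apply: (within_itv_continuous_comp (el_cU1 E)).
    by have [H _] := el_G E; apply/smooth_continuous/smooth_derive1n.
  have [K3 K30 hK3] := within_continuous_bounded ch.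
  have := @prim_chain R 0 1 U1 _ (derive1n 2 G) (derive1n 3 G \o U1) K2 (el_pU1 E) hU2 ch
    (fun t _ _ => Gddot_derive (el_G E) (U1 t)).
  move=> H; apply: (@dmono_prim _ _ (K3 * K2) H) => t t0 t1.
  by rewrite normrM ler_pM// ?hK3 ?hU2.
have dm : dmono (fun x => m x - c).
  apply: dmonoB; last exact: dmono_cst.
  by apply: dmono_noninc => x y _ xy _; exact: (el_m_noninc E).
apply: dmonoB.
  apply: dmonoM; first exact: dmono_cst.
  by apply: dmonoM; [apply: dmonoM => //; exact: dS|exact: dmonoM].
apply: dmonoM; last exact: dmonoM.
by apply: dmonoM; [apply: dmonoM; apply: dS; exact: ltW|exact: dmonoM].
Qed.

Lemma m_measurable : measurable_fun I01 m.
Proof.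
have -> : m = (fun x => - (- m x)) by apply/funext => x; rewrite opprK.
apply: measurable_funN; apply: nondecreasing_measurable => // s t st.
by rewrite lerN2; exact: (el_m_noninc E).
Qed.

Lemma subquadratic_regularity : p <= 2 ->
  exists g : nat -> R -> R, sobolev_witness 3 (@in_Linf R) u g /\ in_BV (g 3%N).
Proof.
move=> p2; have [K hK] := third_bounded p2.
have IJ x : I01 x -> 0 <= x /\ x <= 1.
  by rewrite /= in_itv/= => /andP[? ?]; split; exact: ltW.
have m3 := third_measurable E m_measurable.
have i3 : leb.-integrable I01 (EFin \o T).
  by apply: (@bounded_integrable_I _ K) => // x /IJ[]; exact: hK.
have w3 := third_weak_deriv E i3; have [w1 w2] := lower_weak_derivs E.
exists (fun j => match j with 0%N => u | 1%N => U1 | 2%N => U2 | _ => T end).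
split; last exact/dmono_BV/third_dmono.
split=> //; split; last by case=> [|[|[|//]]].
have cI h : {within J01, continuous h} -> in_Linf h.
  move=> ch; have [L L0 hL] := within_continuous_bounded ch.
  apply: (@bounded_in_Linf _ L); last by move=> x /IJ[]; exact: hL.
  apply: (@measurable_funS _ _ _ _ J01) => //; first exact: subset_itv_oo_cc.
  exact: (@within_continuous_measurable R 0 1).
have [_ [cu [cU1 cU2]]] := classical_C2 E.
case=> [|[|[|[|//]]]] _; [exact: cI|exact: cI|exact: cI|].
by apply: (@bounded_in_Linf _ K) => // x /IJ[]; exact: hK.
Qed.

End bounded_variation.

(** * The superquadratic case *)

Section edge_integrals.
Context {R : realType}.
Local Notation leb := (@lebesgue_measure R).
Local Notation I01 := (`]0%R, 1%R[%classic : set R).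
Local Notation J01 := (`[0%R, 1%R]%classic : set R).
Implicit Types (a b x y s t d e K q : R) (f g h k F D : R -> R).

(** Monotone convergence along compact subintervals: a bound uniform over them suffices for a
    nonnegative function singular at the ends. *)
Lemma integrable_exhaustion h K : measurable_fun I01 h ->
  (forall x, I01 x -> 0 <= h x) ->
  (forall a b, 0 < a -> a < b -> b < 1 ->
     (\int[leb]_(x in `[a, b]) (h x)%:E <= K%:E)%E) ->
  leb.-integrable I01 (EFin \o h).
Proof.
move=> mh h0 H.
(* Starting at 3 keeps [e n] at most 1/3, so that every interval [F n] is nondegenerate. *)
pose e (n : nat) : R := n.+3%:R^-1.
have e0 n : 0 < e n by rewrite invr_gt0.
have e1 n : e n <= 3^-1 by rewrite lef_pV2 ?posrE// ler_nat.
pose F (n : nat) : set R := `[e n, 1 - e n]%classic.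
have FI n : F n `<=` I01.
  move=> x; rewrite /F /= !in_itv/= => /andP[h1 h2].
  by have := e0 n; have := e1 n => ? ?; apply/andP; split; lra.
have UF : \bigcup_n F n = I01.
  apply/seteqP; split=> [x [n _]|x]; first exact: FI.
  rewrite /= in_itv/= => /andP[x0 x1].
  pose y := Num.min x (1 - x).
  have y0 : 0 < y by rewrite /y lt_min x0 subr_gt0.
  have y1 : y <= x by rewrite /y ge_min lexx.
  have y2 : y <= 1 - x by rewrite /y ge_min lexx orbT.
  exists (Num.truncn y^-1) => //.
  have ey : e (Num.truncn y^-1) <= y.
    rewrite -[leRHS]invrK lef_pV2 ?posrE ?invr_gt0//.
    by apply: (le_trans (ltW (truncnS_gt _))); rewrite ler_nat; do 2 apply: leqW.
  by rewrite /F /= in_itv/=; apply/andP; split; lra.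
have ndF : {homo F : n n' / (n <= n')%N >-> (n <= n')%O}.
  move=> n n' nn'; rewrite subsetEset; apply: subset_itv; rewrite bnd_simp.
    by rewrite lef_pV2 ?posrE// ler_nat.
  by rewrite lerD2l lerN2 lef_pV2 ?posrE// ler_nat.
have mhE : measurable_fun I01 (EFin \o h) by exact/measurable_EFinP.
have cv : (\int[leb]_(x in F i) (h x)%:E)%E @[i --> \oo] -->
    (\int[leb]_(x in \bigcup_i F i) (h x)%:E)%E.
  apply: ge0_nondecreasing_set_cvg_integral => //.
  - by move=> n; exact: measurable_itv.
  - by move=> n; apply: measurable_funS mhE => //; exact: FI.
  - by move=> n x /FI Ix; rewrite lee_fin h0.
have le : (\int[leb]_(x in I01) (h x)%:E <= K%:E)%E.
  rewrite UF in cv; rewrite -(cvg_lim _ cv)//; apply: lime_le; first by apply/cvg_ex; eexists; exact: cv.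
  apply: nearW => n; apply: H => //; have := e0 n; have := e1 n => ? ?; lra.
apply/integrableP; split=> //; apply: (le_lt_trans _ (ltry K)).
suff -> : (\int[leb]_(x in I01) `|(EFin \o h) x| = \int[leb]_(x in I01) (h x)%:E)%E by [].
by apply: eq_integral => x; rewrite inE => Ix /=; rewrite ger0_norm// h0.
Qed.

Lemma powR_antitone a b s : 0 < a -> a <= b -> s <= 0 -> b `^ s <= a `^ s.
Proof.
move=> a0 ab s0; have b0 := lt_le_trans a0 ab.
have E z : z `^ s = (z `^ (- s))^-1 by rewrite -powRN opprK.
rewrite (E a) (E b) lef_pV2 ?posrE ?powR_gt0//.
by apply: powR_homo => //; [rewrite oppr_ge0|exact: ltW].
Qed.

Lemma is_derive_edge s x : 0 < s -> 0 < x -> x < 1 ->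
  is_derive x 1 (fun t => s^-1 * t `^ s + (- s^-1) * (1 - t) `^ s)
    (x `^ (s - 1) + (1 - x) `^ (s - 1)).
Proof.
move=> s0 x0 x1.
have d1 := is_derive1_powR s x0.
have d2 : is_derive x 1 (fun t => (1 - t) `^ s) (s * (1 - x) `^ (s - 1) * (-1)).
  apply: (@is_derive1_comp R (@powR R ^~ s) (fun t => 1 - t)).
    by apply: is_derive1_powR; rewrite subr_gt0.
  have := is_derive_affine (-1) 1 x.
  by congr is_derive; apply/funext => t; ring.
have := is_derive_lin s^-1 (- s^-1) d1 d2; congr is_derive.
by field; rewrite gt_eqF.
Qed.

Lemma powR_pos_continuous s x : 0 < x -> {for x, continuous (@powR R ^~ s)}.
Proof.
move=> x0; apply: differentiable_continuous; apply/derivable1_diffP.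
by apply: derivable_powR; rewrite in_itv/= andbT.
Qed.

(** One of x and 1 - x is at least 1/2, so the function is at most twice x^s + (1 - x)^s. That sum
    has an explicit primitive whose increments are at most 2 / (s + 1). *)
Lemma edge_integrable s : -1 < s -> s <= 0 ->
  leb.-integrable I01 (EFin \o (fun x => (x * (1 - x)) `^ s)).
Proof.
move=> s1 s0; pose s' := s + 1.
have s'0 : 0 < s' by rewrite /s'; lra.
have ss : s' - 1 = s by rewrite /s'; ring.
have mX (f : R -> R) q : measurable_fun I01 f -> measurable_fun I01 (fun x => f x `^ q).
  by move=> mf; apply: (@measurableT_comp _ _ _ _ _ _ (@powR R ^~ q)).
have m1x : measurable_fun I01 (fun x : R => 1 - x) by apply: measurable_funB.
pose h x := x `^ s + (1 - x) `^ s.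
have mh : measurable_fun I01 h.
  by apply: measurable_funD; apply: mX.
have ih : leb.-integrable I01 (EFin \o h).
  apply: (@integrable_exhaustion h (2 * s'^-1)) => //.
    by move=> x _; rewrite addr_ge0// powR_ge0.
  move=> a b a0 ab b1.
  have pr : prim a b (fun t => s'^-1 * t `^ s' + (- s'^-1) * (1 - t) `^ s') h.
    apply: prim_C1 => [t at_ tb|].
      by have := @is_derive_edge s' t s'0; rewrite ss; apply; lra.
    apply/within_continuous_dist => t e at_ tb e0.
    have ct : {for t, continuous h}.
      apply: cvgD; first by apply: powR_pos_continuous; lra.
      apply: (@continuous_comp R R R (fun t => 1 - t) (@powR R ^~ s)).
        by apply: cvgB; [exact: cvg_cst|exact: cvg_id].
      by apply: powR_pos_continuous; lra.
    move: ct => /cvgrPdist_lt/(_ _ e0) /nbhs_ballP[d /= d0 Hd].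
    exists d => // y ay yb yt; rewrite distrC; apply: Hd.
    by rewrite /ball/= distrC.
  have [ihab prE] := pr.
  rewrite -[leLHS]fineK; last exact: integrable_fin_num ihab.
  rewrite lee_fin; have := prE a b (lexx a) (ltW ab) (lexx b).
  rewrite /Rintegral => <-.
  have le1 y : 0 <= y -> y <= 1 -> 0 <= y `^ s' <= 1.
    move=> y0 y1; rewrite powR_ge0/=.
    by have := powR_homo (ltW s'0) y0 y1; rewrite powR1.
  have i0 : 0 < s'^-1 by rewrite invr_gt0.
  have := le1 a; have := le1 b; have := le1 (1 - a); have := le1 (1 - b).
  move=> /(_ ltac:(lra) ltac:(lra)) /andP[h1 h2] /(_ ltac:(lra) ltac:(lra)) /andP[h3 h4].
  move=> /(_ ltac:(lra) ltac:(lra)) /andP[h5 h6] /(_ ltac:(lra) ltac:(lra)) /andP[h7 h8].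
  have -> : s'^-1 * b `^ s' + - s'^-1 * (1 - b) `^ s' - (s'^-1 * a `^ s' + - s'^-1 * (1 - a) `^ s') =
    (b `^ s' - (1 - b) `^ s' - a `^ s' + (1 - a) `^ s') * s'^-1 by ring.
  by rewrite ler_pM2r//; lra.
apply: (@integrable_le_bound _ _ (fun x => 2 * h x + 0 * h x)).
- apply: mX; apply: measurable_funM => //.
- exact: integrable_lin.
- move=> x /=; rewrite in_itv/= => /andP[x0 x1]; rewrite mul0r addr0 ger0_norm ?powR_ge0//.
  (* The factor (1/2)^s is at most 2 because s > -1. *)
  have half y : 0 < y -> (2^-1 * y) `^ s <= 2 * y `^ s.
    move=> y0; rewrite powRM; [|lra|exact: ltW].
    have h2 : 0 < (2^-1 : R) <= 1 by apply/andP; split; lra.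
    have := ger_powR h2 (ltW s1); rewrite powR_inv1 ?invrK; last lra.
    by move=> H; rewrite ler_wpM2r ?powR_ge0.
  have := powR_ge0 x s; have := powR_ge0 (1 - x) s => g1 g2.
  have [xh|xh] := leP x (1/2).
    have : (x * (1 - x)) `^ s <= (2^-1 * x) `^ s.
      apply: powR_antitone => //; first by rewrite mulr_gt0// invr_gt0.
      by rewrite mulrC ler_pM2l//; lra.
    by have := half x x0; rewrite /h; lra.
  have : (x * (1 - x)) `^ s <= (2^-1 * (1 - x)) `^ s.
    apply: powR_antitone => //; first by rewrite mulr_gt0// ?invr_gt0// subr_gt0.
    by rewrite ler_pM2r ?subr_gt0//; lra.
  by have := half (1 - x); rewrite subr_gt0 => /(_ x1); rewrite /h; lra.
Qed.

Lemma integrable_in_Lq q h : measurable_fun I01 h ->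
  leb.-integrable I01 (EFin \o (fun x => `|h x| `^ q)) -> in_Lq q h.
Proof.
move=> mh /integrableP[_ ih]; split=> //.
suff -> : (\int[leb]_(x in I01) (`|h x| `^ q)%:E =
   \int[leb]_(x in I01) `|(EFin \o (fun x => (`|h x| `^ q)%R)) x|)%E by [].
by apply: eq_integral => x _ /=; rewrite (ger0_norm (powR_ge0 _ _)).
Qed.

(** Lets an arbitrary Sobolev witness be identified with the explicit derivatives, one order at a
    time. *)
Lemma weak_deriv_unique f g f' g' : weak_deriv f g -> weak_deriv f' g' ->
  {ae leb, forall x, I01 x -> f x = f' x} -> {ae leb, forall x, I01 x -> g x = g' x}.
Proof.
move=> [jf [ig H]] [jf' [ig' H']] ff'.
have := @test_orthogonal_ae0 R (fun x => 1 * g x + (-1) * g' x) (integrable_lin _ _ _ ig ig').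
move=> HH; have : {ae leb, forall x, I01 x -> 1 * g x + (-1) * g' x = 0}.
  apply: HH => // phi tp.
  have cphi := smooth_continuous (test_fun_smooth tp).
  have cphi' := test_fun_cont tp.
  have RE f0 g0 : leb.-integrable I01 (EFin \o f0) -> leb.-integrable I01 (EFin \o g0) ->
      (\int[leb]_(x in I01) (f0 x * derive1 phi x)%:E = - \int[leb]_(x in I01) (g0 x * phi x)%:E)%E ->
      \int[leb]_(x in I01) (g0 x * phi x) = - \int[leb]_(x in I01) (f0 x * derive1 phi x).
    by move=> jf0 ig0 e; rewrite {2}/Rintegral e fineN opprK.
  have i1 := integrable_mul_continuous ig cphi; have i2 := integrable_mul_continuous ig' cphi.
  have j1 := integrable_mul_continuous jf cphi'; have j2 := integrable_mul_continuous jf' cphi'.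
  have Z : \int[leb]_(x in I01) ((1 * g x + (-1) * g' x) * phi x) = 0.
    transitivity (\int[leb]_(x in I01) (1 * (g x * phi x) + (-1) * (g' x * phi x))).
      by apply: eq_Rintegral => x _; ring.
    rewrite Rintegral_lin// (RE f g)//; last exact: H.
    rewrite (RE f' g')//; last exact: H'.
    rewrite (@ae_Rintegral _ (fun x => f x * derive1 phi x) (fun x => f' x * derive1 phi x))//.
    - by ring.
    - exact: integrable_measurable j1.
    - exact: integrable_measurable j2.
    move: ff'; apply: filterS; first exact: (ae_filter_ringOfSetsType leb).
    by move=> x Hx Ix; rewrite Hx.
  rewrite -[LHS]fineK; first by rewrite -[fine _]/(\int[leb]_(x in I01) ((1 * g x + (-1) * g' x) * phi x)) Z.
  have := integrable_mul_continuous (integrable_lin 1 (-1) (measurable_itv _) ig ig') cphi.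
  exact: integrable_fin_num.
apply: filterS; first exact: (ae_filter_ringOfSetsType leb).
by move=> x Hx Ix; have := Hx Ix; lra.
Qed.

Lemma powR_add_le a b q : 0 <= q -> 0 <= a -> 0 <= b ->
  (a + b) `^ q <= 2 `^ q * (a `^ q + b `^ q).
Proof.
move=> q0 a0 b0; have [ab|ba] := leP a b.
  apply: (@le_trans _ _ ((2 * b) `^ q)); first by apply: powR_homo => //; lra.
  by rewrite powRM// ler_wpM2l ?powR_ge0// lerDr powR_ge0.
apply: (@le_trans _ _ ((2 * a) `^ q)); first by apply: powR_homo => //; lra.
by rewrite powRM// ler_wpM2l ?powR_ge0// lerDl powR_ge0.
Qed.

Lemma not_integrable_reciprocal d h : 0 < d -> d < 1 ->
  leb.-integrable I01 (EFin \o h) -> ~ (forall x, 0 < x -> x <= d -> x^-1 <= h x).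
Proof.
move=> d0 d1 ih H.
pose T := \int[leb]_(x in I01) `|h x|.
(* Chosen so that ln d - ln a = T + 1, one more than the L^1 norm of h. *)
pose a := d * expR (- (T + 1)).
have T0 : 0 <= T by exact: Rintegral_ge0.
have a0 : 0 < a by rewrite mulr_gt0// expR_gt0.
have ad : a < d.
  by rewrite /a -[ltRHS]mulr1 ltr_pM2l// expR_lt1; lra.
have pr : prim a d (@ln R) (fun x => x^-1).
  apply: prim_C1 => [t at_ td|]; first by apply: is_derive1_ln; lra.
  apply/within_continuous_dist => t e at_ tb e0.
  have ct : {for t, continuous (fun x : R => x^-1)}.
    by apply: cvgV; [rewrite gt_eqF//; lra|exact: cvg_id].
  move: ct => /cvgrPdist_lt/(_ _ e0) /nbhs_ballP[r /= r0 Hr].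
  exists r => // y ay yb yt; rewrite distrC; apply: Hr.
  by rewrite /ball/= distrC.
have := pr.2 a d (lexx a) (ltW ad) (lexx d).
rewrite /a lnM ?posrE ?expR_gt0// expRK -/a => E.
have sub : `[a, d]%classic `<=` I01.
  by move=> x /=; rewrite !in_itv/= => /andP[? ?]; apply/andP; split; lra.
have ihs : leb.-integrable `[a, d] (EFin \o h) by apply: integrableS ih.
have le1 : \int[leb]_(t in `[a, d]) t^-1 <= \int[leb]_(t in `[a, d]) `|h t|.
  apply: le_Rintegral => //; first exact: pr.1.
    exact: (@integrable_norm _ _ _ leb `[a, d] h).
  move=> t /=; rewrite in_itv/= => /andP[at_ td].
  by rewrite (le_trans _ (ler_norm _))// H//; lra.
have le2 : \int[leb]_(t in `[a, d]) `|h t| <= T.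
  rewrite /T /Rintegral; apply: fine_le.
  - apply: integrable_fin_num => //; exact: (@integrable_norm _ _ _ leb `[a, d] h).
  - apply: integrable_fin_num => //; exact: (@integrable_norm _ _ _ leb I01 h).
  apply: ge0_subset_integral => //.
  apply: measurableT_comp => //; apply: measurableT_comp => //; exact: integrable_measurable ih.
have := le_trans le1 le2; rewrite -E opprD addrA subrr add0r opprK gerDl.
by rewrite ler10.
Qed.

End edge_integrals.

Section superquadratic.
Context {R : realType}.
Local Notation leb := (@lebesgue_measure R).
Local Notation I01 := (`]0%R, 1%R[%classic : set R).
Local Notation J01 := (`[0%R, 1%R]%classic : set R).
Implicit Types (a b x y s t d e K q : R) (f g h k F D : R -> R).

Variables (G : R -> R) (p : R) (u U1 W m : R -> R) (c M del : R).
Hypothesis E : EL_data G p u U1 W m c M del.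
Hypothesis p2 : 2 < p.

Let A x := derive1 G (U1 x).
Let B x := derive1n 2 G (U1 x).
Let r := (p - 1)^-1.
Let S x := p^-1 * W x.
Let U2 := curv G p U1 W.
Let T := third G p U1 W m c.

Lemma r_pred : r - 1 = - ((p - 2) / (p - 1)).
Proof. by rewrite /r; field; have p2' := p2; apply/eqP => ?; lra. Qed.

Lemma r_pred_lt0 : r - 1 < 0.
Proof. by rewrite r_pred oppr_lt0 divr_gt0//; have := p2 => ?; lra. Qed.

(** As r - 1 < 0, the lower bound on [W] becomes an upper bound on S^(r - 1). The additive constant
    is absorbed because (x (1 - x))^(r - 1) >= 1. *)
Lemma third_edge_bound : exists2 C : R, 0 < C &
  forall x, 0 < x -> x < 1 -> `|T x| <= C * (x * (1 - x)) `^ (r - 1).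
Proof.
have p2' := p2; have r1 := r_pred_lt0.
have [C1 [C2 [C10 C20 H]]] := third_bound E.
have [kap kap0 Hk] := W_lower_bound E.
have p0 : 0 < p by lra.
pose k' := p^-1 * kap.
have k'0 : 0 < k' by rewrite mulr_gt0 ?invr_gt0.
exists (C1 * k' `^ (r - 1) + C2).
  by rewrite addr_gt0// mulr_gt0// powR_gt0.
move=> x x0 x1; have [h _] := H x (ltW x0) (ltW x1).
have X0 : 0 < x * (1 - x) by rewrite mulr_gt0// subr_gt0.
have X1 : x * (1 - x) <= 1 by rewrite mulr_ile1//; lra.
have hS : S x `^ (r - 1) <= k' `^ (r - 1) * (x * (1 - x)) `^ (r - 1).
  rewrite -powRM; [|exact: ltW|exact: ltW].
  apply: powR_antitone; [exact: mulr_gt0| |exact: ltW].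
  by rewrite /k' /S -mulrA ler_pM2l ?invr_gt0// Hk// ltW.
have one : 1 <= (x * (1 - x)) `^ (r - 1).
  by have := powR_antitone X0 X1 (ltW r1); rewrite powR1.
apply: (le_trans h); rewrite mulrDl lerD//; last by rewrite ler_peMr// ltW.
by rewrite -mulrA ler_pM2l.
Qed.

(** The upper limit on q says exactly that the edge exponent (r - 1) q exceeds -1. *)
Lemma third_power_integrable q : 1 <= q -> q < (p - 1) / (p - 2) ->
  leb.-integrable I01 (EFin \o (fun x => `|T x| `^ q)).
Proof.
move=> q1 qp; have p2' := p2.
have [C C0 hC] := third_edge_bound.
have q0 : 0 <= q by lra.
have s1 : -1 < (r - 1) * q.
  rewrite r_pred mulNr ltrN2 mulrAC ltr_pdivrMr; last lra.
  rewrite mul1r mulrC -ltr_pdivlMr//; lra.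
have s0 : (r - 1) * q <= 0 by rewrite mulr_le0_ge0// ltW// r_pred_lt0.
have ie := edge_integrable s1 s0.
apply: (@integrable_le_bound _ _ (fun x => C `^ q * (x * (1 - x)) `^ ((r - 1) * q) +
    0 * (x * (1 - x)) `^ ((r - 1) * q))).
- apply: (@measurableT_comp _ _ _ _ _ _ (@powR R ^~ q)) => //.
  apply: measurableT_comp => //.
  exact: (third_measurable E (m_measurable E)).
- exact: integrable_lin.
- move=> x /=; rewrite in_itv/= => /andP[x0 x1]; rewrite mul0r addr0.
  rewrite (ger0_norm (powR_ge0 _ _)) powRrM -powRM ?(ltW C0) ?powR_ge0//.
  by apply: powR_homo => //; exact: hC.
Qed.

Lemma third_integrable : leb.-integrable I01 (EFin \o T).
Proof.
have p2' := p2.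
have : leb.-integrable I01 (EFin \o (fun x => `|T x| `^ 1)).
  apply: third_power_integrable => //.
  by rewrite ltr_pdivlMr; lra.
move=> i1; apply: integrable_le_bound i1 _.
  exact: (third_measurable E (m_measurable E)).
by move=> x _; rewrite powRr1.
Qed.

Lemma superquadratic_regularity q : 1 <= q -> q < (p - 1) / (p - 2) -> in_W 3 q u.
Proof.
move=> q1 qp; have q0 : 0 <= q by lra.
have IJ x : I01 x -> 0 <= x /\ x <= 1.
  by rewrite /= in_itv/= => /andP[? ?]; split; exact: ltW.
have w3 := third_weak_deriv E third_integrable; have [w1 w2] := lower_weak_derivs E.
exists (fun j => match j with 0%N => u | 1%N => U1 | 2%N => U2 | _ => T end).
split=> //; split; last by case=> [|[|[|//]]].
have cI h : {within J01, continuous h} -> in_Lq q h.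
  move=> ch; have [L L0 hL] := within_continuous_bounded ch.
  apply: (@bounded_in_Lq _ _ L) => //; last by move=> x /IJ[]; exact: hL.
  apply: (@measurable_funS _ _ _ _ J01) => //; first exact: subset_itv_oo_cc.
  exact: (@within_continuous_measurable R 0 1).
have [_ [cu [cU1 cU2]]] := classical_C2 E.
case=> [|[|[|[|//]]]] _; [exact: cI|exact: cI|exact: cI|].
apply: integrable_in_Lq; first exact: (third_measurable E (m_measurable E)).
exact: third_power_integrable.
Qed.

(** On [0, del] the mass is M > c, so the numerator of the singular term does not vanish. Since [W]
    is Lipschitz with W(0) = 0, S is at most a multiple of x, which bounds S^(r - 1) from below. *)
Lemma third_lower_bound : exists C1 C2, [/\ 0 < C1, 0 < C2 &
  forall x, 0 < x -> x <= del -> C1 * x `^ (r - 1) <= `|T x| + C2].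
Proof.
have p2' := p2; have r1 := r_pred_lt0; have p0 : 0 < p by lra.
have [C1 [C2 [_ C20 H]]] := third_bound E.
have [b0 b00 hb] := speed_bounds E.
have [c0 cM] := multiplier_bounds E.
have [L L0 hL] := W_density_bound E.
have r0 := r_gt0 E.
have d0 := el_del0 E; have d1 := el_del1 E.
pose L' := p^-1 * L; have L'0 : 0 < L' by rewrite mulr_gt0 ?invr_gt0.
have rp : 0 < r / p by rewrite divr_gt0.
have Mc : 0 < M - c by rewrite subr_gt0.
have P0 : 0 < L' `^ (r - 1) by rewrite powR_gt0.
exists (r / p * (L' `^ (r - 1) * (M - c) * (b0 * b0))), C2; split=> //.
  by apply: mulr_gt0 => //; apply: mulr_gt0; apply: mulr_gt0.
move=> x x0 xd; have x1 : x <= 1 by lra.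
have [_ h2] := H x (ltW x0) x1.
have Sx : S x <= L' * x.
  rewrite /S /L' -mulrA ler_pM2l ?invr_gt0//.
  have := prim_lipschitz (el_pW E) hL (lexx 0) ler01 (ltW x0) x1.
  rewrite (el_W0 E) !subr0 (gtr0_norm x0); apply: le_trans; exact: ler_norm.
have Sp : 0 < S x by apply: (S_gt0 E) => //; lra.
have hS : L' `^ (r - 1) * x `^ (r - 1) <= S x `^ (r - 1).
  rewrite -powRM; [|exact: ltW|exact: ltW].
  by apply: powR_antitone => //; exact: ltW.
have hA : b0 * b0 <= (A x)^-1 * (A x)^-1.
  by apply: ler_pM; rewrite ?(ltW b00) ?hb// ltW.
pose X := r / p * (S x `^ (r - 1) * (m x - c) * ((A x)^-1 * (A x)^-1)).
pose Y := (S x `^ r * S x `^ r) * ((A x)^-1 * (A x)^-1) * (B x * (A x)^-1).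
have TE : T x = - X - Y by rewrite /T /third mulNr.
have hX : r / p * (L' `^ (r - 1) * (M - c) * (b0 * b0)) * x `^ (r - 1) <= X.
  rewrite /X (el_mM E (ltW x0) xd).
  have -> : r / p * (L' `^ (r - 1) * (M - c) * (b0 * b0)) * x `^ (r - 1) =
     r / p * (L' `^ (r - 1) * x `^ (r - 1) * (M - c) * (b0 * b0)) by ring.
  rewrite ler_pM2l//; apply: ler_pM => //.
  - by rewrite !mulr_ge0 ?powR_ge0// ltW.
  - by rewrite mulr_ge0// ltW.
  - by rewrite ler_pM2r.
have : X <= `|T x| + `|Y|.
  rewrite TE; have := ler_norm (- (- X - Y)); rewrite normrN.
  by have := ler_norm (- Y); rewrite normrN; lra.
by rewrite -/Y in h2; lra.
Qed.

(** At the endpoint exponent, (r - 1) q = -1, so an integrable |u'''|^q would yield an integrable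
    function dominating 1 / x near 0. *)
Lemma superquadratic_optimality : ~ in_W 3 ((p - 1) / (p - 2)) u.
Proof.
have p2' := p2; set q := (p - 1) / (p - 2).
move=> [g [g0 [gL gw]]].
have q0 : 0 < q by rewrite /q divr_gt0; lra.
have [w1 w2] := lower_weak_derivs E.
have w3 := third_weak_deriv E third_integrable.
have e0 : {ae leb, forall x, I01 x -> g 0%N x = u x} by apply/aeW => x _; rewrite g0.
have e1 := weak_deriv_unique (gw 0%N isT) w1 e0.
have e2 := weak_deriv_unique (gw 1%N isT) w2 e1.
have e3 := weak_deriv_unique (gw 2%N isT) w3 e2.
have i3 := in_Lq_integrable (gL 3%N isT).
have mT := third_measurable E (m_measurable E).
have mTq : measurable_fun I01 (fun x => `|T x| `^ q).
  apply: (@measurableT_comp _ _ _ _ _ _ (@powR R ^~ q)) => //.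
  exact: measurableT_comp.
have iT : leb.-integrable I01 (EFin \o (fun x => `|T x| `^ q)).
  apply/integrableP; split; first exact/measurable_EFinP.
  case/integrableP: i3 => m3; rewrite (@ae_eq_integral _ _ R leb I01
    (fun x => `|(EFin \o (fun x => (`|T x| `^ q)%R)) x|)%E)//.
  - by apply: measurableT_comp.
  - by apply: measurableT_comp => //; exact/measurable_EFinP.
  apply: filterS e3; first exact: (ae_filter_ringOfSetsType leb).
  by move=> x Hx Ix /=; rewrite Hx.
have [C1 [C2 [C10 C20 H]]] := third_lower_bound.
have d0 := el_del0 E; have d1 := el_del1 E.
(* Comes from raising the lower bound to the power q: [powR_add_le] contributes 2^q, and the
   division isolates 1 / x. *)
pose K := 2 `^ q / C1 `^ q.
have C1q : 0 < C1 `^ q by rewrite powR_gt0.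
have i1 : leb.-integrable I01 (EFin \o (fun=> 1)).
  by apply: integrable_cc_oo; have [] := prim_id (0 : R) 1.
apply: (@not_integrable_reciprocal _ del (fun x => K * `|T x| `^ q + (K * C2 `^ q) * 1)) => //.
- by lra.
- exact: integrable_lin.
move=> x x0 xd.
have rq : (r - 1) * q = -1 by rewrite r_pred /q; field; apply/andP; split; apply/eqP => ?; lra.
have : (C1 * x `^ (r - 1)) `^ q <= (`|T x| + C2) `^ q.
  by apply: powR_homo; [exact: ltW|rewrite mulr_ge0 ?powR_ge0// ltW|exact: H].
rewrite powRM ?powR_ge0 ?(ltW C10)// -powRrM rq powR_inv1 ?(ltW x0)// => h.
have h' := le_trans h (powR_add_le (ltW q0) (normr_ge0 (T x)) (ltW C20)).
rewrite -(ler_pM2l C1q); apply: (le_trans h').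
by rewrite le_eqVlt; apply/orP; left; apply/eqP; rewrite /K; field; rewrite gt_eqF.
Qed.

End superquadratic.

(** * The tent obstacle *)

Section tent.
Context {R : realType}.
Local Notation leb := (@lebesgue_measure R).
Local Notation I01 := (`]0%R, 1%R[%classic : set R).
Local Notation J01 := (`[0%R, 1%R]%classic : set R).
Implicit Types (a b x y s t d e K q : R) (f g h k F D : R -> R).

Definition tent x : R := 1/4 - `|x - 1/2|.

Lemma tent_obstacle : obstacle tent.
Proof.
split.
  apply: continuous_subspaceT => x; apply: cvgB; first exact: cvg_cst.
  apply: (@continuous_comp R R R (fun x => x - 1/2) Num.norm).
    by apply: cvgB; [exact: cvg_id|exact: cvg_cst].
  exact: norm_continuous.
split; first by rewrite /tent ler0_norm; lra.
split; first by rewrite /tent ger0_norm; lra.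
by exists (1/2); rewrite /tent subrr normr0; split; [lra|split; lra].
Qed.

(** The bound on h keeps x - h and x + h on the same side of the peak. *)
Lemma tent_affine x (h : R) : 0 <= h -> h <= `|x - 1/2| ->
  tent x = 1/2 * tent (x - h) + (1 - 1/2) * tent (x + h).
Proof.
rewrite /tent => h0; have [xh|xh] := leP 0 (x - 1/2).
- rewrite (ger0_norm xh) => hx.
  have a1 : 0 <= x - h - 1/2 by lra.
  have a2 : 0 <= x + h - 1/2 by lra.
  by rewrite (ger0_norm a1) (ger0_norm a2); lra.
- rewrite (ltr0_norm xh) => hx.
  have a1 : x - h - 1/2 <= 0 by lra.
  have a2 : x + h - 1/2 <= 0 by lra.
  by rewrite (ler0_norm a1) (ler0_norm a2); lra.
Qed.

(** Right difference quotients are 0 and left ones are at least K, so l cannot lie within K / 4 of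
    both. *)
Lemma kink_not_derivable F x l d K : 0 < d -> 0 < K -> is_derive x 1 F l ->
  (forall y, x < y -> y < x + d -> F y = F x) ->
  (forall y, x - d < y -> y < x -> K * (x - y) <= F x - F y) -> False.
Proof.
move=> d0 K0 dF Hr Hl.
have e0 : 0 < K / 4 by lra.
have [d' d'0 H] := is_derive_dist dF e0.
pose h := Num.min d d' / 2.
have m0 : 0 < Num.min d d' by rewrite lt_min d0.
have m1 : Num.min d d' <= d by rewrite ge_min lexx.
have m2 : Num.min d d' <= d' by rewrite ge_min lexx orbT.
have h0 : 0 < h by rewrite /h; lra.
have hd : h < d by rewrite /h; lra.
have hd' : h < d' by rewrite /h; lra.
have r1 := H (x + h); have l1 := H (x - h).
have E1 : x + h - x = h by ring.
have E2 : x - h - x = - h by ring.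
rewrite E1 (gtr0_norm h0) in r1; rewrite E2 normrN (gtr0_norm h0) in l1.
have {}r1 := r1 hd'; have {}l1 := l1 hd'.
have FE : F (x + h) = F x by apply: Hr; lra.
rewrite FE subrr sub0r normrN normrM (gtr0_norm h0) ler_pM2r// in r1.
have Hl' := Hl (x - h) ltac:(lra) ltac:(lra).
have E3 : x - (x - h) = h by ring.
rewrite E3 in Hl'.
have lh : l * h <= K / 4 * h.
  by rewrite ler_pM2r//; exact: le_trans (ler_norm _) r1.
have Kh : 0 < K * h by rewrite mulr_gt0.
move: l1; rewrite ler_norml mulrN opprK => /andP[l1 _].
have E4 : K / 4 * h = (K * h) / 4 by ring.
by rewrite E4 in lh l1; lra.
Qed.

Variables (G : R -> R) (p : R) (v U1 W m : R -> R) (c M del : R).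
Hypothesis E : EL_data G p v U1 W m c M del.

(** At another contact point the tent is affine on a small symmetric segment, so strict concavity
    would put v(x) strictly above the tent. The ends are excluded because the tent is negative
    there. *)
Lemma contact_tent x : (forall y, J01 y -> tent y <= v y) ->
  0 <= x -> x <= 1 -> v x = tent x -> x = 1/2.
Proof.
move=> vt x0 x1 vx; apply/eqP/negPn/negP => xh.
have xn0 : x != 0.
  apply/negP => /eqP x00; move: vx; rewrite x00 (el_u0 E) /tent ler0_norm; lra.
have xn1 : x != 1.
  apply/negP => /eqP x11; move: vx; rewrite x11 (el_u1 E) /tent ger0_norm; lra.
have {}x0 : 0 < x by rewrite lt_neqAle eq_sym xn0.
have {}x1 : x < 1 by rewrite lt_neqAle xn1.
pose h := Num.min (Num.min x (1 - x)) `|x - 1/2|.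
have h0 : 0 < h by rewrite /h !lt_min x0 subr_gt0 x1 normr_gt0 subr_eq0.
have h1 : h <= x by rewrite /h !ge_min lexx.
have h2 : h <= 1 - x by rewrite /h !ge_min lexx orbT.
have h3 : h <= `|x - 1/2| by rewrite /h !ge_min lexx orbT.
have := strictly_concave E (x := x - h) (y := x + h) (t := 1/2)
  ltac:(lra) ltac:(lra) ltac:(lra) ltac:(lra) ltac:(lra).
have -> : 1/2 * (x - h) + (1 - 1/2) * (x + h) = x by field.
have := vt (x - h); have := vt (x + h); rewrite /= !in_itv/=.
move=> /(_ ltac:(apply/andP; split; lra)) t1 /(_ ltac:(apply/andP; split; lra)) t2.
have := tent_affine (ltW h0) h3; rewrite vx; lra.
Qed.

(** If v were C^3, then W = p (- v'' A)^(p - 1) would be differentiable at 1/2, the base being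
    positive there. But its density jumps at 1/2 together with [m]. This works for every p > 1. *)
Lemma kink_of_atom : (forall t, 0 <= t -> t <= 1/2 -> m t = M) ->
  (forall t, 1/2 < t -> t <= 1 -> m t = 0) -> ~ C3_open v.
Proof.
move=> mM m0 [v1 [v2 [v3 [dv _]]]].
have p1 := el_p E; have p0 : 0 < p by lra.
have [dC _] := classical_C2 E.
pose U2 := curv G p U1 W; pose A x := derive1 G (U1 x).
have I x : 0 < x -> x < 1 -> I01 x by rewrite /= in_itv/= => -> ->.
have dval f x l l' : is_derive x 1 f l -> is_derive x 1 f l' -> l = l'.
  by move=> [_ <-] [_ <-].
have nI x : 0 < x -> x < 1 -> \forall y \near x, 0 < y /\ y < 1.
  move=> x0 x1; near=> y; split; near: y; [exact: lt_nbhsr|exact: lt_nbhsl].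
have e1 x : 0 < x -> x < 1 -> v1 x = U1 x.
  by move=> x0 x1; have [d1 _] := dv x (I x x0 x1); have [d2 _] := dC x (I x x0 x1); exact: dval d1 d2.
have e2 x : 0 < x -> x < 1 -> v2 x = U2 x.
  move=> x0 x1; have [_ [d1 _]] := dv x (I x x0 x1); have [_ d2] := dC x (I x x0 x1).
  have d1' : is_derive x 1 U1 (v2 x).
    apply: near_eq_is_derive d1; near=> y.
    have [y0 y1] : 0 < y /\ y < 1 by near: y; exact: nI.
    exact: e1.
  exact: dval d1' d2.
pose x : R := 1/2; have x0 : 0 < x by rewrite /x; lra.
have x1 : x < 1 by rewrite /x; lra.
have dU2 : is_derive x 1 U2 (v3 x).
  have [_ [_ d1]] := dv x (I x x0 x1).
  apply: near_eq_is_derive d1; near=> y.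
  have [y0 y1] : 0 < y /\ y < 1 by near: y; exact: nI.
  exact: e2.
have dA : is_derive x 1 A (derive1n 2 G (U1 x) * U2 x).
  have [_ d2] := dC x (I x x0 x1).
  exact: (@is_derive1_comp R (derive1 G) U1 x _ _ (Gdot_derive (el_G E) _) d2).
have A0 y : 0 < A y := speed_gt0 E y.
have WE y : 0 < y -> y < 1 -> W y = p * (-1 * (U2 y * A y) + 0 * 0) `^ (p - 1).
  move=> y0 y1; rewrite mul0r addr0 /U2 (curvE E (ltW y0) (ltW y1)) mulN1r mulNr opprK.
  rewrite divfK ?gt_eqF//; last exact: A0.
  rewrite -powRrM mulVf; last by apply/eqP => ?; lra.
  rewrite powRr1; first by rewrite mulrA divff ?mul1r// gt_eqF.
  by rewrite mulr_ge0 ?invr_ge0 ?(ltW p0)// ltW// (W_gt0 E).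
have [l dW] : exists l, is_derive x 1 W l.
  (* The null summand 0 * 0 in this and the surrounding formulas only matches the two-term shape of
     [is_derive_lin]. *)
  have dUA := is_derive_lin (-1) 0 (is_derive_mul dU2 dA) (is_derive_cst (0 : R) x 1).
  have pos : 0 < -1 * (U2 x * A x) + 0 * 0.
    rewrite mul0r addr0 mulN1r oppr_gt0 pmulr_llt0//.
    exact: (curv_lt0 E).
  have dP := @is_derive1_comp R (@powR R ^~ (p - 1)) _ x _ _ (is_derive1_powR (p - 1) pos) dUA.
  have dpP := is_derive_lin p 0 dP (is_derive_cst (0 : R) x 1).
  eexists; apply: near_eq_is_derive dpP; near=> y.
  have [y0 y1] : 0 < y /\ y < 1 by near: y; exact: nI.
  by rewrite (WE y y0 y1) /= [0 * 0]mul0r addr0.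
have cAV := inv_speed_continuous E.
have pY := prim_int (within_continuous_integrable cAV).
have dY := prim_is_derive pY cAV x0 x1.
have dQ := is_derive_lin 1 c dW dY.
(* Adding c times the primitive of 1 / A removes the multiplier: the density becomes m / A, which is
   zero to the right of 1/2 and at least M b0 to the left. *)
pose Q y := 1 * W y + c * \int[leb]_(t in `[0, y]) (A t)^-1.
have pQ : prim 0 1 Q (fun t => m t / A t).
  apply: prim_eq (prim_lin 1 c (el_pW E) pY) _ _ => // t _ _.
  by rewrite -/(A t); ring.
have M0 := contact_mass_gt0 E.
have [b0 b00 hb] := speed_bounds E.
have [KA KA0 hKA] := within_continuous_bounded cAV.
have bQ t : 0 <= t -> t <= 1 -> `|m t / A t| <= M * KA.
  move=> t0 t1; rewrite normrM ler_pM//; last exact: hKA.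
  by rewrite ger0_norm ?(el_m_ge0 E)// (tail_le_mass E).
apply: (@kink_not_derivable Q x _ (1/2) (M * b0) _ _ dQ).
- by lra.
- by rewrite mulr_gt0.
- move=> y xy yx; have y1 : y < 1 by rewrite /x in yx; lra.
  apply/eqP; rewrite -subr_eq0 -normr_le0; apply/ler_addgt0Pr => e e0.
  have MK : 0 < M * KA by rewrite mulr_gt0.
  (* Since [m] vanishes only strictly beyond 1/2, Q is first shown constant on [z, y]; the Lipschitz
     bound makes the remaining gap from 1/2 to z cost at most e. *)
  pose z := Num.min y (x + e / (M * KA)).
  have z1 : z <= y by rewrite /z ge_min lexx.
  have z2 : z <= x + e / (M * KA) by rewrite /z ge_min lexx orbT.
  have z0 : x < z by rewrite /z lt_min xy ltrDl divr_gt0.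
  have Qyz : Q y = Q z.
    apply/eqP; rewrite -subr_eq0 eq_le; apply/andP; split.
      have := @prim_le _ _ _ _ _ 0 z y pQ (ltW (lt_trans x0 z0)) z1 (ltW y1); rewrite mul0r; apply.
      by move=> t zt ty; rewrite m0 ?mul0r//; rewrite /x in z0; lra.
    have := @prim_ge _ _ _ _ _ 0 z y pQ (ltW (lt_trans x0 z0)) z1 (ltW y1); rewrite mul0r; apply.
    by move=> t zt ty; rewrite m0 ?mul0r//; rewrite /x in z0; lra.
  rewrite Qyz add0r.
  apply: (le_trans (prim_lipschitz pQ bQ (ltW x0) (ltW x1) (ltW (lt_trans x0 z0)) (le_trans z1 (ltW y1)))).
  rewrite gtr0_norm ?subr_gt0// mulrC -ler_pdivlMr//.
  by rewrite lerBlDl.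
- move=> y xy yx; apply: (prim_ge pQ); [rewrite /x in xy; lra|exact: ltW|exact: ltW|].
  move=> t yt tx; rewrite mM; [|rewrite /x in xy; lra|by []].
  by rewrite ler_pM2l// hb//; rewrite /x in xy tx; lra.
Unshelve. all: by end_near. Qed.

End tent.

(** All mass sits at the single point 1/2, which belongs to [t, 1] exactly when t <= 1/2. *)
Lemma tent_no_C3 (R : realType) (G : R -> R) p (v : R -> R) : standing_G G -> 1 < p ->
  critical_point G p (@tent R) v -> ~ C3_open v.
Proof.
move=> sG p1 crit.
have [U1 [W [c [M [del [mu [E [mufin [mC muC]]]]]]]]] :=
  critical_EL_data sG p1 tent_obstacle crit.
have [[_ vt] _] := crit.
have ct x : 0 <= x -> x <= 1 -> v x = tent x -> x = 1/2 := contact_tent E vt.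
have M0 : tail mu 0 = M by apply: (el_mM E) => //; exact: ltW (el_del0 E).
apply: (kink_of_atom E) => t.
- move=> t0 th; rewrite -M0; apply/eqP; rewrite eq_le tail_nonincreasing//=.
  apply: (tail_le_off_contact mufin mC muC) => // x /=; rewrite !in_itv/= => /andP[h0 h1].
  have [tx|xt] := leP t x; first by left.
  right=> -[_ ux]; have := ct x h0 h1 ux => xe.
  by move: (lt_le_trans xt th); rewrite xe ltxx.
- move=> th t1; apply/eqP; rewrite eq_le tail_ge0 andbT.
  have := @tail_le_off_contact R mu _ set0 t mufin mC muC measurable0.
  rewrite measure0; apply => x /=; rewrite in_itv/= => /andP[h0 h1]; right=> -[Jx ux].
  move: Jx; rewrite in_itv/= => /andP[x0 _].
  have xe := ct x x0 h1 ux.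
  by move: (lt_le_trans th h0); rewrite xe ltxx.
Qed.

Theorem theorem1p1 (R : realType) (G : R -> R) (p : R) (psi u : R -> R) :
  standing_G G -> obstacle psi -> 1 < p ->
  critical_point G p psi u ->
  (exists u1 u2 : R -> R,
     C2_closed u u1 u2 /\
     (forall x, 0 < x -> x < 1 -> u2 x < 0) /\ u2 0 = 0 /\ u2 1 = 0) /\
  concave_on01 u /\
  (p <= 2 ->
     (exists g : nat -> R -> R,
        sobolev_witness 3 (@in_Linf R) u g /\ in_BV (g 3%N)) /\
     (exists psi' : R -> R, obstacle psi' /\
        forall v : R -> R, critical_point G p psi' v -> ~ C3_open v)) /\
  (2 < p ->
     (forall q : R, 1 <= q -> q < (p - 1) / (p - 2) -> in_W 3 q u) /\
     ~ in_W 3 ((p - 1) / (p - 2)) u).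
Proof.
move=> sG ob p1 crit.
have [U1 [W [c [M [del [mu [E _]]]]]]] := critical_EL_data sG p1 ob crit.
split.
  exists U1, (curv G p U1 W); split; first exact: (classical_C2 E).
  split; first exact: (curv_lt0 E).
  by split; apply: curv_end; [exact: (el_W0 E)|exact: (el_W1 E)].
split; first exact: (concave E).
split=> [p2|p2].
  split; first exact: (subquadratic_regularity E).
  by exists (@tent R); split; [exact: tent_obstacle|move=> v; exact: tent_no_C3].
by split=> [q|]; [exact: (superquadratic_regularity E)|exact: (superquadratic_optimality E)].
Qed.
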